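(* Let $n$ be a positive integer and let $X$ be a Banach space of genus $n$. Then $X$ is unconditionally primary if and only if $X$ contains a complemented subspace of genus $n-1$.
   Context: Two sequences $(x_n)$, $(y_n)$ in Banach spaces are equivalent, $(x_n)\sim(y_n)$, if $Tx_n=y_n$ defines an isomorphism between their closed linear spans; they are permutatively equivalent if $(x_n)\sim(y_{\pi(n)})$ for some permutation $\pi$ of the index set. A Banach space has a unique normalized unconditional basis if it has a normalized unconditional basis and any two such bases are permutatively equivalent. A Banach space $X$ is of genus $n$ if $X$ and all its complemented subspaces with unconditional bases have a unique normalized unconditional basis, and there are, up to isomorphism, exactly $n$ different (infinite-dimensional) complemented subspaces of $X$ with unconditional bases ($X$ itself included in the count). For example, $\ell_1\oplus\ell_2$ is of genus 3. A Banach space $X$ is unconditionally primary if whenever $X\cong Y\oplus Z$ and $Y$, $Z$ have unconditional bases, then either $X\cong Y$ or $X\cong Z$. Here $\cong$ means linearly isomorphic. *)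

(* Defs.v *)
From mathcomp Require Import all_boot all_order all_algebra.
From mathcomp Require Import complex.
From mathcomp Require Import all_classical all_reals all_analysis.

Set Implicit Arguments.
Unset Strict Implicit.
Unset Printing Implicit Defensive.

Import Order.TTheory GRing.Theory Num.Theory.
Import numFieldNormedType.Exports.
Local Open Scope classical_set_scope.
Local Open Scope ring_scope.

(* Banach spaces are real or complex.  In MathComp-Analysis the norm of a
   normed module over R[i] is R[i]-valued, with nonnegative real values. *)
Inductive scalar_field (R : realType) : numFieldType -> Prop :=
| real_scalars : scalar_field R R
| complex_scalars : scalar_field R R[i].

(* Subspaces are sets of vectors of an ambient normed space: a notion about a
   normed space is defined for a linear subspace E of an ambient space V, and
   the space V itself is the case E = [set: V]. *)

Definition linear_on (K : numFieldType) (V W : normedModType K)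
    (E : set V) (T : V -> W) : Prop :=
  forall (a : K) (u v : V), E u -> E v -> T (a *: u + v) = a *: T u + T v.

Definition is_isomorphism (K : numFieldType) (V W : normedModType K)
    (E : set V) (F : set W) (T : V -> W) : Prop :=
  [/\ linear_on E T,
      set_bij E F T,
      {within E, continuous T} &
      exists S : W -> V,
        {within F, continuous S} /\ {in E, cancel T S}].

Definition isomorphic (K : numFieldType) (V W : normedModType K)
    (E : set V) (F : set W) : Prop :=
  exists T : V -> W, is_isomorphism E F T.

(* F is the range of a continuous linear projection defined on E. *)
Definition complemented (K : numFieldType) (V : normedModType K)
    (E F : set V) : Prop :=
  F `<=` E /\
  exists P : V -> V,
    [/\ linear_on E P, {within E, continuous P}, P @` E = F &
        forall u, F u -> P u = u].

Definition finite_dimensional (K : numFieldType) (V : normedModType K)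
    (E : set V) : Prop :=
  exists (m : nat) (e : 'I_m -> V),
    E = [set \sum_(i < m) a i *: e i | a in [set: 'I_m -> K]].

(* Bases of finite-dimensional spaces are finite, so sequences have a length:
   (x_k) of length N = Some m is indexed by k < m, and by all of nat when
   N = None; the values x k outside the index set are irrelevant. *)
Definition index_set (N : option nat) : set nat :=
  if N is Some m then `I_m else [set: nat].

Definition closed_span (K : numFieldType) (V : normedModType K)
    (N : option nat) (x : nat -> V) : set V :=
  closure [set v | exists (m : nat) (a : nat -> K),
                     v = \sum_(0 <= k < m | k \in index_set N) a k *: x k].

Definition equivalent (K : numFieldType) (V W : normedModType K)
    (N : option nat) (x : nat -> V) (y : nat -> W) : Prop :=
  exists T : V -> W,
    is_isomorphism (closed_span N x) (closed_span N y) T /\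
    forall k, index_set N k -> T (x k) = y k.

Definition permutatively_equivalent (K : numFieldType)
    (V W : normedModType K)
    (N : option nat) (x : nat -> V) (y : nat -> W) : Prop :=
  exists pi : nat -> nat,
    set_bij (index_set N) (index_set N) pi /\ equivalent N x (y \o pi).

Definition expansion (K : numFieldType) (V : normedModType K)
    (N : option nat) (x : nat -> V) (a : nat -> K) (v : V) : Prop :=
  (fun m => \sum_(0 <= k < m | k \in index_set N) a k *: x k) @ \oo --> v.

Definition schauder_basis (K : numFieldType) (V : normedModType K)
    (E : set V) (N : option nat) (x : nat -> V) : Prop :=
  (forall k, index_set N k -> E (x k)) /\
  forall v, E v ->
    exists a : nat -> K, expansion N x a v /\
      forall b : nat -> K, expansion N x b v ->
        forall k, index_set N k -> b k = a k.

Definition unconditional_basis (K : numFieldType) (V : normedModType K)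
    (E : set V) (N : option nat) (x : nat -> V) : Prop :=
  schauder_basis E N x /\
  forall (v : V) (a : nat -> K), E v -> expansion N x a v ->
    forall pi : nat -> nat, set_bij (index_set N) (index_set N) pi ->
      expansion N (x \o pi) (a \o pi) v.

Definition has_unconditional_basis (K : numFieldType) (V : normedModType K)
    (E : set V) : Prop :=
  exists (N : option nat) (x : nat -> V), unconditional_basis E N x.

Definition normalized_unconditional_basis (K : numFieldType)
    (V : normedModType K) (E : set V) (N : option nat) (x : nat -> V) : Prop :=
  unconditional_basis E N x /\ forall k, index_set N k -> `|x k| = 1.

Definition unique_normalized_unconditional_basis (K : numFieldType)
    (V : normedModType K) (E : set V) : Prop :=
  (exists (N : option nat) (x : nat -> V),
     normalized_unconditional_basis E N x) /\
  forall (N M : option nat) (x y : nat -> V),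
    normalized_unconditional_basis E N x ->
    normalized_unconditional_basis E M y ->
    N = M /\ permutatively_equivalent N x y.

(* The complemented subspaces counted by the genus. *)
Definition genus_subspace (K : numFieldType) (V : normedModType K)
    (E F : set V) : Prop :=
  [/\ complemented E F, has_unconditional_basis F & ~ finite_dimensional F].

(* Finite-dimensional spaces are exactly the spaces of genus 0. *)
Definition genus (K : numFieldType) (V : normedModType K)
    (n : nat) (E : set V) : Prop :=
  [/\ unique_normalized_unconditional_basis E,
      forall F : set V, complemented E F -> has_unconditional_basis F ->
        unique_normalized_unconditional_basis F &
      exists Y : 'I_n -> set V,
        [/\ forall i, genus_subspace E (Y i),
            forall i j, isomorphic (Y i) (Y j) -> i = j &
            forall F : set V, genus_subspace E F ->
              exists i, isomorphic F (Y i)]].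

Definition unconditionally_primary (K : numFieldType)
    (X : completeNormedModType K) : Prop :=
  forall Y Z : completeNormedModType K,
    has_unconditional_basis [set: Y] -> has_unconditional_basis [set: Z] ->
    isomorphic [set: X] [set: (Y * Z)%type] ->
    isomorphic [set: X] [set: Y] \/ isomorphic [set: X] [set: Z].

(* Main.v *)
From HB Require Import structures.
Require Import Defs.
From mathcomp Require Import all_boot all_order all_algebra.
From mathcomp Require Import complex.
From mathcomp Require Import all_classical all_reals all_analysis.

From mathcomp Require Import ring.

Set Implicit Arguments.
Unset Strict Implicit.
Unset Printing Implicit Defensive.

Import Order.TTheory GRing.Theory Num.Theory.
Import numFieldNormedType.Exports.
Local Open Scope classical_set_scope.
Local Open Scope ring_scope.

(** Everything rests on one fact: if X has some finite genus, then every
    infinite-dimensional complemented subspace F of X with an unconditional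
    basis is isomorphic to its square (genus_subspace_square).

    Granted this, Pelczynski's decomposition method shows that two such
    subspaces, each complemented in the other, are isomorphic, so that the
    classes counted by the genus are ordered by complemented embedding, with X
    at the top.  If X is unconditionally primary, the sum of two classes other
    than X embeds complementably in X + X = X and is again not X; hence the sum
    W of all the classes other than X is not X, its classes are exactly the
    n - 1 classes other than X, and W has genus n - 1.  Conversely, let Y be
    complemented in X and have genus n - 1.  A count shows that X does not
    embed complementably in Y, whose classes are therefore all the classes
    other than X.  If X = U + V and neither summand is X, then both embed
    complementably in Y, and so does X = U + V in Y + Y = Y: a contradiction.

    For the square, let x be the normalized unconditional basis of F.  Every
    infinite set S of indices spans a complemented subspace of X, and when the
    spans of S and S' are isomorphic the uniqueness of normalized bases makes
    the two subsequences equivalent up to a permutation.  So the infinite sets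
    of indices fall into finitely many types, two sets of the same type being
    equivalent.  It remains to find two disjoint sets of indices over each of
    which the subsequence is equivalent to x (finitely_many_types_doubling); a
    Cantor-Bernstein argument then arranges that they partition the index set
    (doubling_partition).  If for some S neither S nor its complement contains
    a copy of x, both have fewer types than x, and their doublings, which exist
    by induction, are glued by unconditionality.  Otherwise, if there were no
    two disjoint copies of x, the sets that contain one would form an
    ultrafilter.  It is an analytic family of sets, since being a copy with a
    given equivalence constant is a closed condition, and it is preserved by the
    removal of finite sets, because x has copies in all its tails, by a
    pigeonhole argument (embeds_tail); a category argument shows that no such
    ultrafilter exists (disjoint_ranges).

    The passage between bases, defined by expansions, and inequalities between
    norms of finite sums is provided by family_basis and by
    basis_unconditional, which is a form of the open mapping theorem. *)

(** * Real and complex scalars, limits and completeness *)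

Section SequencesInNormedGroups.
Variables (K : numFieldType) (V : normedZmodType K).

Definition seq_lim (u : nat -> V) (l : V) : Prop :=
  forall e, 0 < e -> exists N, forall n, (N <= n)%N -> `|u n - l| <= e.

Definition seq_cauchy (u : nat -> V) : Prop :=
  forall e, 0 < e -> exists N, forall n, (N <= n)%N -> `|u n - u N| <= e.

Definition seq_complete : Prop :=
  forall u, seq_cauchy u -> exists l, seq_lim u l.

End SequencesInNormedGroups.
Arguments seq_complete {K} V.

Definition archimedean_norm (K : numFieldType) : Prop :=
  forall a : K, exists n : nat, `|a| <= n%:R.

Section Limits.
Variable K : numFieldType.

Lemma norm_le_eps (V : normedZmodType K) (v : V) (c : K) :
  (forall e, 0 < e -> `|v| <= c + e) -> `|v| <= c.
Proof. by move=> h; apply/ler_addgt0Pr. Qed.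

Lemma norm_eq0_eps (V : normedZmodType K) (v : V) :
  (forall e, 0 < e -> `|v| <= e) -> v = 0.
Proof.
move=> h; apply/normr0_eq0/le_anti; rewrite normr_ge0 andbT.
by apply/ler_addgt0Pr => e /h; rewrite add0r.
Qed.

Lemma divn_gt0_eps (e : K) (n : nat) : 0 < e -> 0 < e / n.+1%:R.
Proof. by move=> e0; rewrite divr_gt0// ltr0n. Qed.

Lemma mul_eps (e : K) (n : nat) : 0 < e -> n%:R * (e / n.+1%:R) <= e.
Proof.
move=> e0; rewrite mulrA ler_pdivrMr ?ltr0n// mulrC.
by rewrite ler_wpM2l ?ler_nat// ltW.
Qed.

Lemma seq_lim_unique (V : normedZmodType K) (u : nat -> V) l l' :
  seq_lim u l -> seq_lim u l' -> l = l'.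
Proof.
move=> ul ul'; apply/subr0_eq/norm_eq0_eps => e e0.
have [N1 h1] := ul _ (divn_gt0_eps 1 e0).
have [N2 h2] := ul' _ (divn_gt0_eps 1 e0).
have := h1 _ (leq_maxl N1 N2); have := h2 _ (leq_maxr N1 N2).
move: (maxn _ _) => n H2 H1.
rewrite (splitr e) (_ : l - l' = - (u n - l) + (u n - l')).
  by rewrite (le_trans (ler_normD _ _))// normrN lerD.
by rewrite opprB addrA subrK.
Qed.

Lemma cvg_seq_lim (V : normedModType K) (u : nat -> V) l :
  u @ \oo --> l <-> seq_lim u l.
Proof.
split=> [/cvgrPdist_le h e e0|h].
  have [N _ hN] := h _ e0; exists N => n Nn.
  by rewrite distrC; apply: hN.
apply/cvgrPdist_le => e e0; have [N hN] := h _ e0.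
by exists N => // n Nn; rewrite /= distrC; apply: hN.
Qed.

Lemma complete_seq (V : completeNormedModType K) : seq_complete V.
Proof.
move=> u cu.
have : cauchy (u @ \oo).
  apply: cauchy_exP => e e0.
  have e2 : 0 < e / 2 by rewrite divr_gt0.
  have [N hN] := cu _ e2; exists (u N); exists N => // n Nn.
  rewrite -ball_normE /ball_/= distrC (le_lt_trans (hN _ Nn))//.
  by rewrite ltr_pdivrMr// ltr_pMr// ltr1n.
move=> /cauchy_cvg/cvg_ex[l /cvg_seq_lim ul]; by exists l.
Qed.

Lemma norm_fst_le (V W : normedZmodType K) (w : V * W) : `|w.1| <= `|w|.
Proof.
by rewrite prod_normE comparable_le_max ?lexx// real_comparable ?normr_real.
Qed.

Lemma norm_snd_le (V W : normedZmodType K) (w : V * W) : `|w.2| <= `|w|.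
Proof.
by rewrite prod_normE comparable_le_max ?lexx ?orbT// real_comparable ?normr_real.
Qed.

Lemma norm_pair_le (V W : normedZmodType K) (w : V * W) (c : K) :
  `|w.1| <= c -> `|w.2| <= c -> `|w| <= c.
Proof. by move=> h1 h2; rewrite prod_normE /Num.max; case: ifP. Qed.

Lemma seq_complete_prod (V W : normedModType K) :
  seq_complete V -> seq_complete W -> seq_complete (V * W)%type.
Proof.
move=> cV cW u cu.
have [l1 h1] : exists l, seq_lim (fst \o u) l.
  apply: cV => e e0; have [N hN] := cu _ e0; exists N => n /hN.
  exact: le_trans (norm_fst_le (u n - u N)).
have [l2 h2] : exists l, seq_lim (snd \o u) l.
  apply: cW => e e0; have [N hN] := cu _ e0; exists N => n /hN.
  exact: le_trans (norm_snd_le (u n - u N)).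
exists (l1, l2) => e e0.
have [N1 H1] := h1 _ e0; have [N2 H2] := h2 _ e0.
exists (maxn N1 N2) => n; rewrite geq_max => /andP[n1 n2].
by apply: norm_pair_le; [exact: H1|exact: H2].
Qed.

Lemma archimedean_pow2 : archimedean_norm K ->
  forall e : K, 0 < e -> exists n : nat, (2 ^+ n)^-1 <= e.
Proof.
move=> hA e e0; have [n hn] := hA e^-1; exists n.
rewrite -[leRHS]invrK lef_pV2 ?posrE ?invr_gt0 ?exprn_gt0//.
rewrite gtr0_norm ?invr_gt0// in hn; rewrite (le_trans hn)// -natrX ler_nat.
by rewrite ltnW// ltn_expl.
Qed.

(** Geometrically decreasing steps: the form of completeness used for
    successive approximation. *)
Lemma geometric_limit (V : normedZmodType K) (u : nat -> V) (c : K) :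
    archimedean_norm K -> seq_complete V -> 0 <= c ->
    (forall n, `|u n.+1 - u n| <= c / 2 ^+ n.+1) ->
  exists l, seq_lim u l /\ forall n, `|l - u n| <= c / 2 ^+ n.
Proof.
move=> hA cV c0 hu.
have step n k : `|u (n + k)%N - u n| <= c / 2 ^+ n - c / 2 ^+ (n + k).
  elim: k => [|k IH]; first by rewrite addn0 !subrr normr0.
  rewrite addnS (_ : u _ - u n = (u (n + k).+1 - u (n + k)%N)
                                 + (u (n + k)%N - u n)); last first.
    by rewrite addrA subrK.
  rewrite (le_trans (ler_normD _ _))//.
  have -> : c / 2 ^+ n - c / 2 ^+ (n + k).+1
      = c / 2 ^+ (n + k).+1 + (c / 2 ^+ n - c / 2 ^+ (n + k)).
    have -> : c / 2 ^+ (n + k) = c / 2 ^+ (n + k).+1 + c / 2 ^+ (n + k).+1.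
      rewrite -mulrDr exprS invfM -mulrDl; congr (_ * _).
      by rewrite -[LHS]mul1r [X in X * _](splitr 1) !mul1r.
    by ring.
  by rewrite lerD.
have bnd n m : (n <= m)%N -> `|u m - u n| <= c / 2 ^+ n.
  move=> /subnKC <-; rewrite (le_trans (step _ _))// gerBl.
  by rewrite divr_ge0// exprn_ge0.
have [l ul] : exists l, seq_lim u l.
  apply: cV => e e0.
  have [k hk] := hA c.
  have [n hn] := archimedean_pow2 hA (divn_gt0_eps k e0).
  exists n => m nm; rewrite (le_trans (bnd _ _ nm))//.
  rewrite ger0_norm// in hk.
  rewrite (le_trans _ (mul_eps k e0))// ler_pM// invr_ge0 exprn_ge0//.
exists l; split=> // n; apply: norm_le_eps => e e0.
have [N hN] := ul _ e0.
rewrite (_ : l - u n = (u (maxn N n) - u n) - (u (maxn N n) - l)).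
  rewrite (le_trans (ler_normB _ _))// lerD//.
    by rewrite bnd// leq_maxr.
  by rewrite hN// leq_maxl.
by rewrite opprB [RHS]addrC addrA subrK.
Qed.

Lemma closure_eps (V : normedModType K) (A : set V) v :
  closure A v <-> forall e, 0 < e -> exists2 w, A w & `|v - w| <= e.
Proof.
split=> [cA e e0|h B].
  have /cA[w [Aw]] : nbhs v (ball v e) by apply: nbhsx_ballx.
  by rewrite -ball_normE => /ltW ?; exists w.
move=> /nbhs_ballP[e /= e0 eB].
have e2 : 0 < e / 2 by rewrite divr_gt0.
have [w Aw vw] := h _ e2; exists w; split=> //; apply: eB.
rewrite -ball_normE /ball_/= (le_lt_trans vw)//.
by rewrite ltr_pdivrMr// ltr_pMr// ltr1n.
Qed.

End Limits.

Lemma scalar_archimedean (R : realType) (K : numFieldType) :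
  scalar_field R K -> archimedean_norm K.
Proof.
case=> a.
  exists (Num.truncn `|a|).+1; exact/ltW/truncnS_gt.
exists (Num.truncn (complex.Re `|a|)).+1.
rewrite -[`|a|]RRe_real ?normr_real// -(rmorph_nat (real_complex R)) lecR.
exact/ltW/truncnS_gt.
Qed.

Lemma scalar_complete (R : realType) (K : numFieldType) :
  scalar_field R K -> seq_complete K.
Proof.
case; first exact: (@complete_seq R R).
move=> u cu.
have part (f : {additive R[i] -> R}) : (forall z, (`|f z|%:C)%C <= `|z|) ->
    exists l, seq_lim (f \o u) l.
  move=> hf; apply: (@complete_seq R R) => e e0.
  have [|N hN] := cu e%:C%C; first by rewrite ltcR.
  exists N => n Nn; rewrite -lecR/= -raddfB (le_trans (hf _))//.
  exact: hN.
have [l1 h1] := part (@complex.Re R : {additive _ -> _}) (@normc_ge_Re R).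
have hIm (z : R[i]) : (`|complex.Im z|%:C)%C <= `|z|.
  have := normc_ge_Re (z * 'i%C).
  by rewrite ReiNIm normrN normrM complexiE normCi mulr1.
have [l2 h2] := part (@complex.Im R : {additive _ -> _}) hIm.
exists (l1 +i* l2)%C => e e0.
have e2 : 0 < complex.Re e / 2.
  by rewrite divr_gt0//; move: e0; rewrite ltcE => /andP[].
have [N1 H1] := h1 _ e2; have [N2 H2] := h2 _ e2.
exists (maxn N1 N2) => n; rewrite geq_max => /andP[/H1 n1 /H2 n2].
have -> : u n - (l1 +i* l2)%C
    = (complex.Re (u n) - l1)%:C%C + 'i%C * (complex.Im (u n) - l2)%:C%C.
  by rewrite [LHS]complexE !raddfB.
rewrite (le_trans (ler_normD _ _))// normrM complexiE normCi mul1r.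
have -> : e = (complex.Re e / 2 + complex.Re e / 2)%:C%C.
  by rewrite -splitr RRe_real// gtr0_real.
have nC (r : R) : `|(r%:C)%C| = (`|r|%:C)%C.
  by rewrite normc_def /= expr0n /= addr0 sqrtr_sqr.
rewrite [leRHS]rmorphD; by apply: lerD; rewrite nC lecR ?n1 ?n2.
Qed.

(** * Bounded maps, isomorphisms and complemented subspaces *)

Section BoundedMaps.
Variable K : numFieldType.
Hypothesis hA : archimedean_norm K.

Definition is_subspace (V : normedModType K) (E : set V) : Prop :=
  E 0 /\ forall (a : K) u v, E u -> E v -> E (a *: u + v).

Definition seq_closed (V : normedModType K) (E : set V) : Prop :=
  forall v, (forall e, 0 < e -> exists2 w, E w & `|v - w| <= e) -> E v.

Definition bounded_map (V W : normedModType K) (E : set V) (F : set W)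
    (T : V -> W) : Prop :=
  [/\ linear_on E T, forall u, E u -> F (T u) &
      exists C : nat, forall u, E u -> `|T u| <= C%:R * `|u|].

Definition iso (V W : normedModType K) (E : set V) (F : set W) : Prop :=
  exists (T : V -> W) (S : W -> V),
    [/\ bounded_map E F T, bounded_map F E S,
        forall u, E u -> S (T u) = u & forall w, F w -> T (S w) = w].

Definition retract (V W : normedModType K) (E : set V) (F : set W) : Prop :=
  exists (T : V -> W) (S : W -> V),
    [/\ bounded_map E F T, bounded_map F E S & forall u, E u -> S (T u) = u].

Implicit Types V W Z : normedModType K.

Lemma subspaceT V : is_subspace [set: V]. Proof. by []. Qed.

Lemma subspaceZ V (E : set V) a u : is_subspace E -> E u -> E (a *: u).
Proof. by move=> [E0 sE] Eu; rewrite -[_ *: _]addr0; apply: sE. Qed.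

Lemma subspaceD V (E : set V) u v : is_subspace E -> E u -> E v -> E (u + v).
Proof. by move=> [E0 sE] Eu Ev; rewrite -[u]scale1r; apply: sE. Qed.

Lemma subspaceB V (E : set V) u v : is_subspace E -> E u -> E v -> E (u - v).
Proof.
by move=> sE Eu Ev; rewrite -scaleN1r addrC; apply: (proj2 sE).
Qed.

Lemma subspace_sum V (E : set V) (I : Type) (s : seq I) (P : pred I) (f : I -> V) :
  is_subspace E -> (forall i, P i -> E (f i)) -> E (\sum_(i <- s | P i) f i).
Proof.
move=> sE Ef; elim/big_ind: _ => //; first by case: sE.
by move=> u v; exact: subspaceD.
Qed.

Lemma subspace_setX V W (E : set V) (F : set W) :
  is_subspace E -> is_subspace F -> is_subspace (E `*` F).
Proof.
move=> [E0 sE] [F0 sF]; split=> // a u v [? ?] [? ?].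
by split; [apply: sE|apply: sF].
Qed.

Section Linear.
Variables (V W : normedModType K) (E : set V) (T : V -> W).
Hypotheses (sE : is_subspace E) (lT : linear_on E T).

Lemma linear_on0 : T 0 = 0.
Proof.
have := lT (-1) (proj1 sE) (proj1 sE).
by rewrite scaler0 addr0 scaleN1r addNr.
Qed.

Lemma linear_onZ a u : E u -> T (a *: u) = a *: T u.
Proof.
by move=> Eu; have := lT a Eu (proj1 sE); rewrite addr0 linear_on0 addr0.
Qed.

Lemma linear_onD u v : E u -> E v -> T (u + v) = T u + T v.
Proof. by move=> Eu Ev; have := lT 1 Eu Ev; rewrite !scale1r. Qed.

Lemma linear_onB u v : E u -> E v -> T (u - v) = T u - T v.
Proof.
move=> Eu Ev; have := lT (-1) Ev Eu.
by rewrite !scaleN1r ![- _ + _]addrC.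
Qed.

Lemma linear_on_sum (I : Type) (s : seq I) (P : pred I) (a : I -> K) (x : I -> V) :
  (forall i, P i -> E (x i)) ->
  T (\sum_(i <- s | P i) a i *: x i) = \sum_(i <- s | P i) a i *: T (x i).
Proof.
move=> Ex; elim: s => [|i s IH]; first by rewrite !big_nil linear_on0.
rewrite !big_cons; case: ifP => // Pi; rewrite -IH lT//; first exact: Ex.
by apply: subspace_sum => // j /Ex; exact: subspaceZ.
Qed.

End Linear.

Lemma within_continuous_eps V W (E : set V) (T : V -> W) :
  {within E, continuous T} <->
  forall x, E x -> forall e, 0 < e ->
    exists2 d, 0 < d & forall y, E y -> `|y - x| <= d -> `|T y - T x| <= e.
Proof.
rewrite subspace_continuousP; split=> h x Ex.
  move=> e e0; have /cvgrPdist_le/(_ _ e0) := h x Ex.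
  move=> /nbhs_ballP[d /= d0 hd].
  have d2 : 0 < d / 2 by rewrite divr_gt0.
  exists (d / 2) => // y Ey yx; rewrite distrC; apply: hd => //.
  rewrite -ball_normE /ball_/= distrC (le_lt_trans yx)//.
  by rewrite ltr_pdivrMr// ltr_pMr// ltr1n.
apply/cvgrPdist_le => e e0; have [d d0 hd] := h x Ex e e0.
apply/nbhs_ballP; exists d => //= y yx Ey; rewrite distrC; apply: hd => //.
by rewrite ltW// distrC; move: yx; rewrite -ball_normE.
Qed.

(** On a linear subspace continuity is boundedness: by homogeneity, a bound by
    1 on a ball of radius d gives the norm 1 / d. *)
Lemma continuous_bounded V W (E : set V) (T : V -> W) :
  is_subspace E -> linear_on E T -> {within E, continuous T} ->
  exists C : nat, forall u, E u -> `|T u| <= C%:R * `|u|.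
Proof.
move=> sE lT /within_continuous_eps/(_ 0 (proj1 sE) 1 ltr01)[d d0 hd].
have [C hC] := hA d^-1; exists C => u Eu.
have T0 := linear_on0 sE lT.
have [->|u0] := eqVneq u 0; first by rewrite T0 !normr0 mulr0.
have nu : 0 < `|u| by rewrite normr_gt0.
have := hd ((d / `|u|) *: u) (subspaceZ _ sE Eu).
rewrite (linear_onZ sE lT)// T0 !subr0 [`|_ *: u|]normrZ [`|_ *: T u|]normrZ ger0_norm; last first.
  by rewrite divr_ge0// ltW.
rewrite divfK ?gt_eqF// lexx => /(_ isT).
rewrite mulrAC ler_pdivrMr// mul1r mulrC -ler_pdivlMr// => /le_trans; apply.
rewrite mulrC ler_wpM2r//; apply: le_trans hC.
by rewrite gtr0_norm ?invr_gt0.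
Qed.

Lemma bounded_continuous V W (E : set V) (F : set W) (T : V -> W) :
  is_subspace E -> bounded_map E F T -> {within E, continuous T}.
Proof.
move=> sE [lT _ [C hC]]; apply/within_continuous_eps => x Ex e e0.
exists (e / C.+1%:R); first exact: divn_gt0_eps.
move=> y Ey yx; rewrite -(linear_onB lT)//.
rewrite (le_trans (hC _ _))//; first exact: subspaceB.
by rewrite (le_trans _ (mul_eps C e0))// ler_wpM2l.
Qed.

Lemma bounded_mapT V W Z (E : set V) (F : set W) (G : set Z) T S :
  bounded_map E F T -> bounded_map F G S -> bounded_map E G (S \o T).
Proof.
move=> [lT ET [C hC]] [lS FS [D hD]]; split.
- by move=> a u v Eu Ev; rewrite /= lT// lS//; exact: ET.
- by move=> u /ET/FS.
- exists (D * C)%N => u Eu; rewrite (le_trans (hD _ (ET _ Eu)))//.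
  by rewrite natrM -mulrA ler_wpM2l// hC.
Qed.

Lemma bounded_map_id V (E F : set V) : E `<=` F -> bounded_map E F id.
Proof. by move=> EF; split=> //; exists 1%N => u _; rewrite mul1r. Qed.

Lemma bounded_map_sub V W (E E' : set V) (F F' : set W) T :
  E' `<=` E -> F `<=` F' -> bounded_map E F T -> bounded_map E' F' T.
Proof.
move=> EE FF [lT ET [C hC]]; split; last by exists C => u /EE/hC.
- by move=> a u v /EE Eu /EE Ev; apply: lT.
- by move=> u /EE/ET/FF.
Qed.

Lemma bounded_map_pair V W Z (E : set V) (F : set W) (G : set Z) T S :
  bounded_map E F T -> bounded_map E G S ->
  bounded_map E (F `*` G) (fun u => (T u, S u)).
Proof.
move=> [lT ET [C hC]] [lS ES [D hD]]; split.
- by move=> a u v Eu Ev; rewrite lT// lS.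
- by move=> u Eu; split; [exact: ET|exact: ES].
- exists (C + D)%N => u Eu; apply: norm_pair_le => /=.
    by rewrite (le_trans (hC _ Eu))// ler_wpM2r// ler_nat leq_addr.
  by rewrite (le_trans (hD _ Eu))// ler_wpM2r// ler_nat leq_addl.
Qed.

Lemma bounded_map_fst V W (E : set V) (F : set W) :
  bounded_map (E `*` F) E fst.
Proof.
split=> //; first by move=> u [].
by exists 1%N => u _; rewrite mul1r norm_fst_le.
Qed.

Lemma bounded_map_snd V W (E : set V) (F : set W) :
  bounded_map (E `*` F) F snd.
Proof.
split=> //; first by move=> u [].
by exists 1%N => u _; rewrite mul1r norm_snd_le.
Qed.

Lemma bounded_map_add V W (E : set V) (F : set W) T S : is_subspace F ->
  bounded_map E F T -> bounded_map E F S -> bounded_map E F (fun u => T u + S u).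
Proof.
move=> sF [lT ET [C hC]] [lS ES [D hD]]; split.
- move=> a u v Eu Ev; rewrite lT// lS// scalerDr !addrA; congr (_ + _).
  by rewrite addrAC.
- by move=> u Eu; apply: subspaceD => //; [exact: ET|exact: ES].
- exists (C + D)%N => u Eu.
  by rewrite natrD mulrDl (le_trans (ler_normD _ _))// lerD ?hC ?hD.
Qed.

Lemma bounded_map_opp V W (E : set V) (F : set W) T : is_subspace F ->
  bounded_map E F T -> bounded_map E F (fun u => - T u).
Proof.
move=> sF [lT ET [C hC]]; split.
- by move=> a u v Eu Ev; rewrite lT// opprD scalerN.
- by move=> u Eu; rewrite -scaleN1r; apply: subspaceZ => //; exact: ET.
- by exists C => u Eu; rewrite normrN hC.
Qed.

Lemma bounded_map0 V W (E : set V) (F : set W) : is_subspace F ->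
  bounded_map E F (fun=> 0).
Proof.
move=> [F0 _]; split=> //; first by move=> *; rewrite scaler0 add0r.
by exists 0%N => u _; rewrite normr0 mul0r.
Qed.

Lemma iso_refl V (E : set V) : iso E E.
Proof. by exists id, id; split=> //; exact: bounded_map_id. Qed.

Lemma iso_sym V W (E : set V) (F : set W) : iso E F -> iso F E.
Proof. by move=> [T [S [? ? ? ?]]]; exists S, T. Qed.

Lemma iso_trans V W Z (E : set V) (F : set W) (G : set Z) :
  iso E F -> iso F G -> iso E G.
Proof.
move=> [T [S [bT bS TS ST]]] [T' [S' [bT' bS' TS' ST']]].
have [_ ET _] := bT; have [_ GS _] := bS'.
exists (T' \o T), (S \o S'); split.
- exact: bounded_mapT bT bT'.
- exact: bounded_mapT bS' bS.
- by move=> u Eu; rewrite /= TS'// ?TS//; exact: ET.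
- by move=> u Eu; rewrite /= ST// ?ST'//; exact: GS.
Qed.

Lemma iso_retract V W (E : set V) (F : set W) : iso E F -> retract E F.
Proof. by move=> [T [S [? ? ? ?]]]; exists T, S. Qed.

Lemma retract_trans V W Z (E : set V) (F : set W) (G : set Z) :
  retract E F -> retract F G -> retract E G.
Proof.
move=> [T [S [bT bS TS]]] [T' [S' [bT' bS' TS']]].
have [_ ET _] := bT.
exists (T' \o T), (S \o S'); split.
- exact: bounded_mapT bT bT'.
- exact: bounded_mapT bS' bS.
- by move=> u Eu; rewrite /= TS'// ?TS//; exact: ET.
Qed.

Lemma bounded_map_prod V W V' W' (E : set V) (F : set W) (E' : set V')
    (F' : set W') T S :
  bounded_map E E' T -> bounded_map F F' S ->
  bounded_map (E `*` F) (E' `*` F') (fun u => (T u.1, S u.2)).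
Proof.
move=> bT bS; apply: bounded_map_pair.
  exact: bounded_mapT (@bounded_map_fst _ _ E F) bT.
exact: bounded_mapT (@bounded_map_snd _ _ E F) bS.
Qed.

Lemma retract_prod V W V' W' (E : set V) (F : set W) (E' : set V')
    (F' : set W') :
  retract E E' -> retract F F' -> retract (E `*` F) (E' `*` F').
Proof.
move=> [T [S [bT bS TS]]] [T' [S' [bT' bS' TS']]].
exists (fun u => (T u.1, T' u.2)), (fun u => (S u.1, S' u.2)); split.
- exact: bounded_map_prod.
- exact: bounded_map_prod.
- by move=> [u v] [/= Eu Fv]; rewrite TS// TS'.
Qed.

Lemma iso_prod V W V' W' (E : set V) (F : set W) (E' : set V')
    (F' : set W') :
  iso E E' -> iso F F' -> iso (E `*` F) (E' `*` F').
Proof.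
move=> [T [S [bT bS TS ST]]] [T' [S' [bT' bS' TS' ST']]].
exists (fun u => (T u.1, T' u.2)), (fun u => (S u.1, S' u.2)); split.
- exact: bounded_map_prod.
- exact: bounded_map_prod.
- by move=> [u v] [/= Eu Fv]; rewrite TS// TS'.
- by move=> [u v] [/= Eu Fv]; rewrite ST// ST'.
Qed.

Lemma iso_prodC V W (E : set V) (F : set W) : iso (E `*` F) (F `*` E).
Proof.
exists (fun u => (u.2, u.1)), (fun u => (u.2, u.1)); split.
- by apply: bounded_map_pair; [exact: bounded_map_snd|exact: bounded_map_fst].
- by apply: bounded_map_pair; [exact: bounded_map_snd|exact: bounded_map_fst].
- by case.
- by case.
Qed.

Lemma iso_prodA V W Z (E : set V) (F : set W) (G : set Z) :
  iso (E `*` (F `*` G)) ((E `*` F) `*` G).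
Proof.
have f1 := @bounded_map_fst V _ E (F `*` G).
have f2 := @bounded_map_snd V _ E (F `*` G).
have g1 := @bounded_map_fst _ Z (E `*` F) G.
have g2 := @bounded_map_snd _ Z (E `*` F) G.
exists (fun u => ((u.1, u.2.1), u.2.2)), (fun u => (u.1.1, (u.1.2, u.2))).
split.
- apply: bounded_map_pair; last exact: bounded_mapT f2 (@bounded_map_snd _ _ F G).
  apply: bounded_map_pair => //; exact: bounded_mapT f2 (@bounded_map_fst _ _ F G).
- apply: bounded_map_pair; first exact: bounded_mapT g1 (@bounded_map_fst _ _ E F).
  apply: bounded_map_pair => //; exact: bounded_mapT g1 (@bounded_map_snd _ _ E F).
- by move=> [? [? ?]].
- by move=> [[? ?] ?].
Qed.

(** A retract is a direct summand: the kernel of the left inverse is the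
    other one. *)
Lemma retract_split V W (E : set V) (F : set W) :
  is_subspace E -> is_subspace F -> retract E F ->
  exists Z : set W, is_subspace Z /\ iso F (E `*` Z).
Proof.
move=> sE sF [T [S [bT bS TS]]].
have [lT ET _] := bT; have [lS FS _] := bS.
pose Z := [set w | F w /\ S w = 0].
have sZ : is_subspace Z.
  split; first by split; [case: sF|exact: linear_on0 lS].
  move=> a u v [Fu u0] [Fv v0]; split; first exact: (proj2 sF).
  by rewrite lS// u0 v0 scaler0 addr0.
exists Z; split=> //.
exists (fun w => (S w, w - T (S w))), (fun p => T p.1 + p.2); split.
- apply: bounded_map_pair => //.
  have b : bounded_map F F (fun w => w - T (S w)).
    apply: bounded_map_add => //; first exact: bounded_map_id.
    apply: bounded_map_opp => //; exact: bounded_mapT bS bT.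
  case: b => lb Fb bb; split=> // w Fw; split; first exact: Fb.
  rewrite (linear_onB lS)//; last by apply: ET; exact: FS.
  by rewrite TS ?subrr//; exact: FS.
- apply: bounded_map_add => //; first exact: bounded_mapT (@bounded_map_fst _ _ _ _) bT.
  by apply: bounded_map_sub (@bounded_map_snd _ _ E Z) => // w [].
- by move=> w Fw; rewrite /= addrC subrK.
- move=> [u w] [/= Eu [Fw w0]].
  have -> : S (T u + w) = u.
    by rewrite (linear_onD lS)// ?TS// ?w0 ?addr0//; exact: ET.
  by rewrite addrC addKr.
Qed.

(** The decomposition method: F = E + Z with E = E + E gives F = E + F, and
    in the same way E = F + E. *)
Lemma pelczynski V W (E : set V) (F : set W) :
  is_subspace E -> is_subspace F -> iso E (E `*` E) -> iso F (F `*` F) ->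
  retract E F -> retract F E -> iso E F.
Proof.
move=> sE sF E2 F2 /(retract_split sE sF)[Z [_ FZ]].
move=> /(retract_split sF sE)[Y [_ EY]].
have absorb V1 V2 V3 (A : set V1) (B : set V2) (C : set V3) :
    iso A (A `*` A) -> iso B (A `*` C) -> iso B (A `*` B).
  move=> A2 BAC; apply: (iso_trans BAC).
  apply: iso_trans (iso_prod A2 (iso_refl C)) _.
  apply: iso_trans (iso_sym (iso_prodA _ _ _)) _.
  exact: iso_prod (iso_refl A) (iso_sym BAC).
apply: iso_trans (absorb _ _ _ _ _ _ F2 EY) _.
apply: iso_trans (iso_prodC _ _) _.
exact: iso_sym (absorb _ _ _ _ _ _ E2 FZ).
Qed.

Lemma is_isomorphism_bounded V W (E : set V) (F : set W) T :
  is_subspace E -> is_isomorphism E F T -> exists S,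
    [/\ bounded_map E F T, bounded_map F E S,
        forall u, E u -> S (T u) = u & forall w, F w -> T (S w) = w].
Proof.
move=> sE [lT [funT injT surT] cT [S [cS TS]]].
have bT : bounded_map E F T by split=> //; exact: continuous_bounded.
have TSK u : E u -> S (T u) = u by move=> Eu; apply: TS; rewrite inE.
have FT w : F w -> exists2 u, E u & T u = w by move=> /surT[u Eu <-]; exists u.
have lS : linear_on F S.
  move=> a _ _ /FT[u Eu <-] /FT[v Ev <-].
  by rewrite -lT// !TSK//; apply: (proj2 sE).
have sF : is_subspace F.
  split; first by rewrite -(linear_on0 sE lT); apply: funT; case: sE.
  move=> a _ _ /FT[u Eu <-] /FT[v Ev <-].
  by rewrite -lT//; apply: funT; apply: (proj2 sE).
exists S; split=> //; last by move=> _ /FT[u Eu <-]; rewrite TSK.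
split=> //; last exact: continuous_bounded.
by move=> _ /FT[u Eu <-]; rewrite TSK.
Qed.

Lemma isomorphicP V W (E : set V) (F : set W) :
  is_subspace E -> isomorphic E F <-> iso E F.
Proof.
move=> sE; split.
  by move=> [T /(is_isomorphism_bounded sE)[S hS]]; exists T, S.
move=> [T [S [bT bS TS ST]]]; have [lT ET _] := bT; have [lS FS _] := bS.
exists T; split=> //.
- split=> //.
    by move=> u v; rewrite !inE => Eu Ev /(congr1 S); rewrite !TS.
  by move=> w Fw; exists (S w); [exact: FS|exact: ST].
- exact: bounded_continuous bT.
- exists S; split; last by move=> u; rewrite inE => /TS.
  apply: bounded_continuous bS; split.
    by rewrite -(linear_on0 sE lT); apply: ET; case: sE.
  by move=> a u v Fu Fv; rewrite -(ST u)// -(ST v)// -lT;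
    [apply/ET/(proj2 sE); exact: FS|exact: FS|exact: FS].
Qed.

Lemma subspace_image V W (E : set V) (F : set W) T :
  is_subspace E -> bounded_map E F T -> is_subspace (T @` E).
Proof.
move=> sE [lT _ _]; split.
  by exists 0; [case: sE|exact: linear_on0 lT].
move=> a _ _ [u Eu <-] [v Ev <-]; exists (a *: u + v).
  exact: (proj2 sE).
exact: lT.
Qed.

Lemma complemented_subspace V (E F : set V) :
  is_subspace E -> complemented E F -> is_subspace F.
Proof.
move=> sE [FE [P [lP _ <- _]]]; split.
  by exists 0; [case: sE|exact: linear_on0 lP].
move=> a _ _ [u Eu <-] [v Ev <-]; exists (a *: u + v).
  exact: (proj2 sE).
exact: lP.
Qed.

Lemma complemented_retract V (E F : set V) :
  is_subspace E -> complemented E F -> retract F E.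
Proof.
move=> sE [FE [P [lP cP PE PF]]]; exists id, P; split=> //.
  exact: bounded_map_id.
split=> //; last exact: continuous_bounded.
by move=> u Eu; rewrite -PE; exists u.
Qed.

Lemma complementedP V (E F : set V) P : is_subspace E -> F `<=` E ->
  bounded_map E F P -> (forall u, F u -> P u = u) -> complemented E F.
Proof.
move=> sE FE bP PF; split=> //; exists P.
have [lP FP _] := bP; split=> //; first exact: bounded_continuous bP.
apply/seteqP; split; first by move=> _ [u /FP Fu <-].
by move=> u Fu; exists u; [exact: FE|exact: PF].
Qed.

Lemma complemented_refl V (E : set V) : is_subspace E -> complemented E E.
Proof. by move=> sE; apply: (complementedP (P := id)) => //; exact: bounded_map_id. Qed.

Lemma complemented_trans V (E F G : set V) : is_subspace E ->
  complemented E F -> complemented F G -> complemented E G.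
Proof.
move=> sE EF FG; have sF := complemented_subspace sE EF.
have [FE [P [lP cP PE PF]]] := EF; have [GF [Q [lQ cQ QF QG]]] := FG.
apply: (complementedP (P := Q \o P)) => //.
- by move=> u /GF/FE.
- apply: (@bounded_mapT _ _ _ _ F).
    split=> //; last exact: continuous_bounded.
    by move=> u Eu; rewrite -PE; exists u.
  split=> //; last exact: continuous_bounded.
  by move=> u Eu; rewrite -QF; exists u.
- by move=> u Gu; rewrite /= PF ?QG//; exact: GF.
Qed.

Lemma retract_complemented V W (E : set V) (F : set W) :
  is_subspace E -> is_subspace F -> retract E F ->
  exists G : set W, complemented F G /\ iso E G.
Proof.
move=> sE sF [T [S [bT bS TS]]]; have [lT ET [C hC]] := bT.
have [lS FS hS] := bS.
have bTG : bounded_map E (T @` E) T.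
  by split=> //; exists C.
have GF : T @` E `<=` F by move=> _ [u Eu <-]; exact: ET.
exists (T @` E); split.
  apply: (complementedP (P := T \o S)) => //.
    exact: bounded_mapT bS bTG.
  by move=> _ [u Eu <-]; rewrite /= TS.
exists T, S; split=> //; first exact: bounded_map_sub bS.
by move=> _ [u Eu <-]; rewrite TS.
Qed.

Lemma complemented_closed V (E F : set V) :
  is_subspace E -> seq_closed E -> complemented E F -> seq_closed F.
Proof.
move=> sE cE EF; have sF := complemented_subspace sE EF.
have [FE [P [lP cP PE PF]]] := EF.
have [C hC] := continuous_bounded sE lP cP.
move=> v hv.
have Ev : E v by apply: cE => e /hv[w /FE Ew ?]; exists w.
suff -> : v = P v by rewrite -PE; exists v.
apply/subr0_eq/norm_eq0_eps => e e0.
have [w Fw vw] := hv _ (divn_gt0_eps C.+1 e0).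
have -> : v - P v = (v - w) - P (v - w).
  by rewrite (linear_onB lP)//; [rewrite (PF w)// opprB addrA subrK|exact: FE].
rewrite (le_trans (ler_normB _ _))//.
rewrite (le_trans (lerD (lexx _) (hC _ _)))//.
  by apply: subspaceB => //; exact: FE.
have -> (c : K) : c + C%:R * c = C.+1%:R * c by rewrite -natr1; ring.
by rewrite (le_trans _ (mul_eps C.+1 e0))// ler_wpM2l.
Qed.

Lemma iso_subspace V W (E : set V) (F : set W) :
  is_subspace E -> iso E F -> is_subspace F.
Proof.
move=> sE [T [S [bT [_ FS _] _ ST]]].
suff -> : F = T @` E by exact: subspace_image bT.
have [_ ET _] := bT; apply/seteqP; split; last by move=> _ [u /ET Fu <-].
by move=> w Fw; exists (S w); [exact: FS|exact: ST].
Qed.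

End BoundedMaps.

(** * Closed spans of families and extension of linear maps *)

Section LinearCombinations.
Variables (K : numFieldType) (V : lmodType K) (I : Type).
Implicit Types (x : I -> V) (l : seq (K * I)) (A : set I).

(** Linear combinations are indexed by lists of (coefficient, index) pairs, in
    which an index may be repeated: sums are then concatenations, and no
    rearrangement of indices is ever required. *)
Definition lc x l : V := \sum_(p <- l) p.1 *: x p.2.

Definition supported A l : bool := all (fun p => `[< A p.2 >]) l.

Lemma lc_nil x : lc x [::] = 0. Proof. exact: big_nil. Qed.

Lemma lc_cons x p l : lc x (p :: l) = p.1 *: x p.2 + lc x l.
Proof. exact: big_cons. Qed.

Lemma lc_cat x l l' : lc x (l ++ l') = lc x l + lc x l'.
Proof. exact: big_cat. Qed.

Lemma lc_scale x a l : lc x [seq (a * p.1, p.2) | p <- l] = a *: lc x l.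
Proof.
by rewrite /lc big_map scaler_sumr; apply: eq_bigr => p _; rewrite scalerA.
Qed.

Lemma lc_opp x l : lc x [seq (- p.1, p.2) | p <- l] = - lc x l.
Proof.
rewrite -scaleN1r -lc_scale; congr lc.
by apply: eq_map => p; rewrite mulN1r.
Qed.

Lemma lc_if x (P : pred I) l :
  lc (fun i => if P i then x i else 0) l = lc x [seq p <- l | P p.2].
Proof.
rewrite /lc big_filter [RHS]big_mkcond.
by apply: eq_bigr => p _; case: ifP => // _; rewrite scaler0.
Qed.

Lemma lc_filterC x (P : pred I) l :
  lc x l = lc x [seq p <- l | P p.2] + lc x [seq p <- l | ~~ P p.2].
Proof. by rewrite /lc !big_filter [LHS](bigID (fun p : K * I => P p.2)). Qed.

Lemma lc_coef x (c : I -> K) l :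
  lc (fun i => c i *: x i) l = lc x [seq (p.1 * c p.2, p.2) | p <- l].
Proof. by rewrite /lc big_map; apply: eq_bigr => p _; rewrite scalerA. Qed.

Lemma eq_lc A x y l : (forall i, A i -> x i = y i) -> supported A l ->
  lc x l = lc y l.
Proof.
move=> xy; rewrite /lc; elim: l => [|p l IH] /=; first by rewrite !big_nil.
by move=> /andP[/asboolP /xy e /IH]; rewrite !big_cons e => ->.
Qed.

Lemma supported_cat A l l' : supported A (l ++ l') = supported A l && supported A l'.
Proof. exact: all_cat. Qed.

Lemma supported_sub A B l : A `<=` B -> supported A l -> supported B l.
Proof. by move=> AB; apply: sub_all => p /asboolP/AB/asboolP. Qed.

Lemma supported_filter A (P : pred I) l :
  supported A l -> supported A [seq p <- l | P p.2].
Proof.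
rewrite /supported all_filter; apply: sub_all => p /= h.
by apply/implyP.
Qed.

Lemma supported_filterI A B (P : pred I) l :
  (forall i, A i -> P i -> B i) -> supported A l ->
  supported B [seq p <- l | P p.2].
Proof.
move=> AB; rewrite /supported all_filter; apply: sub_all => p /asboolP Ap /=.
by apply/implyP => Pp; apply/asboolP/AB.
Qed.

Lemma supportedT l : supported [set: I] l.
Proof. by elim: l => //= p l ->; rewrite andbT; apply/asboolP. Qed.

End LinearCombinations.

Lemma lc_map (K : numFieldType) (V : lmodType K) (I J : Type) (e : I -> J)
    (x : J -> V) (l : seq (K * I)) :
  lc x [seq (p.1, e p.2) | p <- l] = lc (x \o e) l.
Proof. by rewrite /lc big_map. Qed.

Lemma supported_map (K : numFieldType) (I J : Type) (e : I -> J)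
    (A : set I) (B : set J) (l : seq (K * I)) :
  (forall i, A i -> B (e i)) -> supported A l ->
  supported B [seq (p.1, e p.2) | p <- l].
Proof.
move=> AB; rewrite /supported all_map; apply: sub_all => p /asboolP/AB ?.
exact/asboolP.
Qed.

Lemma supported_coef (K : numFieldType) (I : Type) (f : K * I -> K)
    (A : set I) (l : seq (K * I)) :
  supported A [seq (f p, p.2) | p <- l] = supported A l.
Proof. by rewrite /supported all_map. Qed.

Section Families.
Variable K : numFieldType.
Hypothesis hA : archimedean_norm K.
Implicit Types V W Z : normedModType K.

(** The closed span in the sense of approximation by finite combinations, over
    index types that need not be ordered. *)
Definition cspan V (I : Type) (A : set I) (x : I -> V) : set V :=
  [set v | forall e, 0 < e -> exists2 l, supported A l & `|v - lc x l| <= e].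

(** Bounds are natural numbers, so that boundedness is a countable union of
    closed conditions; this is what makes category arguments possible. *)
Definition dominates V W (I : Type) (C : nat) (A : set I) (x : I -> V)
    (y : I -> W) : Prop :=
  forall l, supported A l -> `|lc y l| <= C%:R * `|lc x l|.

Definition same_norms V W (I : Type) (C : nat) (A : set I) (x : I -> V)
    (y : I -> W) : Prop :=
  dominates C A x y /\ dominates C A y x.

Lemma lc_linear V W (I : Type) (A : set I) (x : I -> V) (E : set V) (T : V -> W) l :
  is_subspace E -> linear_on E T -> (forall i, A i -> E (x i)) ->
  supported A l -> E (lc x l) /\ T (lc x l) = lc (T \o x) l.
Proof.
move=> sE lT Ex; elim: l => [|p l IH] /=.
  by rewrite !lc_nil; split; [case: sE|exact: linear_on0 lT].
move=> /andP[/asboolP /Ex Ep /IH[El e]]; rewrite !lc_cons; split.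
  exact: (proj2 sE).
by rewrite lT// e.
Qed.

Section Span.
Variables (V : normedModType K) (I : Type) (A : set I) (x : I -> V).

Lemma cspan_lc l : supported A l -> cspan A x (lc x l).
Proof. by move=> Al e e0; exists l; rewrite // subrr normr0 ltW. Qed.

Lemma cspan_mem i : A i -> cspan A x (x i).
Proof.
move=> Ai; rewrite (_ : x i = lc x [:: (1, i)]).
  by apply: cspan_lc => /=; rewrite andbT; apply/asboolP.
by rewrite lc_cons lc_nil scale1r addr0.
Qed.

Lemma cspan_subspace : is_subspace (cspan A x).
Proof.
split; first by rewrite -(lc_nil x); exact: cspan_lc.
move=> a u v hu hv e e0; have [n hn] := hA a.
have e1 := divn_gt0_eps n.+1 e0.
have [l Al ul] := hu _ e1; have [l' Al' vl'] := hv _ e1.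
exists ([seq (a * p.1, p.2) | p <- l] ++ l').
  by rewrite supported_cat supported_coef Al.
rewrite lc_cat lc_scale.
rewrite (_ : _ - _ = a *: (u - lc x l) + (v - lc x l')); last first.
  by rewrite scalerBr opprD addrACA.
rewrite (le_trans (ler_normD _ _))// normrZ (le_trans _ (mul_eps n.+1 e0))//.
by rewrite -[n.+1%:R]natr1 mulrDl mul1r lerD// ler_pM.
Qed.

Lemma cspan_closed : seq_closed (cspan A x).
Proof.
move=> v hv e e0; have e1 := divn_gt0_eps 1 e0.
have [w hw vw] := hv _ e1; have [l Al wl] := hw _ e1.
exists l => //; rewrite (_ : v - _ = (v - w) + (w - lc x l)); last first.
  by rewrite addrA subrK.
by rewrite (splitr e) (le_trans (ler_normD _ _))// lerD.
Qed.

Lemma cspan_min (E : set V) : is_subspace E -> seq_closed E ->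
  (forall i, A i -> E (x i)) -> cspan A x `<=` E.
Proof.
move=> sE cE Ex v hv; apply: cE => e /hv[l Al vl]; exists (lc x l) => //.
have lid : linear_on E (@id V) by [].
by case: (lc_linear sE lid Ex Al).
Qed.

Lemma bounded_maps_eq W (F F' : set W) T S :
  bounded_map (cspan A x) F T -> bounded_map (cspan A x) F' S ->
  (forall i, A i -> T (x i) = S (x i)) -> forall v, cspan A x v -> T v = S v.
Proof.
move=> bT bS TS v Ev; have sE := cspan_subspace.
have [lT _ [C hC]] := bT; have [lS _ [D hD]] := bS.
apply/subr0_eq/norm_eq0_eps => e e0.
have [l Al vl] := Ev _ (divn_gt0_eps (C + D) e0).
have El := cspan_lc Al.
have Tl : T (lc x l) = S (lc x l).
  have [_ ->] := lc_linear sE lT cspan_mem Al.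
  have [_ ->] := lc_linear sE lS cspan_mem Al.
  exact: eq_lc Al.
have Evl : cspan A x (v - lc x l) by exact: (subspaceB sE Ev El).
rewrite (_ : T v - S v = T (v - lc x l) - S (v - lc x l)); last first.
  by rewrite (linear_onB lT)// (linear_onB lS)// Tl opprB addrA subrK.
rewrite (le_trans (ler_normB _ _))// (le_trans _ (mul_eps (C + D) e0))//.
rewrite natrD mulrDl lerD// (le_trans (hC _ Evl) _, le_trans (hD _ Evl) _)//.
  by rewrite ler_wpM2l.
by rewrite ler_wpM2l.
Qed.

(** The extension of x i |-> y i is obtained from the closure of its graph,
    which is the graph of a map because w is controlled by v for (v, w) in
    the closure. *)
Lemma extend_linear W (C : nat) (y : I -> W) :
  seq_complete W -> dominates C A x y ->
  exists T, [/\ bounded_map (cspan A x) (cspan A y) T,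
    forall i, A i -> T (x i) = y i &
    forall v, cspan A x v -> `|T v| <= C%:R * `|v|].
Proof.
move=> cW xy.
pose G v w := forall e, 0 < e -> exists l,
  [/\ supported A l, `|v - lc x l| <= e & `|w - lc y l| <= e].
have Gle v w : G v w -> `|w| <= C%:R * `|v|.
  move=> Gvw; apply: norm_le_eps => e e0.
  have [l [Al vl wl]] := Gvw _ (divn_gt0_eps C.+1 e0).
  rewrite (_ : w = (w - lc y l) + lc y l); last by rewrite subrK.
  rewrite (le_trans (ler_normD _ _))// (le_trans (lerD wl (xy _ Al)))//.
  have : `|lc x l| <= `|v| + e / C.+2%:R.
    rewrite (_ : lc x l = v - (v - lc x l)); last by rewrite opprB addrC subrK.
    by rewrite (le_trans (ler_normB _ _))// lerD.
  move=> /(ler_wpM2l (ler0n K C)); rewrite mulrDr => h.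
  rewrite (le_trans (lerD (lexx _) h))// addrCA lerD//.
  by have := mul_eps C.+1 e0; rewrite -[C.+1%:R]natr1 mulrDl mul1r addrC.
have GD a u v w z : G u w -> G v z -> G (a *: u + v) (a *: w + z).
  move=> uw vz e e0; have [n hn] := hA a.
  have e1 := divn_gt0_eps n.+1 e0.
  have [l [Al ul wl]] := uw _ e1; have [l' [Al' vl' zl']] := vz _ e1.
  exists ([seq (a * p.1, p.2) | p <- l] ++ l').
  have aux (Z : normedModType K) (z1 z2 : Z) (t : I -> Z) :
      `|z1 - lc t l| <= e / n.+2%:R -> `|z2 - lc t l'| <= e / n.+2%:R ->
      `|a *: z1 + z2 - (a *: lc t l + lc t l')| <= e.
    move=> h1 h2.
    rewrite (_ : _ - _ = a *: (z1 - lc t l) + (z2 - lc t l')); last first.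
      by rewrite scalerBr opprD addrACA.
    rewrite (le_trans (ler_normD _ _))// normrZ (le_trans _ (mul_eps n.+1 e0))//.
    by rewrite -[n.+1%:R]natr1 mulrDl mul1r lerD// ler_pM.
  split; first by rewrite supported_cat supported_coef Al.
    by rewrite lc_cat lc_scale; exact: aux.
  by rewrite lc_cat lc_scale; exact: aux.
(* As w is controlled by v on the graph, it vanishes with v. *)
have Gfun v w w' : G v w -> G v w' -> w = w'.
  move=> vw vw'; have := Gle _ _ (GD (-1) _ _ _ _ vw' vw).
  rewrite !scaleN1r addNr normr0 mulr0 normr_le0 addrC subr_eq0.
  by move=> /eqP.
have Gtot v : cspan A x v -> exists w, G v w.
  move=> hv.
  have /choice[l hl] : forall n : nat, exists l,
      supported A l /\ `|v - lc x l| <= (2 ^+ n)^-1.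
    by move=> n; have [|l] := hv (2 ^+ n)^-1; [rewrite invr_gt0 exprn_gt0|exists l].
  have [w hw] : exists w, seq_lim (fun n => lc y (l n)) w.
    apply: cW => e e0.
    have [N hN] := archimedean_pow2 hA (divn_gt0_eps (C + C) e0).
    exists N => n Nn; rewrite -lc_opp -lc_cat.
    rewrite (le_trans (xy _ _))//.
      by rewrite supported_cat supported_coef; rewrite (proj1 (hl n)) (proj1 (hl N)).
    rewrite (le_trans _ (mul_eps (C + C) e0))//.
    rewrite natrD mulrDl -mulrDr ler_wpM2l// lc_cat lc_opp.
    rewrite (_ : _ - _ = (v - lc x (l N)) - (v - lc x (l n))); last first.
      by rewrite opprB [RHS]addrC addrA subrK.
    rewrite (le_trans (ler_normB _ _))// lerD//.
      by rewrite (le_trans (proj2 (hl N))).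
    rewrite (le_trans (proj2 (hl n)))// (le_trans _ hN)//.
    by rewrite lef_pV2 ?posrE ?exprn_gt0// ler_weXn2l// ler1n.
  exists w => e e0; have [N1 h1] := hw _ e0.
  have [N2 h2] := archimedean_pow2 hA e0.
  have [Al vl] := hl (maxn N1 N2).
  exists (l (maxn N1 N2)); split=> //; last first.
    by rewrite distrC; apply: h1; exact: leq_maxl.
  rewrite (le_trans vl)// (le_trans _ h2)//.
  by rewrite lef_pV2 ?posrE ?exprn_gt0// ler_weXn2l ?ler1n// leq_maxr.
have /choice[T hT] : forall v, exists w, cspan A x v -> G v w.
  move=> v; have [/Gtot[w vw]|nv] := pselect (cspan A x v); first by exists w.
  by exists 0.
exists T; split; first split.
- move=> a u v Eu Ev; apply: (Gfun (a *: u + v)).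
    by apply: hT; apply: (proj2 cspan_subspace).
  by apply: GD; exact: hT.
- by move=> u /hT h e /h[l [Al _ ?]]; exists l.
- by exists C => u /hT/Gle.
- move=> i Ai; apply: (Gfun (x i)); first exact/hT/cspan_mem.
  move=> e e0; exists [:: (1, i)]; rewrite /= andbT !lc_cons !lc_nil !scale1r !addr0.
  by rewrite !subrr !normr0; split; [apply/asboolP|exact: ltW|exact: ltW].
- by move=> u /hT/Gle.
Qed.

End Span.

Lemma cspan_iso V W (I : Type) (A : set I) (x : I -> V) (y : I -> W) C :
  seq_complete V -> seq_complete W -> same_norms C A x y ->
  iso (cspan A x) (cspan A y).
Proof.
move=> cV cW [xy yx].
have [T [bT Tx _]] := extend_linear cW xy.
have [S [bS Sy _]] := extend_linear cV yx.
exists T, S; split=> //.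
  apply: (bounded_maps_eq (bounded_mapT bT bS) (bounded_map_id (@subset_refl _ _))) => //.
  by move=> i Ai /=; rewrite Tx// Sy.
apply: (bounded_maps_eq (bounded_mapT bS bT) (bounded_map_id (@subset_refl _ _))) => //.
by move=> i Ai /=; rewrite Sy// Tx.
Qed.

Lemma cspan_sub V (I : Type) (A B : set I) (x : I -> V) :
  A `<=` B -> cspan A x `<=` cspan B x.
Proof.
move=> AB; apply: cspan_min; [exact: cspan_subspace|exact: cspan_closed|].
by move=> i /AB; exact: cspan_mem.
Qed.

Lemma cspan_reindex V (I J : Type) (A : set I) (B : set J) (e : I -> J)
    (x : J -> V) : set_bij A B e -> cspan A (x \o e) = cspan B x.
Proof.
move=> [fe _ se]; apply/seteqP; split; apply: cspan_min.
- exact: cspan_subspace.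
- exact: cspan_closed.
- by move=> i /fe; exact: cspan_mem.
- exact: cspan_subspace.
- exact: cspan_closed.
- by move=> _ /se[i Ai <-]; exact: (@cspan_mem _ _ _ (x \o e)).
Qed.

Lemma dominates_trans V W Z (I : Type) C D (A : set I) (x : I -> V)
    (y : I -> W) (z : I -> Z) :
  dominates C A x y -> dominates D A y z -> dominates (D * C) A x z.
Proof.
move=> xy yz l Al; rewrite natrM -mulrA (le_trans (yz _ Al))//.
by rewrite ler_wpM2l// xy.
Qed.

Lemma dominates_sub V W (I : Type) C (A B : set I) (x : I -> V) (y : I -> W) :
  A `<=` B -> dominates C B x y -> dominates C A x y.
Proof. by move=> AB xy l /(supported_sub AB)/xy. Qed.

Lemma dominates_reindex V W (I J : Type) C (A : set I) (B : set J) (e : I -> J)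
    (x : J -> V) (y : J -> W) : (forall i, A i -> B (e i)) ->
  dominates C B x y -> dominates C A (x \o e) (y \o e).
Proof.
by move=> AB xy l /(supported_map AB) Bl; rewrite -(lc_map e x) -(lc_map e y) xy.
Qed.

Lemma dominates_le V W (I : Type) C D (A : set I) (x : I -> V) (y : I -> W) :
  (C <= D)%N -> dominates C A x y -> dominates D A x y.
Proof.
by move=> CD xy l /xy/le_trans; apply; rewrite ler_wpM2r// ler_nat.
Qed.

Lemma eq_dominates V W (I : Type) C (A : set I) (x x' : I -> V) (y y' : I -> W) :
  (forall i, A i -> x i = x' i) -> (forall i, A i -> y i = y' i) ->
  dominates C A x y -> dominates C A x' y'.
Proof.
by move=> xx yy xy l Al; rewrite -(eq_lc xx Al) -(eq_lc yy Al) xy.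
Qed.

Lemma same_norms_refl V (I : Type) (A : set I) (x : I -> V) : same_norms 1 A x x.
Proof. by split=> l _; rewrite mul1r. Qed.

Lemma same_norms_trans V W Z (I : Type) C D (A : set I) (x : I -> V)
    (y : I -> W) (z : I -> Z) :
  same_norms C A x y -> same_norms D A y z -> same_norms (D * C) A x z.
Proof.
move=> [xy yx] [yz zy]; split; first exact: dominates_trans xy yz.
by rewrite mulnC; exact: dominates_trans zy yx.
Qed.

Lemma same_norms_sub V W (I : Type) C (A B : set I) (x : I -> V) (y : I -> W) :
  A `<=` B -> same_norms C B x y -> same_norms C A x y.
Proof. by move=> AB [? ?]; split; apply: dominates_sub AB _. Qed.

Lemma same_norms_reindex V W (I J : Type) C (A : set I) (B : set J) (e : I -> J)
    (x : J -> V) (y : J -> W) : (forall i, A i -> B (e i)) ->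
  same_norms C B x y -> same_norms C A (x \o e) (y \o e).
Proof. by move=> AB [? ?]; split; apply: dominates_reindex AB _. Qed.

Lemma eq_same_norms V W (I : Type) C (A : set I) (x x' : I -> V) (y y' : I -> W) :
  (forall i, A i -> x i = x' i) -> (forall i, A i -> y i = y' i) ->
  same_norms C A x y -> same_norms C A x' y'.
Proof. by move=> xx yy [? ?]; split; apply: eq_dominates; eauto. Qed.

End Families.

(** * Category in the space of sets of natural numbers *)

Section CategoryOnSubsetsOfNat.

Implicit Types (S T D : nat -> bool) (Z : set (nat -> bool)).

Definition agree (X : Type) (k : nat) (s t : nat -> X) : Prop :=
  forall i, (i < k)%N -> s i = t i.

Lemma agree_le (X : Type) j k (s t : nat -> X) :
  (j <= k)%N -> agree k s t -> agree j s t.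
Proof. by move=> jk st i ij; apply: st; exact: leq_trans jk. Qed.

Lemma agree_sym (X : Type) k (s t : nat -> X) : agree k s t -> agree k t s.
Proof. by move=> st i ik; rewrite st. Qed.

Lemma agree_trans (X : Type) k (s t u : nat -> X) :
  agree k s t -> agree k t u -> agree k s u.
Proof. by move=> st tu i ik; rewrite st// tu. Qed.

Definition splice (X : Type) (k : nat) (s t : nat -> X) : nat -> X :=
  fun i => if (i < k)%N then s i else t i.

Lemma agree_splice (X : Type) k (s t : nat -> X) : agree k s (splice k s t).
Proof. by move=> i ik; rewrite /splice ik. Qed.

Definition nowhere_dense Z : Prop := forall S k, exists S' k',
  [/\ (k <= k')%N, agree k S S' & forall T, agree k' S' T -> ~ Z T].

Definition meager Z : Prop := exists D : nat -> set (nat -> bool),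
  (forall i, nowhere_dense (D i)) /\ Z `<=` \bigcup_i D i.

Lemma meager_sub Z Z' : Z `<=` Z' -> meager Z' -> meager Z.
Proof. by move=> ZZ [D [nD ZD]]; exists D; split=> // S /ZZ/ZD. Qed.

Lemma nowhere_dense0 : nowhere_dense set0.
Proof. by move=> S k; exists S, k; split=> // T _ []. Qed.

Lemma nowhere_dense_meager Z : nowhere_dense Z -> meager Z.
Proof. by move=> nZ; exists (fun=> Z); split=> // S ZS; exists 0%N. Qed.

Lemma meager_bigcup (X : countType) (Z : X -> set (nat -> bool)) :
  (forall i, meager (Z i)) -> meager (\bigcup_i Z i).
Proof.
move=> /choice[D hD].
exists (fun k => if unpickle k is Some (i, j) then D i j else set0); split.
  move=> k; case: (unpickle k) => [[i j]|]; last exact: nowhere_dense0.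
  exact: (proj1 (hD i)).
move=> S [i _ /(proj2 (hD i))[j _ DS]].
by exists (pickle (i, j)) => //; rewrite pickleK.
Qed.

Lemma meagerU Z Z' : meager Z -> meager Z' -> meager (Z `|` Z').
Proof.
move=> mZ mZ'; apply: (@meager_sub _ (\bigcup_b if b then Z else Z')).
  by move=> S [ZS|ZS]; [exists true|exists false].
by apply: meager_bigcup => -[].
Qed.

Lemma nonmeager_setT : ~ meager setT.
Proof.
move=> [D [nD DT]].
have /choice[f hf] : forall p : nat * ((nat -> bool) * nat),
    exists q : (nat -> bool) * nat,
      [/\ (p.2.2 < q.2)%N, agree p.2.2 p.2.1 q.1 &
          forall T, agree q.2 q.1 T -> ~ D p.1 T].
  move=> [i [S k]]; have [S' [k' [kk SS hD]]] := nD i S k.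
  exists (S', k'.+1); split=> //= T ST; apply: hD; exact: agree_le ST.
pose u := fix u i := if i is j.+1 then f (j, u j) else (fun=> false, 0%N).
have uS i : [/\ ((u i).2 < (u i.+1).2)%N, agree (u i).2 (u i).1 (u i.+1).1 &
    forall T, agree (u i.+1).2 (u i.+1).1 T -> ~ D i T] := hf (i, u i).
have ui i : (i <= (u i).2)%N.
  by elim: i => // i IH; case: (uS i) => h _ _; exact: leq_ltn_trans h.
have um i n : agree (u i).2 (u i).1 (u (i + n)%N).1 /\ ((u i).2 <= (u (i + n)%N).2)%N.
  elim: n => [|n [IH1 IH2]]; first by rewrite addn0; split.
  have [h1 h2 _] := uS (i + n)%N; rewrite addnS; split.
    by apply: agree_trans IH1 _; exact: agree_le h2.
  by rewrite (leq_trans IH2)// ltnW.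
pose T i := (u i.+1).1 i.
have uT i : agree (u i).2 (u i).1 T.
  move=> j ji; rewrite /T; have [ij|/ltnW ij] := leqP i j.+1.
    by have [h _] := um i (j.+1 - i)%N; rewrite subnKC// in h; exact: h.
  have [h _] := um j.+1 (i - j.+1)%N; rewrite subnKC// in h.
  by rewrite h//; exact: ui.
have [i _ DTi] := DT T I.
by case: (uS i) => _ _ /(_ T (uT _)).
Qed.

(** Complementation and finite modifications are both translations of the Cantor
    group. *)
Lemma meager_xor Z D : meager Z -> meager [set S | Z (fun i => S i (+) D i)].
Proof.
move=> [N [nN ZN]]; exists (fun k => [set S | N k (fun i => S i (+) D i)]).
split; last by move=> S /ZN[k _ NS]; exists k.
move=> k S m; have [S' [m' [mm SS hN]]] := nN k (fun i => S i (+) D i) m.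
exists (fun i => S' i (+) D i), m'; split=> //.
  by move=> i im; rewrite -SS// addbK.
by move=> T ST; apply: hN => i im; rewrite -ST// addbK.
Qed.

(** Cylinders are given by a function and a length: the cylinder of S and k is
    the set agree k S. *)
Definition everywhere_nonmeager Z S k : Prop := forall S' k',
  (k <= k')%N -> agree k S S' -> ~ meager (Z `&` agree k' S').

Lemma everywhere_nonmeager_ext Z S k S' k' : (k <= k')%N -> agree k S S' ->
  everywhere_nonmeager Z S k -> everywhere_nonmeager Z S' k'.
Proof.
move=> kk SS h T m km ST; apply: h; first exact: leq_trans km.
by apply: agree_trans SS _; exact: agree_le ST.
Qed.

(** Otherwise the points of the cylinder near which Z is meager form a dense
    open subset of it, and the part of Z in the cylinder is contained in the
    nowhere dense rest and in countably many meager pieces. *)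
Lemma nonmeager_localize Z S k : ~ meager (Z `&` agree k S) ->
  exists S' k', [/\ (k <= k')%N, agree k S S' & everywhere_nonmeager Z S' k'].
Proof.
move=> nm; apply: contrapT => hn; apply: nm.
have hm S1 k1 : (k <= k1)%N -> agree k S S1 -> exists S2 k2,
    [/\ (k1 <= k2)%N, agree k1 S1 S2 & meager (Z `&` agree k2 S2)].
  move=> kk SS; apply: contrapT => h; apply: hn; exists S1, k1; split=> //.
  by move=> S2 k2 k12 S12 m; apply: h; exists S2, k2.
pose cyl (s : seq bool) := agree (size s) (nth false s).
pose W (s : seq bool) := [set T | meager (Z `&` cyl s) /\ (Z `&` cyl s) T].
pose N := [set T | agree k S T /\
  forall S2 k2, agree k2 S2 T -> ~ meager (Z `&` agree k2 S2)].
apply: (@meager_sub _ ((\bigcup_s W s) `|` N)).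
  move=> T [ZT ST]; have [NT|nNT] := pselect (N T); [by right|left].
  have [S2 [k2 [S2T mZ]]] : exists S2 k2,
      agree k2 S2 T /\ meager (Z `&` agree k2 S2).
    apply: contrapT => h; apply: nNT; split=> // S2 k2 S2T mZ.
    by apply: h; exists S2, k2.
  have cE : cyl (mkseq S2 k2) = agree k2 S2.
    rewrite /cyl size_mkseq; apply/seteqP; split=> T' h i ik; rewrite -h//.
      by rewrite nth_mkseq.
    by rewrite nth_mkseq.
  by exists (mkseq S2 k2) => //; rewrite /W /= cE; split.
apply: meagerU.
  apply: meager_bigcup => s; have [m|nm] := pselect (meager (Z `&` cyl s)).
    by apply: meager_sub m => T [].
  by apply: meager_sub (nowhere_dense_meager nowhere_dense0) => T [].
apply: nowhere_dense_meager => S1 k1.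
pose S1' := splice k1 S1 S; pose k1' := maxn k k1.
have [SS1|nSS1] := pselect (agree k S S1').
  have [S2 [k2 [k12 S12 mZ]]] := hm S1' k1' (leq_maxl _ _) SS1.
  exists S2, k2; split; first by rewrite (leq_trans _ k12)// leq_maxr.
    apply: agree_trans (agree_splice _ _) _.
    exact: agree_le (leq_maxr _ _) S12.
  by move=> T S2T [_ /(_ S2 k2 S2T)].
exists S1', k1'; split; [exact: leq_maxr|exact: agree_splice|].
move=> T S1T [ST _]; apply: nSS1; apply: agree_trans ST _.
exact: agree_sym (agree_le (leq_maxl _ _) S1T).
Qed.

End CategoryOnSubsetsOfNat.

Section DisjointRanges.
Variable G : nat -> set (nat -> nat).

Definition has_range_in (S : nat -> bool) : Prop :=
  exists M t, G M t /\ forall i, S (t i).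

Hypothesis G_closed : forall M t,
  (forall k, exists2 t', G M t' & agree k t t') -> G M t.
Hypothesis G_dichotomy : forall S, has_range_in S \/ has_range_in (negb \o S).
Hypothesis G_tail : forall S m,
  has_range_in S -> has_range_in (fun i => S i && (m <= i)%N).

(** The sets that contain a range with constant M whose first k values are
    prescribed by t: the analytic family as a union over a tree. *)
Let U M k t := [set S : nat -> bool |
  exists t', [/\ G M t', agree k t t' & forall i, S (t' i)]].

Let U_step M k t S m S' m' : everywhere_nonmeager (U M k t) S m ->
  (m <= m')%N -> agree m S S' -> exists t' S'' m'',
  [/\ agree k t t', (m' <= m'')%N, agree m' S' S'' &
      everywhere_nonmeager (U M k.+1 t') S'' m''].
Proof.
move=> h mm SS; have nm := h _ _ mm SS.
pose tj j := fun i => if (i < k)%N then t i else j.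
have [j nmj] : exists j, ~ meager (U M k.+1 (tj j) `&` agree m' S').
  apply: contrapT => hj; apply: nm.
  apply: (@meager_sub _ (\bigcup_j (U M k.+1 (tj j) `&` agree m' S'))).
    move=> T [[t' [Gt' tt' Tt']] ST]; exists (t' k) => //; split=> //.
    exists t'; split=> // i; rewrite ltnS leq_eqVlt => /orP[/eqP ->|ik].
      by rewrite /tj ltnn.
    by rewrite /tj ik tt'.
  by apply: meager_bigcup => j; apply: contrapT => nj; apply: hj; exists j.
have [S'' [m'' [m12 SS' h']]] := nonmeager_localize nmj.
by exists (tj j), S'', m''; split=> // i ik; rewrite /tj ik.
Qed.

Let U_mem M k t S m i : everywhere_nonmeager (U M k t) S m -> (i < k)%N ->
  (t i < m)%N /\ S (t i).
Proof.
move=> h ik; apply: contrapT => nt.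
apply: (h (splice m S (fun=> false)) (maxn m (t i).+1)); first exact: leq_maxl.
  exact: agree_splice.
apply: meager_sub (nowhere_dense_meager nowhere_dense0) => T [[t' [_ tt' Tt']] ST].
apply: nt; have := Tt' i; rewrite -tt'// -ST ?leq_maxr// /splice.
by case: ifP.
Qed.

Let U_ex M k t S m : everywhere_nonmeager (U M k t) S m ->
  exists2 t', G M t' & agree k t t'.
Proof.
move=> h; have := h S m (leqnn _) (fun _ _ => erefl) => nm.
apply: contrapT => nt; apply: nm.
apply: meager_sub (nowhere_dense_meager nowhere_dense0) => T [[t' [Gt tt' _]] _].
by apply: nt; exists t'.
Qed.

(** Sierpinski's argument that a nonprincipal ultrafilter is not analytic.  By
    the dichotomy the sets that contain a range are not meager, hence are
    everywhere nonmeager in some cylinder; by the condition on tails they are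
    not meager either in a cylinder of sets that avoid the first one.  Two
    ranges are then built simultaneously, by deciding alternately one more
    value of each function and enough of a set that contains its range, in such
    a way that the two sets remain disjoint. *)
Lemma disjoint_ranges : exists M1 M2 t1 t2,
  [/\ G M1 t1, G M2 t2 & forall i j, t1 i <> t2 j].
Proof.
pose t0 : nat -> nat := id.
(* Every set has a range in it or in its complement, and complementation is a
   translation. *)
have nmL : ~ meager has_range_in.
  move=> mL; apply: nonmeager_setT.
  apply: meager_sub (meagerU mL (meager_xor (fun=> true) mL)) => S _.
  have [h|h] := G_dichotomy S; [by left|right].
  rewrite /= (_ : (fun i => S i (+) true) = negb \o S)//.
  by apply/funext => i; rewrite /= addbT.
have LU S : has_range_in S -> exists M, U M 0%N t0 S.
  by move=> [M [t [Gt St]]]; exists M, t; split.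
have [M1 [S1 [m1 h1]]] : exists M S m, everywhere_nonmeager (U M 0%N t0) S m.
  have [M nmM] : exists M, ~ meager (U M 0%N t0 `&` agree 0 (fun=> false)).
    apply: contrapT => hM; apply: nmL.
    apply: (@meager_sub _ (\bigcup_M (U M 0%N t0 `&` agree 0 (fun=> false)))).
      by move=> S /LU[M US]; exists M => //; split.
    by apply: meager_bigcup => M; apply: contrapT => nM; apply: hM; exists M.
  by have [S [m [_ _ h]]] := nonmeager_localize nmM; exists M, S, m.
have [M2 [S2 [m2 [m12 S02 h2]]]] : exists M S m, [/\ (m1 <= m)%N,
    agree m1 (fun=> false) S & everywhere_nonmeager (U M 0%N t0) S m].
  have nm0 : ~ meager (has_range_in `&` agree m1 (fun=> false)).
    (* Translation by D carries the cylinder of S1 to the cylinder of the empty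
       set, and by the condition on tails it preserves the family there. *)
    pose D i := (i < m1)%N && S1 i.
    move=> /(meager_xor D) m0; apply: (h1 S1 m1) => //.
    apply: meager_sub m0 => S [[t [Gt _ St]] SS]; split.
      have [] := G_tail m1 (_ : has_range_in S); first by exists M1, t.
      move=> M [t' [Gt' St']]; exists M, t'; split=> // i.
      have /andP[hS hm] := St' i; rewrite /D.
      by rewrite ltnNge hm /= addbF.
    by move=> i im /=; rewrite /D im -SS//= addbb.
  have [M nmM] : exists M, ~ meager (U M 0%N t0 `&` agree m1 (fun=> false)).
    apply: contrapT => hM; apply: nm0.
    apply: (@meager_sub _ (\bigcup_M (U M 0%N t0 `&` agree m1 (fun=> false)))).
      by move=> S [/LU[M US] ?]; exists M => //; split.
    by apply: meager_bigcup => M; apply: contrapT => nM; apply: hM; exists M.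
  have [S [m [? ? h]]] := nonmeager_localize nmM; exists M, S, m; split=> //.
pose state : Type := (nat -> nat) * (nat -> nat) * ((nat -> bool) * (nat -> bool) * nat).
pose Inv k (p : state) := [/\ everywhere_nonmeager (U M1 k p.1.1) p.2.1.1 p.2.2,
  everywhere_nonmeager (U M2 k p.1.2) p.2.1.2 p.2.2 &
  forall i, (i < p.2.2)%N -> ~~ (p.2.1.1 i && p.2.1.2 i)].
have /choice[f hf] : forall kp : nat * state, exists q : state,
    Inv kp.1 kp.2 -> [/\ Inv kp.1.+1 q, agree kp.1 kp.2.1.1 q.1.1 &
                        agree kp.1 kp.2.1.2 q.1.2].
  move=> [k p]; have [Ip|nI] := pselect (Inv k p); last by exists p.
  case: p Ip => [[t1 t2] [[T1 T2] m]] [/= e1 e2 dis].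
  have [t1' [T1' [n1 [tt1 mn1 TT1 e1']]]] := U_step e1 (leqnn m) (fun _ _ => erefl).
  have [t2' [T2' [n2 [tt2 mn2 TT2 e2']]]] :=
    U_step e2 mn1 (agree_splice T2 (fun=> false)).
  (* Each of the two sets is completed by zeros where the other one has just
     been decided. *)
  exists ((t1', t2'), ((splice n1 T1' (fun=> false), T2'), n2)) => _.
  split=> //; split=> //=.
    by apply: everywhere_nonmeager_ext e1' => //; exact: agree_splice.
  move=> i in2; rewrite /splice; case: ifP => // in1.
  rewrite -TT2// /splice; case: ifP => [im|_]; last by rewrite andbF.
  by rewrite -TT1// dis.
pose p0 : state := ((t0, t0), ((splice m1 S1 (fun=> false), S2), m2)).
pose u := fix u k := if k is j.+1 then f (j, u j) else p0.
have Iu k : Inv k (u k).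
  elim: k => [|k /(hf (k, u k))[]//]; split=> //=.
    by apply: everywhere_nonmeager_ext h1 => //; exact: agree_splice.
  move=> i im; rewrite /splice; case: ifP => // im1.
  by rewrite -S02// andbF.
have uS k : agree k (u k).1.1 (u k.+1).1.1 /\ agree k (u k).1.2 (u k.+1).1.2.
  by have [_ ? ?] := hf (k, u k) (Iu k).
have lim (t : nat -> nat -> nat) : (forall k, agree k (t k) (t k.+1)) ->
    forall k, agree k (fun i => t i.+1 i) (t k).
  move=> ht k i ik.
  have : forall n, t (i.+1 + n)%N i = t i.+1 i.
    elim=> [|n IH]; first by rewrite addn0.
    by rewrite addnS -IH -ht// leq_addr.
  by move=> /(_ (k - i.+1)%N); rewrite subnKC.
pose t1 i := (u i.+1).1.1 i; pose t2 i := (u i.+1).1.2 i.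
have t1k : forall k, agree k t1 (u k).1.1.
  by apply: (lim (fun k => (u k).1.1)) => k; case: (uS k).
have t2k : forall k, agree k t2 (u k).1.2.
  by apply: (lim (fun k => (u k).1.2)) => k; case: (uS k).
exists M1, M2, t1, t2; split.
- apply: G_closed => k; have [e1 _ _] := Iu k.
  by have [t' Gt' tt'] := U_ex e1; exists t' => //; apply: agree_trans (t1k k) tt'.
- apply: G_closed => k; have [_ e2 _] := Iu k.
  by have [t' Gt' tt'] := U_ex e2; exists t' => //; apply: agree_trans (t2k k) tt'.
- move=> i j tij; pose k := (maxn i j).+1.
  have [e1 e2 dis] := Iu k.
  have ik : (i < k)%N by rewrite ltnS leq_maxl.
  have jk : (j < k)%N by rewrite ltnS leq_maxr.
  have [im Si] := U_mem e1 ik; have [_ Sj] := U_mem e2 jk.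
  have := dis _ im; rewrite Si /=.
  by rewrite -(t1k k i ik) tij (t2k k j jk) Sj.
Qed.

End DisjointRanges.

(** * Unconditional families and their subsequences *)

Section Enumerations.

Lemma left_inverse_on (I J : Type) (A : set I) (e : I -> J) (i0 : I) :
  {in A &, injective e} -> exists g, forall i, A i -> g (e i) = i.
Proof.
move=> inj.
have /choice[g hg] : forall j, exists i, forall i', A i' -> e i' = j -> i = i'.
  move=> j; have [[i [Ai ei]]|no] := pselect (exists i, A i /\ e i = j).
    by exists i => i' Ai' ei'; apply: inj; rewrite ?inE// ei.
  by exists i0 => i' Ai' ei'; case: no; exists i'.
by exists g => i Ai; apply: hg.
Qed.

Lemma infinite_image (I J : Type) (S : set I) (e : I -> J) (i0 : I) :
  {in S &, injective e} -> infinite_set S -> infinite_set (e @` S).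
Proof.
move=> /(left_inverse_on i0)[g ge] iS fS; apply: iS.
have -> : S = g @` (e @` S).
  rewrite image_comp; apply/seteqP; split.
    by move=> i Si; exists i => //=; exact: ge.
  by move=> _ [i Si <-]; rewrite /= ge.
exact: finite_image.
Qed.

Lemma infinite_enumeration (S : set nat) : infinite_set S ->
  exists2 e : nat -> nat, injective e & range e = S.
Proof.
move=> iS; have : ([set: nat] #= S)%card.
  by rewrite card_eq_sym; apply: eq_card_nat => //; exact: countableP.
move=> /card_set_bijP[e [fe ie se]]; exists e.
  by move=> i j; apply: ie; rewrite inE.
by apply/seteqP; split=> [_ [i _ <-]|k /se//]; exact: fe.
Qed.

Lemma infinite_tail (m : nat) : infinite_set [set k : nat | (m <= k)%N].
Proof.
have -> : [set k : nat | (m <= k)%N] = [set: nat] `\` `I_m.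
  apply/seteqP; split=> k /=; first by rewrite leqNgt => /negP.
  by move=> [_ /negP]; rewrite -leqNgt.
by apply: infinite_setD; [exact: infinite_nat|exact: finite_II].
Qed.

Lemma countable_enumeration (I : countType) (A : set I) (i0 : I) :
  exists N (e : nat -> I), set_bij (index_set N) A e.
Proof.
have [N] : exists N, (A #= index_set N)%card.
  have [/finite_setP[m mA]|iA] := pselect (finite_set A).
    by exists (Some m).
  by exists None; apply: eq_card_nat => //; exact: countableP.
move=> /card_set_bijP[f [ff fi fs]].
have [g gf] := left_inverse_on i0 fi.
have fg k : index_set N k -> A (g k) /\ f (g k) = k.
  by move=> /fs[i Ai <-]; rewrite gf.
exists N, g; split.
- by move=> k /fg[].
- by move=> j k; rewrite !inE => /fg[_ h1] /fg[_ h2] jk; rewrite -h1 -h2 jk.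
- by move=> i Ai; exists (f i); [exact: ff|exact: gf].
Qed.

End Enumerations.

Section UnconditionalFamilies.
Variable K : numFieldType.
Hypothesis hA : archimedean_norm K.
Implicit Types V W : normedModType K.

(** Unconditionality as an inequality, which makes sense for families that are
    not ordered and passes to subfamilies and reindexings. *)
Definition unconditional V (I : Type) (M : nat) (A : set I) (x : I -> V) : Prop :=
  forall (P : pred I) l, supported A l ->
    `|lc x [seq p <- l | P p.2]| <= M%:R * `|lc x l|.

Lemma unconditional_dominates V (I : Type) M (A : set I) (x : I -> V) (P : pred I) :
  unconditional M A x -> dominates M A x (fun i => if P i then x i else 0).
Proof. by move=> ux l Al; rewrite lc_if ux. Qed.

Lemma unconditional_sub V (I : Type) M (A B : set I) (x : I -> V) :
  A `<=` B -> unconditional M B x -> unconditional M A x.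
Proof. by move=> AB ux P l /(supported_sub AB)/ux. Qed.

Lemma unconditional_reindex V (I J : Type) M (A : set I) (B : set J)
    (e : I -> J) (x : J -> V) :
  (forall i, A i -> B (e i)) -> {in A &, injective e} ->
  unconditional M B x -> unconditional M A (x \o e).
Proof.
move=> AB inj ux P l Al.
pose Q j := `[< exists i, [/\ A i, e i = j & P i] >].
rewrite -(lc_map e x l) -lc_map.
have -> : [seq (p.1, e p.2) | p <- l & P p.2]
        = [seq p <- [seq (p.1, e p.2) | p <- l] | Q p.2].
  elim: l Al => //= p l IH /andP[/asboolP Ap Al].
  have -> : Q (e p.2) = P p.2.
    apply/asboolP/idP => [[i [Ai ei Pi]]|Pp]; last by exists p.2.
    by rewrite -(inj i p.2) ?inE.
  by case: ifP => _ /=; rewrite IH.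
by apply: ux; exact: supported_map Al.
Qed.

Lemma unconditional_scale V (I : Type) M (A : set I) (x : I -> V) (c : I -> K) :
  unconditional M A x -> unconditional M A (fun i => c i *: x i).
Proof.
move=> ux P l Al; rewrite !lc_coef.
have -> : [seq (p.1 * c p.2, p.2) | p <- l & P p.2]
        = [seq p <- [seq (p.1 * c p.2, p.2) | p <- l] | P p.2].
  by elim: l {Al} => //= p l <-; case: ifP.
by apply: ux; rewrite supported_coef.
Qed.

(** A convex function on a cube is maximal at a vertex, so the bounds for the
    multipliers 0 and 1 pass to all multipliers in the unit interval; the
    coordinates are made 0 or 1 one at a time. *)
Lemma unconditional_multiplier V (I : eqType) M (A : set I) (x : I -> V)
    (t : I -> K) :
  unconditional M A x -> (forall i, A i -> 0 <= t i <= 1) ->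
  dominates M A x (fun i => t i *: x i).
Proof.
move=> ux ht l Al.
have vertex (s : seq I) : forall u : I -> K, (forall i, 0 <= u i <= 1) ->
    (forall i, i \notin s -> (u i == 0) || (u i == 1)) ->
    `|lc (fun i => u i *: x i) l| <= M%:R * `|lc x l|.
  elim: s => [|j s IH] u hu us.
    have -> : lc (fun i => u i *: x i) l = lc x [seq p <- l | u p.2 == 1].
      rewrite -(lc_if x (fun i => u i == 1)); apply: (eq_lc (A := A)) Al => i _.
      case: ifP => [/eqP ->|u1]; first by rewrite scale1r.
      by have := us i isT; rewrite u1 orbF => /eqP ->; rewrite scale0r.
    exact: (ux (fun i => u i == 1)).
  pose w (c : K) i := if i == j then c else u i.
  have hw c : (c == 0) || (c == 1) ->
      `|lc (fun i => w c i *: x i) l| <= M%:R * `|lc x l|.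
    move=> c01; apply: IH => i; rewrite /w; case: (eqVneq i j) => // ij.
      by case/orP: c01 => /eqP ->; rewrite ?lexx ?ler01.
    by move=> js; apply: us; rewrite inE negb_or ij.
  have -> : lc (fun i => u i *: x i) l = u j *: lc (fun i => w 1 i *: x i) l
      + (1 - u j) *: lc (fun i => w 0 i *: x i) l.
    rewrite /lc !scaler_sumr -big_split; apply: eq_bigr => p _ /=.
    rewrite !scalerA -scalerDl; congr (_ *: _); rewrite /w.
    by case: eqP => [->|_]; ring.
  have /andP[u0 u1] := hu j.
  rewrite (le_trans (ler_normD _ _))// !normrZ !ger0_norm ?subr_ge0//.
  have -> : M%:R * `|lc x l| = u j * (M%:R * `|lc x l|)
      + (1 - u j) * (M%:R * `|lc x l|) by ring.
  by rewrite lerD// ler_wpM2l ?subr_ge0// hw// eqxx ?orbT.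
have -> : lc (fun i => t i *: x i) l
    = lc (fun i => (if `[< A i >] then t i else 0) *: x i) l.
  by apply: eq_lc Al => i /asboolP ->.
pose s := [seq p.2 | p <- l].
have -> : lc (fun i => (if `[< A i >] then t i else 0) *: x i) l
    = lc (fun i => (if i \in s then (if `[< A i >] then t i else 0) else 0) *: x i) l.
  rewrite /lc !big_seq; apply: eq_bigr => p pl.
  by rewrite (map_f snd pl).
apply: (vertex s) => i.
  by case: ifP => _; [case: asboolP => [/ht//|_]|]; rewrite lexx ler01.
by move=> /negPf ->; rewrite eqxx.
Qed.

(** Dividing by the norms is a bounded multiplier up to the factor D, and so is
    the inverse operation on the normalized family. *)
Lemma same_norms_normalize V (I : eqType) M (D : nat) (A : set I) (y : I -> V) :
  unconditional M A y ->
  (forall i, A i -> `|y i| <= D%:R /\ 1 <= D%:R * `|y i|) ->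
  same_norms (D * M) A y (fun i => `|y i|^-1 *: y i).
Proof.
move=> uy hD.
have yD i : A i -> 0 < `|y i| /\ (0 : K) < D%:R.
  move=> /hD[_ h].
  have /lt0r_neq0 : 0 < D%:R * `|y i| by exact: lt_le_trans h.
  rewrite !lt_neqAle normr_ge0 ler0n !andbT ![0 == _]eq_sym.
  by rewrite mulf_eq0 negb_or => /andP[].
have step (z : I -> V) (t : I -> K) : unconditional M A z ->
    (forall i, A i -> 0 <= t i <= D%:R) ->
    dominates (D * M) A z (fun i => t i *: z i).
  move=> uz ht l Al.
  have -> : lc (fun i => t i *: z i) l = D%:R *: lc (fun i => (t i / D%:R) *: z i) l.
    rewrite /lc scaler_sumr !big_seq; apply: eq_bigr => p pl.
    have /asboolP/yD[_ D0] := allP Al _ pl.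
    by rewrite !scalerA; congr (_ *: _); field; rewrite gt_eqF.
  rewrite normrZ normr_nat natrM -mulrA ler_wpM2l//.
  apply: unconditional_multiplier Al => // i Ai.
  have [_ D0] := yD _ Ai; have /andP[t0 tD] := ht _ Ai.
  by rewrite divr_ge0 ?ler0n//= ler_pdivrMr// mul1r.
split.
  apply: step => // i Ai; have [_ h] := hD _ Ai; have [y0 D0] := yD _ Ai.
  by rewrite invr_ge0 normr_ge0/= -[leLHS]mul1r ler_pdivrMr.
apply: (@eq_dominates _ _ _ _ _ _ (fun i => `|y i|^-1 *: y i) _
          (fun i => `|y i| *: (`|y i|^-1 *: y i))) => //.
  move=> i /yD[y0 _]; rewrite scalerA mulfV ?scale1r// gt_eqF//.
apply: step; first exact: unconditional_scale.
by move=> i /hD[h _]; rewrite normr_ge0.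
Qed.

(** By unconditionality the norm of a sum controls the norms of its parts over P
    and over the complement of P, on each of which an equivalence is given. *)
Lemma same_norms_glue V W (I : Type) M N C D (A : set I) (P : pred I)
    (x : I -> V) (y : I -> W) :
  unconditional M A x -> unconditional N A y ->
  same_norms C (A `&` [set i | P i]) x y ->
  same_norms D (A `&` [set i | ~~ P i]) x y ->
  same_norms ((C + D) * (M + N)) A x y.
Proof.
move=> ux uy [Cxy Cyx] [Dxy Dyx].
have aux (V1 V2 : normedModType K) (z : I -> V1) (t : I -> V2) L :
    unconditional L A z -> dominates C (A `&` [set i | P i]) z t ->
    dominates D (A `&` [set i | ~~ P i]) z t -> dominates ((C + D) * L) A z t.
  move=> uz Czt Dzt l Al.
  rewrite (lc_filterC t P) (le_trans (ler_normD _ _))//.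
  rewrite natrM -mulrA natrD mulrDl lerD//.
    rewrite (le_trans (Czt _ _)) ?ler_wpM2l ?uz//.
    by apply: supported_filterI Al => i.
  rewrite (le_trans (Dzt _ _)) ?ler_wpM2l ?(uz (fun i => ~~ P i))//.
  by apply: (supported_filterI (P := fun i => ~~ P i)) Al => i.
split.
  by apply: dominates_le (aux V W x y M ux Cxy Dxy); rewrite leq_mul2l leq_addr orbT.
by apply: dominates_le (aux W V y x N uy Cyx Dyx); rewrite leq_mul2l leq_addl orbT.
Qed.

Lemma lc_single V (I : eqType) (x : I -> V) k l :
  lc x [seq p <- l | p.2 == k] = (\sum_(p <- l | p.2 == k) p.1) *: x k.
Proof.
rewrite /lc big_filter scaler_suml; apply: eq_bigr => p /eqP ->.
by [].
Qed.

Lemma lc_sum_singles V (x : nat -> V) m l : supported `I_m l ->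
  lc x l = \sum_(k < m) lc x [seq p <- l | p.2 == k :> nat].
Proof.
move=> Al; under eq_bigr do rewrite lc_single.
rewrite /lc; under [RHS]eq_bigr do rewrite scaler_suml big_mkcond.
rewrite exchange_big /= !big_seq; apply: eq_bigr => p pl.
have /asboolP pm := allP Al _ pl.
rewrite (bigD1 (Ordinal pm))//= eqxx big1 ?addr0// => i ip.
case: eqP => // e; rewrite -val_eqE /= -e eqxx// in ip.
Qed.

(** On m indices each coefficient is controlled by the norm of the sum, by
    unconditionality, and controls its term of the other sum. *)
Lemma same_norms_finite V W M N m (A : set nat) (x : nat -> V) (y : nat -> W) :
  A `<=` `I_m -> (forall i, A i -> `|x i| = `|y i|) ->
  unconditional M A x -> unconditional N A y ->
  same_norms (m * (M + N)) A x y.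
Proof.
move=> Am xy ux uy.
have aux (V1 V2 : normedModType K) (z : nat -> V1) (t : nat -> V2) L :
    (forall i, A i -> `|t i| = `|z i|) -> unconditional L A z ->
    dominates (m * L) A z t.
  move=> tz uz l Al; rewrite (lc_sum_singles _ (supported_sub Am Al)).
  rewrite (le_trans (ler_norm_sum _ _ _))// natrM -mulrA.
  rewrite -[m in leRHS]card_ord mulr_natl -sumr_const ler_sum// => k _.
  suff -> : `|lc t [seq p <- l | p.2 == k :> nat]| = `|lc z [seq p <- l | p.2 == k :> nat]|.
    exact: (uz (fun i => i == k :> nat)).
  have [Ak|nAk] := pselect (A k); first by rewrite !lc_single !normrZ tz.
  rewrite (_ : [seq p <- l | p.2 == k :> nat] = [::]) ?lc_nil ?normr0//.
  apply/eqP; rewrite -[_ == _]negbK -has_filter; apply/hasPn => p pl.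
  have /asboolP Ap := allP Al _ pl.
  by apply: contra_notN nAk => /eqP <-.
split.
  apply: dominates_le (aux V W x y M (fun i Ai => esym (xy i Ai)) ux).
  by rewrite leq_mul2l leq_addr orbT.
apply: dominates_le (aux W V y x N xy uy).
by rewrite leq_mul2l leq_addl orbT.
Qed.

End UnconditionalFamilies.

Section Subsequences.
Variables (K : numFieldType) (V : normedModType K).
Hypothesis hA : archimedean_norm K.
Implicit Types (x : nat -> V) (S : set nat).

Definition embeds x S S' : Prop := exists (s : nat -> nat) (C : nat),
  [/\ {in S &, injective s}, forall i, S i -> S' (s i) & same_norms C S x (x \o s)].

(** c S is the number of the isomorphism class of the span of S; equality of
    classes enters only through the embeddings that it provides. *)
Definition finitely_many_types (n : nat) x : Prop :=
  exists c : set nat -> nat,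
    (forall S, infinite_set S -> (c S < n)%N) /\
    forall S S', infinite_set S -> infinite_set S' -> c S = c S' -> embeds x S S'.

Definition normalized_unconditional x : Prop :=
  (forall k, `|x k| = 1) /\ exists M, unconditional M [set: nat] x.

Lemma normalized_unconditional_comp x (e : nat -> nat) : injective e ->
  normalized_unconditional x -> normalized_unconditional (x \o e).
Proof.
move=> ie [nx [M ux]]; split; first by move=> k; exact: nx.
by exists M; apply: unconditional_reindex ux => // i j _ _; exact: ie.
Qed.

Lemma embeds_comp x (e : nat -> nat) S S' : injective e ->
  embeds x (e @` S) (e @` S') -> embeds (x \o e) S S'.
Proof.
move=> ie [s [C [is_ ss sn]]].
have [g ge] := @left_inverse_on _ _ [set: nat] e 0%N (in2W ie).
have eg k : range e k -> e (g k) = k by move=> [i _ <-]; rewrite ge.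
have se i : S i -> exists2 j, S' j & e j = s (e i) by move=> Si; apply: ss; exists i.
exists (g \o s \o e), C; split.
- move=> i j; rewrite !inE => Si Sj /= /(congr1 e).
  have [i' _ ei'] := se _ Si; have [j' _ ej'] := se _ Sj.
  rewrite !eg; [|by exists j'|by exists i'] => /is_ h.
  by apply: ie; apply: h; rewrite inE; [exists i|exists j].
- by move=> i Si /=; have [j S'j <-] := se _ Si; rewrite ge.
- apply: (@eq_same_norms _ _ _ _ _ S (x \o e) _ (x \o s \o e)).
  + by [].
  + by move=> i Si /=; have [j S'j <-] := se _ Si; rewrite ge.
  + by apply: same_norms_reindex sn => i Si; exists i.
Qed.

(** Among the n + 1 tails that start at j * m for j <= n, two have the same
    type; the equivalence between them is prolonged by a translation by m on
    the remaining initial segment, where all injections are equivalences. *)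
Lemma embeds_tail n x m : normalized_unconditional x ->
  finitely_many_types n x -> embeds x [set: nat] [set k | (m <= k)%N].
Proof.
move=> [nx [M ux]] [c [cn ce]].
pose B j := [set k : nat | (j * m <= k)%N].
have iB j : infinite_set (B j) by exact: infinite_tail.
have [i [j [ij cij]]] : exists i j : nat, (i < j)%N /\ c (B i) = c (B j).
  have [i [j [/eqP ij cij]]] : exists i j : 'I_n.+1, i <> j /\ c (B i) = c (B j).
    apply: contrapT => no.
    have inj : injective (fun i : 'I_n.+1 => Ordinal (cn _ (iB i))).
      move=> i j /(congr1 val) /= cij; apply: contrapT => ij.
      by apply: no; exists i, j.
    by have := leq_card _ inj; rewrite !card_ord ltnn.
  have [ltij|ltji|/val_inj e] := ltngtP i j.
  - by exists i, j.
  - by exists j, i.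
  - by rewrite e eqxx in ij.
have [s [C [is_ ss sn]]] := ce _ _ (iB i) (iB j) cij.
have ijm : (i * m + m <= j * m)%N by rewrite addnC -mulSn leq_mul2r ij orbT.
pose t k := if (k < i * m)%N then (k + m)%N else s k.
have sB k : (k < i * m)%N = false -> B i k by move=> /negbT; rewrite -leqNgt.
have it : injective t.
  have aux k k' : (k < i * m)%N -> (k' < i * m)%N = false -> t k <> t k'.
    move=> kk kk'; rewrite /t kk kk' => e.
    have := ss _ (sB _ kk'); rewrite -e /B /= leqNgt => /negP; apply.
    by apply: leq_trans ijm; rewrite ltn_add2r.
  move=> k k'; case: (boolP (k < i * m)%N) => kk; case: (boolP (k' < i * m)%N) => kk'.
  - by rewrite /t kk kk' => /addIn.
  - by move=> /aux; rewrite (negbTE kk') => /(_ kk erefl).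
  - by move=> /esym /aux; rewrite (negbTE kk) => /(_ kk' erefl).
  - rewrite /t (negbTE kk) (negbTE kk') => /is_; apply; rewrite inE;
      exact/sB/negbTE.
have ut : unconditional M [set: nat] (x \o t).
  by apply: unconditional_reindex ux => // ? ? _ _; exact: it.
exists t, ((i * m * (M + M) + C) * (M + M))%N; split.
- by move=> ? ? _ _; exact: it.
- move=> k _; rewrite /t /=; case: ifP => [_|/sB/ss]; first exact: leq_addl.
  rewrite /B /=; apply: leq_trans.
  by apply: leq_trans ijm; exact: leq_addl.
- apply: (@same_norms_glue _ _ _ _ _ _ _ _ _ (fun k => (k < i * m)%N)) => //.
    apply: same_norms_finite => //.
    + by move=> k _ /=; rewrite !nx.
    + by apply: unconditional_sub ux.
    + by apply: unconditional_sub ut.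
  apply: (@eq_same_norms _ _ _ _ _ _ x _ (x \o s)) => //.
    by move=> k [_ /= /negbTE kk]; rewrite /t kk.
  by apply: same_norms_sub sn => k [_ /= /negbTE/sB].
Qed.

Definition doubling x : Prop := exists (s t : nat -> nat) (C : nat),
  [/\ injective s, injective t, forall i j, s i <> t j,
      same_norms C [set: nat] x (x \o s) & same_norms C [set: nat] x (x \o t)].

Lemma same_norms_le (W W' : normedModType K) (I : Type) C D (A : set I)
    (x : I -> W) (y : I -> W') :
  (C <= D)%N -> same_norms C A x y -> same_norms D A x y.
Proof. by move=> CD [? ?]; split; exact: dominates_le CD _. Qed.

(** A copy of x with a given constant is a closed condition on the injection,
    as every linear combination involves finitely many indices; and a copy in S
    can be moved off any finite set by first embedding x in a tail. *)
Lemma doubling_dichotomy n x : normalized_unconditional x ->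
  finitely_many_types n x ->
  (forall S, embeds x [set: nat] S \/ embeds x [set: nat] (~` S)) -> doubling x.
Proof.
move=> nux fx dich.
pose G M := [set t : nat -> nat | injective t /\ same_norms M [set: nat] x (x \o t)].
have GE (S : nat -> bool) : has_range_in G S <-> embeds x [set: nat] [set k | S k].
  split=> [[M [t [[it nt] St]]]|[t [M [it St nt]]]].
    by exists t, M; split=> [? ? _ _|i _|//]; [exact: it|exact: St].
  exists M, t; split; last by move=> i; exact: St.
  by split=> // i j; apply: it; rewrite inE.
have [||S m hS|M1 [M2 [s [t [[is_ ns] [it nt] st]]]]] := @disjoint_ranges G.
- move=> M t ht; split.
    move=> i j tij; have [t' [it' _] tt'] := ht (maxn i j).+1.
    by apply: it'; rewrite -!tt' ?ltnS ?leq_maxl ?leq_maxr.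
  have aux l : exists2 t', G M t' & lc (x \o t) l = lc (x \o t') l.
    pose m := (\max_(p <- l) p.2).+1.
    have [t' Gt' tt'] := ht m; exists t' => //.
    apply: (eq_lc (A := `I_m)); first by move=> i im /=; rewrite tt'.
    apply/allP => p pl; apply/asboolP; rewrite /= ltnS.
    by rewrite (@leq_bigmax_seq _ l xpredT (fun q : K * nat => q.2)).
  by split=> l Al; have [t' [_ [h1 h2]] ->] := aux l; [exact: h1|exact: h2].
- move=> S; have [h|h] := dich [set k | S k]; [left|right]; apply/GE => //.
  case: h => [s [C [? sS ?]]]; exists s, C; split=> // i /sS /negP.
  by [].
- have [s [C [is_ sS sn]]] := (GE S).1 hS; apply/GE.
  have [b hb] : exists b, forall i, (s i < m)%N -> (i < b)%N.
    have [g gs] := left_inverse_on 0%N is_.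
    exists (\max_(k < m) g k).+1 => i im; rewrite ltnS -{1}(gs i I).
    exact: (leq_bigmax (Ordinal im)).
  have [t [D [it tt tn]]] := embeds_tail b nux fx.
  exists (s \o t), (C * D)%N; split.
  + by move=> i j _ _ /= /is_ h; apply: it; rewrite ?inE//; apply: h; rewrite inE.
  + move=> i _ /=; rewrite sS//= leqNgt; apply/negP => /hb.
    by rewrite ltnNge (tt i I).
  + apply: same_norms_trans tn _.
    by apply: (same_norms_reindex (e := t)) sn.
- exists s, t, (M1 + M2)%N; split=> //.
    exact: same_norms_le (leq_addr _ _) ns.
  exact: same_norms_le (leq_addl _ _) nt.
Qed.

Lemma doubling_glue x (e f : nat -> nat) : normalized_unconditional x ->
  injective e -> injective f -> range f = ~` range e ->
  doubling (x \o e) -> doubling (x \o f) -> doubling x.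
Proof.
move=> [nx [M ux]] ie if_ fe [s [t [C [is_ it st ns nt]]]].
move=> [s' [t' [C' [is' it' st' ns' nt']]]].
have [g ge] := @left_inverse_on _ _ [set: nat] e 0%N (in2W ie).
have [h hf] := @left_inverse_on _ _ [set: nat] f 0%N (in2W if_).
pose P k := `[< range e k >].
have PE k : P k -> exists i, k = e i by move=> /asboolP[i _ <-]; exists i.
have PN k : P k = false -> exists i, k = f i.
  move=> /asboolPn; rewrite -[~ _]/((~` range e) k) -fe => -[i _ <-].
  by exists i.
have Pe i : P (e i) by apply/asboolP; exists i.
have Pf i : P (f i) = false.
  by apply/asboolPn; rewrite -[~ _]/((~` range e) (f i)) -fe; exists i.
pose glue (u u' : nat -> nat) k := if P k then e (u (g k)) else f (u' (h k)).
have gluee u u' i : glue u u' (e i) = e (u i) by rewrite /glue Pe ge.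
have gluef u u' i : glue u u' (f i) = f (u' i) by rewrite /glue Pf hf.
have ef i j : e i <> f j by move=> /(congr1 P); rewrite Pe Pf.
have inj u u' : injective u -> injective u' -> injective (glue u u').
  move=> iu iu' k l.
  case Pk : (P k); case Pl : (P l); [have [i ->] := PE _ Pk|have [i ->] := PE _ Pk
    |have [i ->] := PN _ Pk|have [i ->] := PN _ Pk];
  [have [j ->] := PE _ Pl|have [j ->] := PN _ Pl|have [j ->] := PE _ Pl
    |have [j ->] := PN _ Pl]; rewrite ?gluee ?gluef.
  - by move=> /ie /iu ->.
  - by move=> /ef.
  - by move=> /esym /ef.
  - by move=> /if_ /iu' ->.
have norms u u' : injective u -> injective u' ->
    same_norms C [set: nat] (x \o e) (x \o e \o u) ->
    same_norms C' [set: nat] (x \o f) (x \o f \o u') ->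
    same_norms ((C + C') * (M + M)) [set: nat] x (x \o glue u u').
  move=> iu iu' nu nu'; apply: (@same_norms_glue _ _ _ _ _ _ _ _ _ P) => //.
  - by apply: unconditional_reindex ux => // ? ? _ _; exact: inj.
  - apply: (@eq_same_norms _ _ _ _ _ _ (x \o e \o g) _ (x \o e \o u \o g)).
    + by move=> k [_ /= /PE[i ->]]; rewrite ge.
    + by move=> k [_ /= /PE[i ->]]; rewrite gluee ge.
    + exact: (same_norms_reindex (B := [set: nat]) (e := g)).
  - apply: (@eq_same_norms _ _ _ _ _ _ (x \o f \o h) _ (x \o f \o u' \o h)).
    + by move=> k [_ /= /negbTE/PN[i ->]]; rewrite hf.
    + by move=> k [_ /= /negbTE/PN[i ->]]; rewrite gluef hf.
    + exact: (same_norms_reindex (B := [set: nat]) (e := h)).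
exists (glue s s'), (glue t t'), ((C + C') * (M + M))%N; split.
- exact: inj.
- exact: inj.
- move=> k l; case Pk : (P k); case Pl : (P l); [have [i ->] := PE _ Pk|have [i ->] := PE _ Pk
    |have [i ->] := PN _ Pk|have [i ->] := PN _ Pk];
  [have [j ->] := PE _ Pl|have [j ->] := PN _ Pl|have [j ->] := PE _ Pl
    |have [j ->] := PN _ Pl]; rewrite ?gluee ?gluef.
  + by move=> /ie; exact: st.
  + exact: ef.
  + by move=> /esym; exact: ef.
  + by move=> /if_; exact: st'.
- exact: norms.
- exact: norms.
Qed.

(** If the whole sequence embeds in neither of two complementary
    subsequences, then their subsequences miss its type, and induction applies
    to both; otherwise the topological argument applies. *)
Lemma finitely_many_types_doubling n x : normalized_unconditional x ->
  finitely_many_types n x -> doubling x.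
Proof.
elim: n x => [|n IH] x nux fx.
  by case: fx => c [cn _]; have := cn _ infinite_nat.
have [dich|/existsNP[S /not_orP[nS nS']]] :=
    pselect (forall S, embeds x [set: nat] S \/ embeds x [set: nat] (~` S)).
  exact: doubling_dichotomy fx dich.
have [c [cn ce]] := fx.
have types T : ~ embeds x [set: nat] T -> infinite_set T ->
    forall e, injective e -> range e = T -> doubling (x \o e).
  move=> nT iT e ie eT; apply: IH; first exact: normalized_unconditional_comp.
  have iim (U : set nat) : infinite_set U -> infinite_set (e @` U).
    by apply: infinite_image => // ? ? _ _; exact: ie.
  have cT (U : set nat) : infinite_set U -> c (e @` U) <> c [set: nat].
    move=> iU cU; apply: nT.
    have [s [C [h1 h2 h3]]] := ce _ _ infinite_nat (iim _ iU) (esym cU).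
    by exists s, C; split=> // i /h2[j _ <-]; rewrite -eT; exists j.
  (* The type of the whole sequence no longer occurs: its number is reused for
     the type n. *)
  pose c' U := if c (e @` U) == n then c [set: nat] else c (e @` U).
  exists c'; split=> [U iU|U U' iU iU' cU].
    have := cn _ (iim _ iU); have := cn _ infinite_nat; have := cT _ iU.
    rewrite /c'; case: eqP => [->|ne _ _]; rewrite !ltnS leq_eqVlt.
      by case: eqP => [->//|_ _ /= ->].
    by case: eqP.
  apply: embeds_comp => //; apply: ce; [exact: iim|exact: iim|].
  move: cU; rewrite /c'; have := cT _ iU; have := cT _ iU'.
  have [e1|_] := eqVneq (c (e @` U)) n; have [e2|_] := eqVneq (c (e @` U')) n.
  - by rewrite e1 e2.
  - by move=> h1 _ h3; case: h1.
  - by move=> _ h2 h3; case: h2.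
  - by [].
have finite_compl T : finite_set T -> embeds x [set: nat] (~` T).
  move=> /finite_seqP[s Ts].
  have [t [C [h1 h2 h3]]] := embeds_tail (\max_(k <- s) k).+1 nux fx.
  exists t, C; split=> // i _; rewrite Ts /= => ti.
  have := h2 i I; rewrite /= ltnNge => /negP; apply.
  by rewrite (@leq_bigmax_seq _ s xpredT id).
have iS : infinite_set S by move=> /finite_compl.
have iS' : infinite_set (~` S) by move=> /finite_compl; rewrite setCK.
have [e ie eS] := infinite_enumeration iS.
have [f if_ fS] := infinite_enumeration iS'.
apply: (doubling_glue nux ie if_); first by rewrite eS.
  exact: types eS.
exact: types fS.
Qed.

(** With A the range of one copy, the other copy embeds the whole sequence
    into the complement of A, and the Cantor-Bernstein argument turns this
    embedding into an equivalence onto the complement. *)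
Lemma doubling_partition x : normalized_unconditional x -> doubling x ->
  exists (s t : nat -> nat) (C : nat),
  [/\ injective s, injective t, range t = ~` range s,
      same_norms C [set: nat] x (x \o s) & same_norms C [set: nat] x (x \o t)].
Proof.
move=> [nx [M ux]] [s [t [C [is_ it st ns nt]]]].
(* P is the orbit of the range of s under t; moving it by t frees exactly that
   range. *)
pose P k := `[< exists n i, k = iter n t (s i) >].
have Pt k : P k -> P (t k) by move=> /asboolP[n [i ->]]; apply/asboolP; exists n.+1, i.
have Ps i : P (s i) by apply/asboolP; exists 0%N, i.
pose h k := if P k then t k else k.
have ih : injective h.
  move=> k l; rewrite /h; case: ifP => Pk; case: ifP => Pl //.
  - exact: it.
  - by move=> e; rewrite -e Pt in Pl.
  - by move=> e; rewrite e Pt in Pk.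
exists s, h, ((C + 1) * (M + M))%N; split=> //.
- apply/seteqP; split=> [_ [k _ <-] [i _]|k nk].
    rewrite /h; case: ifP => Pk; first exact: st.
    by move=> e; rewrite -e Ps in Pk.
  have [Pk|Pk] := boolP (P k); last by exists k => //; rewrite /h (negbTE Pk).
  have [[|n] [i ek]] := asboolP _ Pk; first by case: nk; exists i.
  exists (iter n t (s i)) => //; rewrite /h ek.
  by have -> : P (iter n t (s i)) by apply/asboolP; exists n, i.
- have [M0|M0] := posnP M.
    have := ux xpredT [:: (1, 0%N)] (supportedT _).
    by rewrite M0 mul0r /= lc_cons lc_nil scale1r addr0 nx ler10.
  apply: same_norms_le ns; rewrite addn1 -[C]muln1 leq_mul ?muln1// addn_gt0 M0.
  by [].
- apply: (@same_norms_glue _ _ _ _ _ _ _ _ _ P _ _ ux).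
  + by apply: unconditional_reindex ux => // ? ? _ _; exact: ih.
  + apply: (@eq_same_norms _ _ _ _ _ _ x _ (x \o t)) => //.
      by move=> k [_ /= Pk]; rewrite /h Pk.
    by apply: same_norms_sub nt.
  + apply: (@eq_same_norms _ _ _ _ _ _ x _ x) => //.
      by move=> k [_ /= /negbTE Pk]; rewrite /h Pk.
    exact: same_norms_refl.
Qed.

End Subsequences.

(** * Unconditional families are bases of their closed spans *)

Section FamiliesAreBases.
Variables (K : numFieldType) (V : normedModType K).
Hypotheses (hA : archimedean_norm K) (hK : seq_complete K) (cV : seq_complete V).

Lemma line_subspace (w : V) : is_subspace [set v | exists c : K, v = c *: w].
Proof.
split; first by exists 0; rewrite scale0r.
move=> a _ _ [c ->] [d ->]; exists (a * c + d).
by rewrite scalerDl scalerA.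
Qed.

Lemma line_closed (w : V) : w != 0 -> seq_closed [set v | exists c : K, v = c *: w].
Proof.
move=> w0 v hv; have nw : 0 < `|w| by rewrite normr_gt0.
have /choice[c hc] : forall n : nat, exists c : K, `|v - c *: w| <= (2 ^+ n)^-1.
  move=> n; have [|_ [c ->] h] := hv (2 ^+ n)^-1.
    by rewrite invr_gt0 exprn_gt0.
  by exists c.
have small e : 0 < e -> exists N, forall n, (N <= n)%N -> `|v - c n *: w| <= e.
  move=> e0; have [N hN] := archimedean_pow2 hA e0; exists N => n Nn.
  rewrite (le_trans (hc n))// (le_trans _ hN)//.
  by rewrite lef_pV2 ?posrE ?exprn_gt0// ler_weXn2l// ler1n.
have [d hd] : exists d, seq_lim c d.
  apply: hK => e e0; have e1 : 0 < e * `|w| / 2 by rewrite divr_gt0// mulr_gt0.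
  have [N hN] := small _ e1; exists N => n Nn.
  rewrite -(ler_pM2r nw) -normrZ scalerBl.
  rewrite (_ : _ - _ = (v - c N *: w) - (v - c n *: w)); last first.
    by rewrite opprB [RHS]addrC addrA subrK.
  by rewrite [leRHS]splitr (le_trans (ler_normB _ _))// lerD ?hN.
exists d; apply/subr0_eq/norm_eq0_eps => e e0.
have e2 : 0 < e / 2 by rewrite divr_gt0.
have [N hN] := small _ e2.
have [N' hN'] := hd _ (divr_gt0 e2 nw).
rewrite (_ : _ - _ = (v - c (maxn N N') *: w) + (c (maxn N N') - d) *: w); last first.
  by rewrite scalerBl addrA subrK.
rewrite [leRHS]splitr (le_trans (ler_normD _ _))// lerD ?hN ?leq_maxl//.
by rewrite normrZ -ler_pdivlMr// hN' ?leq_maxr.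
Qed.

Section NaturalIndices.
Variables (N : option nat) (x : nat -> V) (M : nat).
Let J := index_set N.
Hypotheses (ux : unconditional M J x) (x0 : forall k, J k -> x k != 0).
Let E := cspan J x.

Lemma coordinate_projection (P : pred nat) : exists T : V -> V,
  [/\ bounded_map E E T, forall k, J k -> T (x k) = if P k then x k else 0 &
      forall v, E v -> `|T v| <= M%:R * `|v|].
Proof.
have [T [bT Tx CT]] := extend_linear hA cV (unconditional_dominates P ux).
exists T; split=> //; apply: bounded_map_sub bT => //.
apply: cspan_min; [exact: cspan_subspace|exact: cspan_closed|].
move=> k Jk /=; case: ifP => _; first exact: cspan_mem.
by case: (@cspan_subspace K hA V _ J x).
Qed.

(** The sum of the coordinates of v over a finite set F of indices is the value
    at v of a projection, and these projections are uniformly bounded and equal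
    to the identity at a given finite combination as soon as F is large.  So
    the net of the sums over finite sets converges to v, which gives the
    convergence of every rearrangement at once. *)
Lemma family_basis : unconditional_basis E N x.
Proof.
have sE : is_subspace E by exact: cspan_subspace.
have Ex k : J k -> E (x k) by exact: cspan_mem.
have /choice[T hT] := coordinate_projection.
have bT P : bounded_map E E (T P) by case: (hT P).
have Tx P k : J k -> T P (x k) = if P k then x k else 0 by case: (hT P) => _ h _; exact: h.
have TM P v : E v -> `|T P v| <= M%:R * `|v| by case: (hT P) => _ _; exact.
pose Tk k := T (pred1 k).
have /choice[a ha] : forall v, exists a : nat -> K,
    forall k, J k -> E v -> Tk k v = a k *: x k.
  move=> v.
  suff /choice[a ha] : forall k, exists c : K, J k -> E v -> Tk k v = c *: x k.
    by exists a.
  move=> k.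
  have [Jk|nJ] := pselect (J k); last by exists 0.
  have [Ev|nE] := pselect (E v); last by exists 0.
  have [S [bS Sx _]] := extend_linear hA cV (unconditional_dominates (pred1 k) ux).
  have [c hc] : exists c : K, S v = c *: x k.
    have [_ /(_ v Ev) h _] := bS.
    suff /(_ _ h) : cspan J (fun i => if pred1 k i then x i else 0)
        `<=` [set w | exists c : K, w = c *: x k] by [].
    apply: cspan_min.
    - exact: line_subspace.
    - exact: line_closed (x0 Jk).
    - move=> i Ji /=; case: eqP => [->|_]; first by exists 1; rewrite scale1r.
      by exists 0; rewrite scale0r.
  exists c => _ _; rewrite -hc; apply: (bounded_maps_eq hA (bT _) bS) => //.
  by move=> i Ji; rewrite Tx// Sx.
have sumT F v : uniq F -> E v -> \sum_(k <- F) Tk k v = T [in F] v.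
  move=> uF Ev; elim: F uF => [_|j F IH /= /andP[jF uF]].
    rewrite big_nil; apply: (bounded_maps_eq hA (bounded_map0 _ sE) (bT _)) Ev => i Ji.
    by rewrite Tx.
  rewrite big_cons IH//.
  apply: (bounded_maps_eq hA (bounded_map_add sE (bT _) (bT _)) (bT _)) Ev => i Ji.
  rewrite !Tx//= in_cons; case: eqP => [->|_]; last by rewrite add0r.
  by rewrite (negbTE jF) addr0.
have conv v e : E v -> 0 < e -> exists L : seq nat, (forall i, i \in L -> J i) /\
    forall F, uniq F -> {subset L <= F} -> `|\sum_(k <- F) Tk k v - v| <= e.
  move=> Ev e0; have [l Jl vl] := Ev _ (divn_gt0_eps M.+1 e0).
  have JL p : p \in l -> J p.2 by move=> /(allP Jl)/asboolP.
  exists [seq p.2 | p <- l]; split; first by move=> _ /mapP[p /JL Jp ->].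
  move=> F uF LF; rewrite sumT//.
  have El : E (lc x l) by exact: cspan_lc.
  have Tl : T [in F] (lc x l) = lc x l.
    have [lT _ _] := bT [in F]; have [_ ->] := lc_linear sE lT Ex Jl.
    rewrite /lc !big_seq; apply: eq_bigr => p pl; rewrite /= Tx; last exact: JL.
    by rewrite /= LF//; apply/mapP; exists p.
  have -> : T [in F] v - v = T [in F] (v - lc x l) - (v - lc x l).
    have [lT _ _] := bT [in F]; rewrite (linear_onB lT)// Tl opprB addrA.
    by rewrite subrK.
  have Evl : E (v - lc x l) by exact: (subspaceB sE).
  rewrite (le_trans (ler_normB _ _))// (le_trans (lerD (TM _ _ Evl) (lexx _)))//.
  rewrite -[X in _ + X]mul1r -mulrDl natr1 (le_trans _ (mul_eps M.+1 e0))//.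
  by rewrite ler_wpM2l.
have aperm v (pi : nat -> nat) : E v -> set_bij J J pi ->
    expansion N (x \o pi) (a v \o pi) v.
  move=> Ev [fpi ipi spi]; apply/cvg_seq_lim => e e0.
  have [L [JL hL]] := conv _ _ Ev e0.
  have [m hm] : exists m, forall i, i \in L ->
      exists k, [/\ J k, (k < m)%N & pi k = i].
    elim: L JL {hL} => [|i L IH] JL; first by exists 0%N.
    have [m hm] : exists m, forall i, i \in L ->
        exists k, [/\ J k, (k < m)%N & pi k = i].
      by apply: IH => j jL; apply: JL; rewrite in_cons jL orbT.
    have [k Jk ki] : exists2 k, J k & pi k = i.
      by apply: spi; apply: JL; rewrite in_cons eqxx.
    exists (maxn m k.+1) => j; rewrite in_cons => /orP[/eqP ->|/hm[k' [? km ?]]].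
      by exists k; split=> //; rewrite leq_maxr.
    by exists k'; split=> //; rewrite (leq_trans km)// leq_maxl.
  exists m => n mn; pose F := [seq pi k | k <- index_iota 0 n & k \in J].
  have -> : \sum_(0 <= k < n | k \in J) (a v \o pi) k *: (x \o pi) k
      = \sum_(k <- F) Tk k v.
    rewrite big_map big_filter; apply: eq_bigr => k; rewrite inE => Jk.
    by rewrite ha//; exact: fpi.
  apply: hL => [|i /hm[k [Jk km <-]]].
    rewrite map_inj_in_uniq ?filter_uniq ?iota_uniq// => i j.
    rewrite !mem_filter => /andP[Ji _] /andP[Jj _]; exact: ipi.
  apply/map_f; rewrite mem_filter mem_set//= mem_index_iota.
  exact: leq_trans mn.
have bid : set_bij J J id by split=> // i Ji; exists i.
have uniq_coef v b k : E v -> expansion N x b v -> J k -> b k = a v k.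
  move=> Ev /cvg_seq_lim vb Jk.
  suff e : Tk k v = b k *: x k.
    apply/eqP; rewrite -subr_eq0 -[_ == 0]orbF -(negbTE (x0 Jk)) -scaler_eq0.
    by rewrite scalerBl -e ha// subrr.
  apply/subr0_eq/norm_eq0_eps => e e0.
  have [n hn] := vb _ (divn_gt0_eps M e0).
  pose m := maxn n k.+1; have := hn m (leq_maxl _ _).
  set s := (\sum_(0 <= i < m | _) _) => sv.
  have Es : E s.
    by apply: subspace_sum => // i; rewrite inE => Ji; exact: (subspaceZ _ sE (Ex _ Ji)).
  have Ts : Tk k s = b k *: x k.
    have [lT _ _] := bT (pred1 k).
    rewrite /Tk /s (linear_on_sum sE lT); last by move=> i; rewrite inE; exact: Ex.
    rewrite big_mkcond (bigD1_seq k) ?iota_uniq//=; last first.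
      by rewrite mem_index_iota /= leq_maxr.
    rewrite mem_set// Tx//= eqxx big1 ?addr0// => i ik.
    case: ifP => //; rewrite inE => Ji.
    by rewrite Tx//= (negbTE ik) scaler0.
  have [lT _ _] := bT (pred1 k).
  rewrite -Ts -(linear_onB lT)// (le_trans (TM _ _ (subspaceB sE Ev Es)))//.
  by rewrite (le_trans _ (mul_eps M e0))// ler_wpM2l// distrC.
split; first split=> //.
  move=> v Ev; exists (a v); split; first exact: (aperm v id).
  by move=> b hb k Jk; exact: uniq_coef.
move=> v b Ev hb pi bpi.
have -> : expansion N (x \o pi) (b \o pi) v <-> expansion N (x \o pi) (a v \o pi) v.
  rewrite /expansion; have -> : (fun m => \sum_(0 <= k < m | k \in index_set N) (b \o pi) k *: (x \o pi) k)
      = (fun m => \sum_(0 <= k < m | k \in index_set N) (a v \o pi) k *: (x \o pi) k).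
    apply/funext => m; apply: eq_bigr => k; rewrite inE => Jk /=.
    by rewrite (uniq_coef v b)//; case: bpi => f _ _; exact: f.
  by [].
exact: aperm.
Qed.

End NaturalIndices.

Lemma enumerated_family_basis (I : Type) (A : set I) (x : I -> V) (M : nat)
    (N : option nat) (e : nat -> I) :
  unconditional M A x -> (forall i, A i -> x i != 0) ->
  set_bij (index_set N) A e -> unconditional_basis (cspan A x) N (x \o e).
Proof.
move=> ux x0 be; rewrite -(cspan_reindex hA x be).
have [fe ie _] := be.
apply: (@family_basis _ _ M); first exact: unconditional_reindex ux.
by move=> k /fe; exact: x0.
Qed.

End FamiliesAreBases.

(** * Unconditional bases satisfy the unconditional inequality *)

Section BasesAreUnconditionalFamilies.
Variables (K : numFieldType) (V : normedModType K).
Hypotheses (hA : archimedean_norm K) (hK : seq_complete K) (cV : seq_complete V).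

Lemma pow2V_gt0 n : 0 < (2 ^+ n)^-1 :> K.
Proof. by rewrite invr_gt0 exprn_gt0. Qed.

Lemma pow2V_le n m : (n <= m)%N -> (2 ^+ m)^-1 <= (2 ^+ n)^-1 :> K.
Proof.
by move=> nm; rewrite lef_pV2 ?posrE ?exprn_gt0// ler_weXn2l// ler1n.
Qed.

Lemma pow2V_half n : (2 ^+ n)^-1 = (2 ^+ n.+1)^-1 + (2 ^+ n.+1)^-1 :> K.
Proof. by rewrite exprS invfM -mulrDl [X in X * _](_ : _ = 1) ?mul1r// [RHS]splitr !mul1r. Qed.

(** Baire's theorem inside a closed subspace.  If every ball contained a point
    away from A n for each n, balls of radius a power of 1/2 could be nested so
    as to avoid all the sets A n. *)
Lemma baire_cover (E : set V) (A : nat -> set V) :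
  is_subspace E -> seq_closed E -> (forall v, E v -> exists n, A n v) ->
  exists n v r, [/\ E v, 0 < r & forall w, E w -> `|w - v| <= r ->
    forall e, 0 < e -> exists2 u, A n u & `|w - u| <= e].
Proof.
move=> sE cE EA; apply: contrapT => no.
have /choice[f hf] : forall p : nat * (V * nat), exists q : V * nat,
    E p.2.1 -> [/\ E q.1, (p.2.2 < q.2)%N, `|q.1 - p.2.1| <= (2 ^+ p.2.2.+1)^-1
      & forall z, `|z - q.1| <= (2 ^+ q.2)^-1 -> ~ A p.1 z].
  move=> [n [v k]] /=; have [Ev|nE] := pselect (E v); last by exists (v, k).
  have [w [Ew wv [e [e0 hw]]]] : exists w, [/\ E w, `|w - v| <= (2 ^+ k.+1)^-1 &
      exists e, 0 < e /\ forall u, A n u -> ~ `|w - u| <= e].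
    apply: contrapT => h; apply: no; exists n, v, (2 ^+ k.+1)^-1.
    split=> // w Ew wv e e0.
    apply: contrapT => h'; apply: h; exists w; split=> //; exists e; split=> //.
    by move=> u Au wu; apply: h'; exists u.
  have [j hj] := archimedean_pow2 hA e0.
  exists (w, maxn j k.+1) => _; split=> //=; first exact: leq_maxr.
  move=> z zw /hw; apply; rewrite distrC (le_trans zw)// (le_trans _ hj)//.
  by rewrite pow2V_le// leq_maxl.
pose u := fix u n := if n is j.+1 then f (j, u j) else (0 : V, 0%N).
have Eu n : E (u n).1.
  elim: n => [|n IH]; first by case: sE.
  by case: (hf (n, u n) IH).
have uS n : [/\ ((u n).2 < (u n.+1).2)%N, `|(u n.+1).1 - (u n).1| <= (2 ^+ (u n).2.+1)^-1
    & forall z, `|z - (u n.+1).1| <= (2 ^+ (u n.+1).2)^-1 -> ~ A n z].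
  by case: (hf (n, u n) (Eu n)).
have un n : (n <= (u n).2)%N.
  by elim: n => // n IH; case: (uS n) => h _ _; exact: leq_ltn_trans h.
have near n m : `|(u (n + m)%N).1 - (u n).1| <= (2 ^+ (u n).2)^-1 - (2 ^+ (u (n + m)%N).2)^-1.
  elim: m => [|m IH]; first by rewrite addn0 !subrr normr0.
  have [h1 h2 _] := uS (n + m)%N; rewrite addnS.
  rewrite (_ : _ - (u n).1 = ((u (n + m).+1).1 - (u (n + m)%N).1)
      + ((u (n + m)%N).1 - (u n).1)); last by rewrite addrA subrK.
  rewrite (le_trans (ler_normD _ _))// (le_trans (lerD h2 IH))//.
  rewrite addrCA lerD2l (pow2V_half (u (n + m)%N).2) opprD addrA subrr add0r.
  by rewrite lerN2 pow2V_le.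
have near' n m : (n <= m)%N -> `|(u m).1 - (u n).1| <= (2 ^+ (u n).2)^-1.
  move=> /subnKC <-; rewrite (le_trans (near _ _))// gerBl.
  exact/ltW/pow2V_gt0.
have [l ul] : exists l, seq_lim (fun n => (u n).1) l.
  apply: cV => e e0; have [N hN] := archimedean_pow2 hA e0.
  exists N => n Nn; rewrite (le_trans (near' _ _ Nn))// (le_trans _ hN)//.
  exact: pow2V_le.
have El : E l.
  apply: cE => e /ul[N hN]; exists (u N).1; first exact: Eu.
  by rewrite distrC hN.
have [n An] := EA l El.
have [_ _ /(_ l)] := uS n; apply=> //.
apply: norm_le_eps => e e0; have [N hN] := ul _ e0.
rewrite (_ : _ - _ = ((u (maxn N n.+1)).1 - (u n.+1).1) - ((u (maxn N n.+1)).1 - l)).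
  by rewrite (le_trans (ler_normB _ _))// lerD ?near' ?leq_maxr// hN// leq_maxl.
by rewrite opprB [RHS]addrC addrA subrK.
Qed.

(** Gliding hump: from arbitrarily far partial sums of norm larger than 1 over
    blocks F, the permutation that enumerates, block after block, first F and
    then the rest of the interval, makes the series diverge. *)
Lemma rearrangements_bound_subsums (y : nat -> V) (v : V) :
  (forall pi, bijective pi -> seq_lim (fun m => \sum_(0 <= k < m) y (pi k)) v) ->
  exists B : nat, forall (P : pred nat) m, `|\sum_(0 <= k < m | P k) y k| <= B%:R.
Proof.
move=> hy; apply: contrapT => no.
(* A bound for the first p terms reduces an unbounded subsum to its part
   beyond p. *)
have hump p : exists q (P : pred nat), (p < q)%N /\ ~ `|\sum_(p <= k < q | P k) y k| <= 1.
  have [B hB] := hA (\sum_(0 <= k < p) `|y k|).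
  apply: contrapT => h; apply: no; exists B.+1 => P m.
  have initial j : (j <= p)%N -> `|\sum_(0 <= k < j | P k) y k| <= B%:R.
    move=> jp; rewrite (le_trans _ hB)// ger0_norm ?sumr_ge0//.
    rewrite (le_trans (ler_norm_sum _ _ _))// [leRHS](big_cat_nat (n := j))//=.
    rewrite ler_wpDr ?sumr_ge0// big_mkcond ler_sum// => k _.
    by case: ifP.
  have [mp|pm] := leqP m p.
    by rewrite (le_trans (initial _ mp))// ler_nat.
  rewrite (big_cat_nat (n := p))//=; last exact: ltnW.
  rewrite -natr1 (le_trans (ler_normD _ _))// lerD ?initial//.
  by apply: contrapT => h'; apply: h; exists m, P.
have /choice[f hf] : forall p, exists qF : nat * seq nat,
    [/\ (p < qF.1)%N, exists P, qF.2 = [seq k <- index_iota p qF.1 | P k] &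
        ~ `|\sum_(k <- qF.2) y k| <= 1].
  move=> p; have [q [P [pq hP]]] := hump p.
  exists (q, [seq k <- index_iota p q | P k]); split=> //=; first by exists P.
  by rewrite big_filter.
pose p := fix p j := if j is i.+1 then (f (p i)).1 else 0%N.
pose F j := (f (p j)).2.
pose G j := [seq k <- index_iota (p j) (p j.+1) | k \notin F j].
(* L j enumerates the interval from 0 to p j, block after block. *)
pose L := fix L j := if j is i.+1 then L i ++ F i ++ G i else [::].
have pS j : (p j < p j.+1)%N by case: (hf (p j)).
have pm i j : (i <= j)%N -> (p i <= p j)%N.
  move=> /subnKC <-; elim: (j - i)%N => [|n IH]; first by rewrite addn0.
  by rewrite addnS (leq_trans IH)// ltnW.
have pj j : (j <= p j)%N by elim: j => // j IH; exact: leq_ltn_trans (pS j).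
have FG j : perm_eq (F j ++ G j) (index_iota (p j) (p j.+1)).
  have [_ [P FP] _] := hf (p j).
  rewrite /G {1}/F FP perm_sym -(perm_filterC P) perm_cat2l.
  rewrite (_ : [seq k <- _ | k \notin _] = [seq k <- index_iota (p j) (p j.+1) | predC P k]) //.
  apply: eq_in_filter => k kp; rewrite /F FP mem_filter [X in _ && X]kp andbT.
  by [].
have Liota j : perm_eq (L j) (iota 0 (p j)).
  elim: j => [|j IH] //=.
  have -> : iota 0 (f (p j)).1 = iota 0 (p j) ++ index_iota (p j) (p j.+1).
    rewrite /index_iota -[X in _ ++ iota X _]add0n -iotaD subnKC//.
    exact: ltnW.
  by apply: perm_cat IH _; exact: FG.
have sL j : size (L j) = p j by rewrite (perm_size (Liota j)) size_iota.
have Lpre i j : (i <= j)%N -> exists s, L j = L i ++ s.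
  move=> /subnKC <-; elim: (j - i)%N => [|n [s IH]].
    by exists [::]; rewrite addn0 cats0.
  by exists (s ++ F (i + n)%N ++ G (i + n)%N); rewrite addnS /= IH -!catA.
pose pi k := nth 0%N (L k.+1) k.
have piL j k : (k < p j)%N -> pi k = nth 0%N (L j) k.
  move=> kj; rewrite /pi; have [jk|kj'] := leqP j k.+1.
    by have [s ->] := Lpre _ _ jk; rewrite nth_cat sL kj.
  by have [s ->] := Lpre _ _ (ltnW kj'); rewrite nth_cat sL (pj k.+1).
have big j i : (i <= p j)%N -> \sum_(0 <= k < i) y (pi k) = \sum_(k <- take i (L j)) y k.
  move=> ij; rewrite [RHS](big_nth 0%N) size_takel ?sL//.
  apply: eq_big_nat => k /= ki; rewrite nth_take//.
  by rewrite (piL j)// (leq_trans ki).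
have bpi : bijective pi.
  have ipi : injective pi.
    move=> i j; pose n := (maxn i j).+1.
    have ni : (i < p n)%N by rewrite (leq_trans _ (pj n))// ltnS leq_maxl.
    have nj : (j < p n)%N by rewrite (leq_trans _ (pj n))// ltnS leq_maxr.
    rewrite (piL n)// (piL n)// => /eqP; rewrite nth_uniq ?sL//; first by move/eqP.
    by rewrite (perm_uniq (Liota n)) iota_uniq.
  have spi k : exists i, pi i = k.
    have kL : k \in L k.+1 by rewrite (perm_mem (Liota _)) mem_iota add0n (pj k.+1).
    exists (index k (L k.+1)); rewrite (piL k.+1) ?nth_index//.
    by rewrite -sL index_mem.
  have /choice[g gK] := spi.
  by exists g => // k; apply: ipi; rewrite gK.
have [N hN] := hy _ bpi _ (divr_gt0 ltr01 (ltr0n K 2)).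
have [_ _] := hf (p N); apply; rewrite -/(F N).
have sF : (size (F N) <= p N.+1 - p N)%N.
  by have := perm_size (FG N); rewrite size_cat size_iota => <-; exact: leq_addr.
have pF : (p N + size (F N) <= p N.+1)%N by rewrite -leq_subRL// ltnW.
have := hN _ (leq_trans (pj N) (leq_addr (size (F N)) _)); have := hN _ (pj N).
rewrite (big N.+1 (p N)); last exact: ltnW.
rewrite (big N.+1 _ pF) /=.
rewrite -{1}(sL N) take_size_cat// -(sL N) catA take_size_cat ?size_cat// big_cat /=.
set a := \sum_(k <- L N) _; set b := \sum_(k <- F N) _ => h1 h2.
have -> : b = (a + b - v) - (a - v).
  by rewrite opprB addrA subrK [a + b]addrC addrK.
by rewrite [leRHS]splitr (le_trans (ler_normB _ _))// lerD.
Qed.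

Lemma supported_max l : supported `I_(\max_(p <- l) p.2).+1 (l : seq (K * nat)).
Proof.
apply/allP => p pl; apply/asboolP.
by rewrite /= ltnS (@leq_bigmax_seq _ l xpredT (fun q : K * nat => q.2)).
Qed.

(** Collecting equal indices turns a linear combination given by a list into a
    partial sum of a series. *)
Lemma lc_coefficients (J : set nat) (x : nat -> V) (Q : pred nat) m l :
  supported J l -> supported `I_m l ->
  \sum_(0 <= k < m | (k \in J) && Q k) (\sum_(p <- l | p.2 == k) p.1) *: x k
  = lc x [seq p <- l | Q p.2].
Proof.
move=> Jl lm; rewrite (lc_sum_singles _ (supported_filter Q lm)).
rewrite big_mkord big_mkcond; apply: eq_bigr => k _.
rewrite lc_single big_filter_cond.
have [Qk|nQ] := boolP (Q k); last first.
  rewrite andbF big1 ?scale0r// => p /andP[+ /eqP pk].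
  by rewrite pk (negbTE nQ).
rewrite andbT.
have -> : \sum_(p <- l | Q p.2 && (p.2 == k :> nat)) p.1
        = \sum_(p <- l | p.2 == k) p.1.
  apply: eq_bigl => p; case: eqP => [->|_]; last by rewrite andbF.
  by rewrite Qk.
case: ifP => // /negP Jk; rewrite big1_seq ?scale0r// => p /andP[/eqP pk pl].
by case: Jk; rewrite -pk inE; exact/asboolP/(allP Jl).
Qed.

Section Basis.
Variables (E : set V) (N : option nat) (x : nat -> V).
Hypotheses (sE : is_subspace E) (cE : seq_closed E).
Hypothesis ubx : unconditional_basis E N x.
Let J := index_set N.

Let psum (P : pred nat) (a : nat -> K) m : V :=
  \sum_(0 <= k < m | (k \in J) && P k) a k *: x k.

Let controlled (b : K) (v : V) (a : nat -> K) : Prop :=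
  expansion N x a v /\ forall P m, `|psum P a m| <= b.

Let Ex k : J k -> E (x k).
Proof. by case: ubx => -[h _] _; exact: h. Qed.

Let psum_lin P (c : K) a b m :
  psum P (fun k => c * a k + b k) m = c *: psum P a m + psum P b m.
Proof.
rewrite /psum scaler_sumr -big_split; apply: eq_bigr => k _ /=.
by rewrite scalerDl scalerA.
Qed.

Let psumT a : (fun m => \sum_(0 <= k < m | k \in index_set N) a k *: x k) = psum xpredT a.
Proof. by apply/funext => m; apply: eq_bigl => k; rewrite andbT. Qed.

Let expansion_lin (c : K) a b u v : expansion N x a u -> expansion N x b v ->
  expansion N x (fun k => c * a k + b k) (c *: u + v).
Proof.
rewrite /expansion !psumT => au bv.
rewrite (_ : psum _ _ = (fun m => c *: psum xpredT a m + psum xpredT b m)).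
  by apply: cvgD => //; apply: cvgZr.
by apply/funext => m; exact: psum_lin.
Qed.

Let expansion0 : expansion N x (fun=> 0) 0.
Proof.
apply/cvg_seq_lim => e e0; exists 0%N => n _.
by rewrite big1 ?subrr ?normr0 ?ltW// => k _; rewrite scale0r.
Qed.

Lemma basis_neq0 k : J k -> x k != 0.
Proof.
move=> Jk; apply/eqP => xk0; have [[_ /(_ 0 (proj1 sE))[a [_ ua]]] _] := ubx.
have /ua/(_ k Jk) : expansion N x (fun i => (i == k)%:R) 0.
  apply/cvg_seq_lim => e e0; exists 0%N => n _.
  rewrite big1 ?subrr ?normr0 ?ltW// => i _.
  by case: eqP => [->|_]; rewrite ?xk0 ?scaler0 ?scale0r.
have := ua _ expansion0 k Jk => <-; rewrite eqxx => /eqP.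
by rewrite oner_eq0.
Qed.

Lemma basis_cspan : cspan J x = E.
Proof.
apply/seteqP; split; first exact: cspan_min.
move=> v Ev e e0; have [[_ /(_ v Ev)[a [/cvg_seq_lim/(_ e e0)[m hm] _]]] _] := ubx.
exists [seq (a k, k) | k <- index_iota 0 m & k \in J].
  rewrite /supported all_map; apply/allP => k; rewrite mem_filter => /andP[+ _].
  by move=> Jk; apply/asboolP => /=; move: Jk; rewrite inE.
have := hm _ (leqnn m); rewrite distrC; congr (`|_ - _| <= _).
by rewrite /lc big_map big_filter.
Qed.

Let expansion_controlled v : E v -> exists B : nat, exists a, controlled B%:R v a.
Proof.
move=> Ev; have [[_ /(_ v Ev)[a [va _]]] perm] := ubx.
suff [B hB] : exists B : nat, forall P m, `|psum P a m| <= B%:R by exists B, a.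
case E1 : N va perm => [n|] va perm.
  have [B hB] := hA (\sum_(0 <= k < n) `|a k *: x k|).
  exists B => P m; rewrite (le_trans _ hB)// ger0_norm ?sumr_ge0//.
  rewrite (le_trans (ler_norm_sum _ _ _))//.
  have le1 j : \sum_(0 <= k < j | (k \in J) && P k) `|a k *: x k|
       <= \sum_(0 <= k < j | (k < n)%N) `|a k *: x k|.
    rewrite big_mkcond [leRHS]big_mkcond ler_sum// => k _.
    case: ifP => [/andP[+ _]|_]; last by case: ifP.
    by rewrite /J E1 inE /= => ->.
  rewrite (le_trans (le1 _))//.
  have [mn|nm] := leqP m n.
    rewrite [leRHS](big_cat_nat (n := m))//= ler_wpDr ?sumr_ge0//.
    by rewrite big_mkcond ler_sum// => k _; case: ifP.
  rewrite (big_cat_nat (n := n)) ?(ltnW nm)//= [X in _ + X]big1_seq ?addr0; last first.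
    by move=> k; rewrite mem_index_iota => /andP[+ /andP[+ _]]; rewrite ltnNge => /negP.
  by rewrite big_mkcond ler_sum// => k _; case: ifP.
have [|B hB] := @rearrangements_bound_subsums (fun k => a k *: x k) v.
  move=> pi bpi; have := perm v a Ev va pi.
  rewrite /expansion /=.
  have -> : (fun m => \sum_(0 <= k < m | k \in [set: nat]) (a \o pi) k *: (x \o pi) k)
      = (fun m => \sum_(0 <= k < m) a (pi k) *: x (pi k)).
    by apply/funext => m; apply: eq_bigl => k; rewrite in_setT.
  move=> h; apply/cvg_seq_lim; apply: h.
  have [g gK Kg] := bpi; split=> //.
    by move=> i j _ _; exact: can_inj gK _ _.
  by move=> k _; exists (g k).
exists B => P m; have := hB P m; congr (`|_| <= _).
by apply: eq_bigl => k; rewrite /J E1 /= in_setT.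
Qed.

(** By the category theorem some ball lies in the closure of the vectors whose
    expansion is controlled by a fixed constant. *)
Let approximate_control : exists B : nat, forall w, E w -> `|w| <= 1 ->
  forall e, 0 < e -> exists u a, [/\ E u, controlled B%:R u a & `|w - u| <= e].
Proof.
pose A n := [set v | E v /\ exists a, controlled n%:R v a].
have [|n [v [r [Ev r0 hr]]]] := @baire_cover E A sE cE.
  by move=> v Ev; have [B [a ha]] := expansion_controlled Ev; exists B; split=> //; exists a.
have [D hD] := hA r^-1; exists (D * (n + n))%N => w Ew w1 e e0.
have e1 : 0 < e * r / 2 by rewrite divr_gt0// mulr_gt0.
have [||u1 [Eu1 [a1 [x1 c1]]] h1] := hr (r *: w + v) _ _ _ e1.
- exact: (proj2 sE).
- by rewrite addrK normrZ gtr0_norm// -[leRHS]mulr1 ler_wpM2l// ltW.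
have [|u2 [Eu2 [a2 [x2 c2]]] h2] := hr v Ev _ _ e1.
- by rewrite subrr normr0 ltW.
exists (r^-1 *: (u1 - u2)), (fun k => r^-1 * (-1 * a2 k + a1 k) + 0); split.
- by apply: subspaceZ => //; exact: (subspaceB sE).
- split.
    rewrite -[X in expansion _ _ _ X]addr0; apply: expansion_lin => //.
    rewrite (_ : u1 - u2 = -1 *: u2 + u1); first exact: expansion_lin.
    by rewrite scaleN1r addrC.
  move=> P m; rewrite !psum_lin [psum _ (fun=> 0) _]big1 ?addr0; last first.
    by move=> k _; rewrite scale0r.
  rewrite normrZ gtr0_norm ?invr_gt0// natrM ler_pM ?invr_ge0 ?(ltW r0)//.
    by apply: le_trans hD; rewrite ger0_norm// invr_ge0 ltW.
  by rewrite natrD (le_trans (ler_normD _ _))// normrZ normrN1 mul1r lerD.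
- rewrite (_ : w - _ = r^-1 *: ((r *: w + v - u1) - (v - u2))); last first.
    have -> : r *: w + v - u1 - (v - u2) = r *: w - (u1 - u2).
      move: (r *: w) => z.
      by rewrite !opprB [z + v - u1]addrAC [u2 - v]addrC addrA addrK -addrA [- u1 + _]addrC.
    by rewrite [RHS]scalerBr scalerA mulVf ?scale1r// gt_eqF.
  rewrite normrZ gtr0_norm ?invr_gt0// mulrC ler_pdivrMr//.
  by rewrite [leRHS]splitr (le_trans (ler_normB _ _))// lerD.
Qed.

Let controlled_scale b c v a : 0 <= c -> controlled b v a ->
  controlled (c * b) (c *: v) (fun k => c * a k + 0).
Proof.
move=> c0 [xv cv]; split.
  by rewrite -[X in expansion _ _ _ X]addr0; exact: expansion_lin.
move=> P m; rewrite psum_lin [psum _ (fun=> 0) _]big1 ?addr0; last first.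
  by move=> k _; rewrite scale0r.
by rewrite normrZ ger0_norm// ler_wpM2l.
Qed.

(** Successive approximation, as in the open mapping theorem: a vector w is
    the sum of a series of vectors u j whose expansions are controlled by
    geometrically decreasing constants, and the expansions may be added. *)
Let control : exists B : nat, forall w, E w -> `|w| <= 1 ->
  exists a, controlled B%:R w a.
Proof.
have [B hB] := approximate_control; exists (B + B)%N => w Ew w1.
have /choice[f hf] : forall p : nat * V, exists q : V * (nat -> K),
    E p.2 -> `|p.2| <= (2 ^+ p.1)^-1 -> [/\ E q.1,
      controlled (B%:R / 2 ^+ p.1) q.1 q.2 & `|p.2 - q.1| <= (2 ^+ p.1.+1)^-1].
  move=> [j r] /=; have [[Er rj]|nr] := pselect (E r /\ `|r| <= (2 ^+ j)^-1); last first.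
    by exists (0, fun=> 0) => Er rj; case: nr.
  have [|||u [a [Eu ca ru]]] := hB (2 ^+ j *: r) _ _ (2^-1).
  - exact: subspaceZ.
  - rewrite normrZ ger0_norm ?exprn_ge0// mulrC -ler_pdivlMr ?exprn_gt0//.
    by rewrite mul1r.
  - by rewrite invr_gt0.
  exists ((2 ^+ j)^-1 *: u, fun k => (2 ^+ j)^-1 * a k + 0) => _ _; split=> /=.
  - exact: subspaceZ.
  - by rewrite mulrC; apply: controlled_scale => //; exact/ltW/pow2V_gt0.
  - rewrite (_ : r - _ = (2 ^+ j)^-1 *: (2 ^+ j *: r - u)); last first.
      by rewrite scalerBr scalerA mulVf ?scale1r// expf_neq0// pnatr_eq0.
    rewrite normrZ gtr0_norm ?pow2V_gt0// exprS invfM mulrC ler_wpM2r//.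
pose r := fix r j := if j is i.+1 then r i - (f (i, r i)).1 else w.
pose u j := (f (j, r j)).1; pose a j := (f (j, r j)).2.
have hr j : E (r j) /\ `|r j| <= (2 ^+ j)^-1.
  elim: j => [|j [IH1 IH2]]; first by rewrite expr0 invr1.
  by have [Eu _ h] := hf (j, r j) IH1 IH2; split=> //=; exact: (subspaceB sE).
have hu j : controlled (B%:R / 2 ^+ j) (u j) (a j).
  by have [h1 h2] := hr j; case: (hf (j, r j) h1 h2).
pose s n k := \sum_(j < n) a j k.
have sS n : s n.+1 = (fun k => 1 * a n k + s n k).
  by apply/funext => k; rewrite /s big_ord_recr mul1r addrC.
have xs n : expansion N x (s n) (w - r n).
  elim: n => [|n IH].
    rewrite subrr (_ : s 0%N = (fun=> 0)); first exact: expansion0.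
    by apply/funext => k; rewrite /s big_ord0.
  rewrite sS /= opprB addrA [w + _]addrC -addrA -[(f _).1]scale1r.
  by apply: expansion_lin => //; case: (hu n).
have cS n : (B + B)%:R / 2 ^+ n.+1 = B%:R / 2 ^+ n :> K.
  by rewrite natrD mulrDl -mulrDr -pow2V_half.
have sB P m n i : `|psum P (s (n + i)%N) m - psum P (s n) m|
    <= (B + B)%:R / 2 ^+ n - (B + B)%:R / 2 ^+ (n + i).
  elim: i => [|i IH]; first by rewrite addn0 !subrr normr0.
  rewrite addnS sS psum_lin scale1r -addrA (le_trans (ler_normD _ _))//.
  have [_ /(_ P m) h] := hu (n + i)%N; rewrite (le_trans (lerD h IH))//.
  by rewrite addrCA lerD2l cS natrD mulrDl opprD addrA subrr add0r.
have psumB P m i (b : nat -> K) :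
    (forall k, J k -> `|b k - s i k| * `|x k| <= (B + B)%:R / 2 ^+ i) ->
    `|psum P b m - psum P (s i) m| <= (m * (B + B))%:R / 2 ^+ i.
  move=> hb; rewrite /psum -sumrB (le_trans (ler_norm_sum _ _ _))//.
  rewrite natrM -mulrA mulr_natl -[m in leRHS]subn0 -sumr_const_nat.
  rewrite big_mkcond ler_sum// => k _; case: ifP => [/andP[Jk _]|_].
    by rewrite -scalerBl normrZ hb//; move: Jk; rewrite inE.
  by rewrite divr_ge0// exprn_ge0.
have /choice[b hb] : forall k, exists b : K, J k -> forall i,
    `|b - s i k| * `|x k| <= (B + B)%:R / 2 ^+ i.
  move=> k; have [Jk|nJ] := pselect (J k); last by exists 0.
  have nx : 0 < `|x k| by rewrite normr_gt0 basis_neq0.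
  have step n : `|s n.+1 k - s n k| <= ((B + B)%:R / `|x k|) / 2 ^+ n.+1.
    rewrite sS mul1r addrK mulrAC cS ler_pdivlMr// -normrZ.
    have [_ /(_ (pred1 k) k.+1)] := hu n; congr (`|_| <= _).
    rewrite /psum big_mkcond (bigD1_seq k) ?iota_uniq ?mem_index_iota//=.
    rewrite mem_set// eqxx /= big1 ?addr0// => i /negbTE ->.
    by rewrite andbF.
  have c0 : 0 <= (B + B)%:R / `|x k| by rewrite divr_ge0.
  have [l [_ hl]] := geometric_limit (u := fun n => s n k) hA hK c0 step.
  exists l => _ i; rewrite -ler_pdivlMr// (le_trans (hl i))//.
  by rewrite mulrAC.
have lim P m n : `|psum P b m - psum P (s n) m| <= (B + B)%:R / 2 ^+ n.
  apply: norm_le_eps => e e0.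
  have [i hi] := archimedean_pow2 hA (divn_gt0_eps (m * (B + B)) e0).
  rewrite (_ : _ - _ = (psum P (s (n + i)%N) m - psum P (s n) m)
     + (psum P b m - psum P (s (n + i)%N) m)); last first.
    by rewrite [RHS]addrC addrA subrK.
  rewrite (le_trans (ler_normD _ _))// lerD//.
    rewrite (le_trans (sB _ _ _ _))// gerBl divr_ge0// exprn_ge0//.
  rewrite (le_trans (psumB _ _ _ _ _))//; first by move=> k Jk; exact: hb.
  rewrite (le_trans _ (mul_eps (m * (B + B)) e0))// ler_wpM2l//.
  by rewrite (le_trans _ hi)// pow2V_le// leq_addl.
exists b; split; last first.
  move=> P m; have := lim P m 0%N; rewrite expr0 divr1.
  rewrite [psum P (s 0%N) m]big1 ?subr0// => k _.
  by rewrite /s big_ord0 scale0r.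
rewrite /expansion psumT; apply/cvg_seq_lim => e e0.
have e2 : 0 < e / 2 by rewrite divr_gt0.
have [n hn] := archimedean_pow2 hA (divn_gt0_eps (B + B + 1) e2).
have := xs n; rewrite /expansion psumT => /cvg_seq_lim/(_ _ e2)[m0 hm].
exists m0 => m /hm h.
rewrite (_ : _ - w = (psum xpredT (s n) m - (w - r n))
   + (psum xpredT b m - psum xpredT (s n) m - r n)); last first.
  move: (psum _ _ _) (psum _ _ _) (r n) => p q z.
  by rewrite opprB [p + (z - w)]addrA -[q - p - z]addrA -opprD [RHS]addrC addrA subrK.
rewrite [leRHS]splitr (le_trans (ler_normD _ _))// lerD//.
rewrite (le_trans (ler_normB _ _))//.
rewrite (le_trans _ (mul_eps (B + B + 1) e2))//.
rewrite [(B + B + 1)%:R]natrD mulrDl mul1r lerD//.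
  by rewrite (le_trans (lim _ _ _))// ler_wpM2l.
by rewrite (le_trans (proj2 (hr n))).
Qed.

Let expansion_unique v a b k : E v -> expansion N x a v -> expansion N x b v ->
  J k -> a k = b k.
Proof.
move=> Ev va vb Jk; have [[_ /(_ v Ev)[c [_ uc]]] _] := ubx.
by rewrite (uc a)// (uc b).
Qed.

(** The expansion of a finite combination is the combination itself, so the
    control of expansions on the unit ball is the unconditional inequality; a
    vector is brought to the unit ball by a scalar slightly larger than its
    norm, which also covers the vector 0. *)
Lemma basis_unconditional : exists M, unconditional M J x.
Proof.
have [B hB] := control; exists B => P l Jl.
have El : E (lc x l) by rewrite -basis_cspan; exact: cspan_lc.
pose b k := \sum_(p <- l | p.2 == k) p.1.
pose m0 := (\max_(p <- l) p.2).+1.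
have psumE Q m : (m0 <= m)%N -> psum Q b m = lc x [seq p <- l | Q p.2].
  move=> mm; apply: lc_coefficients => //.
  apply: supported_sub (supported_max l) => k /= km; exact: leq_trans mm.
have xb : expansion N x b (lc x l).
  rewrite /expansion psumT; apply/cvg_seq_lim => e e0; exists m0 => m mm.
  by rewrite psumE// filter_predT subrr normr0 ltW.
rewrite -(psumE P m0)//; apply: norm_le_eps => e e0.
pose c := `|lc x l| + e / B.+1%:R.
have c0 : 0 < c by rewrite ltr_wpDl// divn_gt0_eps.
have [||a [xa ca]] := hB (c^-1 *: lc x l); first exact: subspaceZ.
  rewrite normrZ gtr0_norm ?invr_gt0// mulrC ler_pdivrMr// mul1r.
  by rewrite lerDl ltW// divn_gt0_eps.
have xb' : expansion N x (fun k => c * a k + 0) (lc x l).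
  have := @expansion_lin c _ _ _ _ xa expansion0.
  by rewrite addr0 scalerA mulfV ?scale1r// gt_eqF.
have -> : psum P b m0 = c *: psum P a m0.
  rewrite -[RHS]addr0 -[X in _ + X](_ : psum P (fun=> 0) m0 = 0); last first.
    by rewrite /psum big1// => k _; rewrite scale0r.
  rewrite -psum_lin; apply: eq_bigr => k /andP[+ _]; rewrite inE => Jk.
  by rewrite (expansion_unique El xb xb' Jk).
rewrite normrZ gtr0_norm// (le_trans (ler_wpM2l (ltW c0) (ca P m0)))//.
by rewrite mulrC mulrDr lerD// mul_eps.
Qed.

End Basis.
End BasesAreUnconditionalFamilies.

(** * Closed subspaces as Banach spaces *)

(** The closure properties are bundled with the set, because the instances of
    algebraic structures on the type of its elements depend on them. *)
Record closed_subspace (K : numFieldType) (V : normedModType K) := ClosedSubspace {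
  carrier :> set V;
  carrier_subspace : is_subspace carrier;
  carrier_closed : seq_closed carrier }.

Record subspace_type (K : numFieldType) (V : normedModType K)
    (E : closed_subspace V) := SubspaceElement {
  subspace_val : V;
  subspace_valP : `[< (E : set V) subspace_val >] }.

Section SubspaceType.
Variables (K : numFieldType) (V : completeNormedModType K) (E : closed_subspace V).
Local Notation Z := (subspace_type E).

HB.instance Definition _ := [isSub for @subspace_val K V E].
HB.instance Definition _ := [Choice of Z by <:].

Let sE := carrier_subspace E.

Let mk (v : V) (h : (E : set V) v) : Z := SubspaceElement (asboolT h).

Let val_mem (z : Z) : (E : set V) (val z).
Proof. exact/asboolP/subspace_valP. Qed.

Let zero : Z := mk (proj1 sE).
Let add (u v : Z) : Z := mk (subspaceD sE (val_mem u) (val_mem v)).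
Let scale (c : K) (u : Z) : Z := mk (subspaceZ c sE (val_mem u)).
Let val_oppmem (u : Z) : (E : set V) (- val u).
Proof. by rewrite -scaleN1r; exact: subspaceZ (val_mem u). Qed.

Let opp (u : Z) : Z := mk (val_oppmem u).

Let addA : associative add.
Proof. by move=> u v w; apply: val_inj; rewrite /= addrA. Qed.
Let addC : commutative add.
Proof. by move=> u v; apply: val_inj; rewrite /= addrC. Qed.
Let add0 : left_id zero add.
Proof. by move=> u; apply: val_inj; rewrite /= add0r. Qed.
Let addN : left_inverse zero opp add.
Proof. by move=> u; apply: val_inj; rewrite /= addNr. Qed.

HB.instance Definition _ := GRing.isZmodule.Build Z addA addC add0 addN.

Let scaleA a b v : scale a (scale b v) = scale (a * b) v.
Proof. by apply: val_inj; rewrite /= scalerA. Qed.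
Let scale1 : left_id 1 scale.
Proof. by move=> u; apply: val_inj; rewrite /= scale1r. Qed.
Let scaleDr : right_distributive scale +%R.
Proof. by move=> a u v; apply: val_inj; rewrite /= scalerDr. Qed.
Let scaleDl v : {morph scale^~ v : a b / a + b}.
Proof. by move=> a b; apply: val_inj; rewrite /= scalerDl. Qed.

HB.instance Definition _ := GRing.Zmodule_isLmodule.Build K Z scaleA scale1 scaleDr scaleDl.

Let norm (z : Z) : K := `|val z|.
Let normD u v : norm (u + v) <= norm u + norm v.
Proof. exact: ler_normD. Qed.
Let normZ c u : norm (c *: u) = `|c| * norm u.
Proof. exact: normrZ. Qed.
Let norm_eq0 u : norm u = 0 -> u = 0.
Proof. by move=> /normr0_eq0 u0; apply: val_inj. Qed.

HB.instance Definition _ := Lmodule_isNormed.Build K Z normD normZ norm_eq0.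

Let complete (F : set_system Z) : ProperFilter F -> cauchy F -> cvg F.
Proof.
move=> PF cF.
have cvalF : cauchy ((val : Z -> V) @ F).
  apply/cauchy_ballP => e e0; move: cF => /cauchy_ballP/(_ e e0).
  move=> [[A B] /= [FA FB] AB].
  exists (val @` A, val @` B); first by split; rewrite /= /nbhs/=;
    [apply: filterS FA|apply: filterS FB] => z ?; exists z.
  move=> [_ _] [/= [u Au <-] [w Bw <-]]; have := AB (u, w) (conj Au Bw).
  by rewrite /= -ball_normE => h; rewrite -ball_normE.
have /cauchy_cvg/cvg_ex[v vF] := cvalF.
have Ev : (E : set V) v.
  apply: (carrier_closed (c := E)) => e e0.
  move/cvgrPdist_le: vF => /(_ e e0) /filter_ex[z hz].
  by exists (val z).
apply/cvg_ex; exists (mk Ev); apply/cvgrPdist_le => e e0.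
by move/cvgrPdist_le: vF => /(_ e e0); apply: filterS.
Qed.

HB.instance Definition _ := Uniform_isComplete.Build Z complete.

(** Summands are found as subspaces of X, whereas unconditional primariness
    speaks of Banach spaces. *)
Lemma subspace_type_iso : exists Z : completeNormedModType K, iso E [set: Z].
Proof.
exists Z; pose T (v : V) : Z := if pselect ((E : set V) v) is left h then mk h else 0.
have Tv v : (E : set V) v -> val (T v) = v by move=> h; rewrite /T; case: pselect.
exists T, val; split.
- split=> //.
    move=> a u v Eu Ev; apply: val_inj; rewrite /= Tv ?Tv//.
    exact: (proj2 sE).
  by exists 1%N => u Eu; rewrite mul1r -{2}(Tv u).
- split=> //; last by exists 1%N => u _; rewrite mul1r.
- by [].
- by move=> w _; apply: val_inj; rewrite Tv.
Qed.

End SubspaceType.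

(** * Bases of subspaces, subfamilies and products *)

Section BasesAndSubspaces.
Variable K : numFieldType.
Hypotheses (hA : archimedean_norm K) (hK : seq_complete K).
Implicit Types V W : normedModType K.

Lemma expansion_map V W (E : set V) (F : set W) T N (x : nat -> V) a v :
  is_subspace E -> bounded_map E F T -> (forall k, index_set N k -> E (x k)) ->
  E v -> expansion N x a v -> expansion N (T \o x) a (T v).
Proof.
move=> sE [lT _ [C hC]] Ex Ev /cvg_seq_lim xv; apply/cvg_seq_lim => e e0.
have [m hm] := xv _ (divn_gt0_eps C e0); exists m => n /hm h.
set s := (\sum_(0 <= k < n | _) _ *: x k) in h.
have Es : E s.
  apply: subspace_sum => // k; rewrite inE => Jk.
  exact: (subspaceZ _ sE (Ex _ Jk)).
rewrite -(linear_on_sum sE lT); last by move=> k; rewrite inE; exact: Ex.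
rewrite -/s -(linear_onB lT)// (le_trans (hC _ (subspaceB sE Es Ev)))//.
by rewrite (le_trans _ (mul_eps C e0))// ler_wpM2l.
Qed.

Lemma eq_expansion V N (x y : nat -> V) a v :
  (forall k, index_set N k -> x k = y k) -> expansion N x a v -> expansion N y a v.
Proof.
move=> xy; rewrite /expansion.
rewrite (_ : (fun m => _) = (fun m => \sum_(0 <= k < m | k \in index_set N) a k *: y k))//.
by apply/funext => m; apply: eq_bigr => k; rewrite inE => /xy ->.
Qed.

Lemma unconditional_basis_iso V W (E : set V) (F : set W) T S N (x : nat -> V) :
  is_subspace E -> bounded_map E F T -> bounded_map F E S ->
  (forall u, E u -> S (T u) = u) -> (forall w, F w -> T (S w) = w) ->
  unconditional_basis E N x -> unconditional_basis F N (T \o x).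
Proof.
move=> sE bT bS TS ST [[Ex basx] permx].
have sF : is_subspace F by apply: (iso_subspace sE); exists T, S.
have [_ ET _] := bT; have [_ FS _] := bS.
have back a w : F w -> expansion N (T \o x) a w -> expansion N x a (S w).
  move=> Fw /(expansion_map sF bS) h; apply: (eq_expansion (x := S \o (T \o x))).
    by move=> k /Ex /TS.
  by apply: h => // k /Ex/ET.
split; first split.
- by move=> k /Ex/ET.
- move=> w Fw; have [a [xa ua]] := basx _ (FS _ Fw); exists a; split.
    by rewrite -(ST w Fw); exact: (expansion_map sE bT Ex (FS _ Fw) xa).
  by move=> b /(back _ _ Fw)/ua.
- move=> w a Fw /(back _ _ Fw) xa pi bpi; rewrite -(ST w Fw).
  have := permx _ _ (FS _ Fw) xa pi bpi.
  move=> /(expansion_map sE bT); apply; last exact: FS.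
  by move=> k Jk /=; apply: Ex; have [fpi _ _] := bpi; exact: fpi.
Qed.

Lemma has_unconditional_basis_iso V W (E : set V) (F : set W) :
  is_subspace E -> iso E F -> has_unconditional_basis E -> has_unconditional_basis F.
Proof.
move=> sE [T [S [bT bS TS ST]]] [N [x ux]]; exists N, (T \o x).
exact: (unconditional_basis_iso sE bT bS TS ST ux).
Qed.

Lemma finite_dimensional_image V W (E : set V) T :
  is_subspace E -> linear_on E T -> finite_dimensional E ->
  finite_dimensional (T @` E : set W).
Proof.
move=> sE lT [m [e Ee]].
have Emem i : E (e i).
  rewrite Ee; exists (fun j => (j == i)%:R) => //.
  rewrite (bigD1 i)//= eqxx scale1r big1 ?addr0// => j /negbTE ->.
  by rewrite scale0r.
exists m, (T \o e); apply/seteqP; split.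
  move=> _ [v + <-]; rewrite {1}Ee => -[a _ <-]; exists a => //.
  by rewrite (linear_on_sum sE lT).
move=> _ [a _ <-]; exists (\sum_(i < m) a i *: e i).
  by apply: subspace_sum => // i _; exact: subspaceZ.
by rewrite (linear_on_sum sE lT).
Qed.

Lemma retract_finite_dimensional V W (E : set V) (F : set W) :
  is_subspace F -> retract E F -> finite_dimensional F -> finite_dimensional E.
Proof.
move=> sF [T [S [[_ ET _] [lS FS _] TS]]] fF.
have -> : E = S @` F.
  apply/seteqP; split=> [u Eu|_ [w Fw <-]]; last exact: FS.
  by exists (T u); [exact: ET|exact: TS].
exact: finite_dimensional_image lS fF.
Qed.

Lemma finite_dimensional_prod V W (E : set V) (F : set W) :
  finite_dimensional E -> finite_dimensional F -> finite_dimensional (E `*` F).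
Proof.
move=> [m [e ->]] [m' [f ->]].
pose g (i : 'I_(m + m')) : V * W :=
  match fintype.split i with inl j => (e j, 0) | inr j => (0, f j) end.
have sumg (a : 'I_(m + m') -> K) : \sum_i a i *: g i
    = (\sum_i a (lshift m' i) *: e i, \sum_i a (rshift m i) *: f i).
  rewrite big_split_ord /=.
  under eq_bigr do rewrite /g (unsplitK (inl _)).
  under [X in _ + X]eq_bigr do rewrite /g (unsplitK (inr _)).
  have pairE (w : V * W) : w = (w.1, w.2) by case: w.
  rewrite [LHS]pairE /=; congr pair.
    rewrite (big_morph fst (id1 := 0) (op1 := +%R))// [X in _ + X](big_morph fst (id1 := 0) (op1 := +%R))//=.
    by rewrite [X in _ + X]big1 ?addr0// => i _; rewrite scaler0.
  rewrite (big_morph snd (id1 := 0) (op1 := +%R))// [X in _ + X](big_morph snd (id1 := 0) (op1 := +%R))//=.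
  by rewrite big1 ?add0r// => i _; rewrite scaler0.
exists (m + m')%N, g; apply/seteqP; split.
  move=> [u w] [/= [a _ <-] [b _ <-]].
  exists (fun i => match fintype.split i with inl j => a j | inr j => b j end) => //.
  by rewrite sumg; congr pair; apply: eq_bigr => i _;
    rewrite ?(unsplitK (inl _)) ?(unsplitK (inr _)).
by move=> _ [a _ <-]; rewrite sumg; split; eexists.
Qed.

Lemma finite_basis_finite_dimensional V (E : set V) m (x : nat -> V) :
  is_subspace E -> unconditional_basis E (Some m) x -> finite_dimensional E.
Proof.
move=> sE [[Ex basx] _]; exists m, (fun i : 'I_m => x i).
apply/seteqP; split; last first.
  move=> _ [a _ <-]; apply: subspace_sum => // i _.
  by apply: subspaceZ => //; apply: Ex; exact: ltn_ord.
move=> v Ev; have [a [/cvg_seq_lim xa _]] := basx v Ev.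
exists (fun i : 'I_m => a i) => //.
apply: (seq_lim_unique (u := fun n =>
    \sum_(0 <= k < n | k \in index_set (Some m)) a k *: x k)) => // e e0.
exists m => n mn; rewrite (big_cat_nat (n := m))//=.
rewrite [X in _ + X - _]big1_seq ?addr0; last first.
  move=> k /andP[+]; rewrite inE /= mem_index_iota => km /andP[+ _].
  by rewrite leqNgt km.
rewrite big_mkcond (eq_big_nat _ _ (F2 := fun k => a k *: x k)); last first.
  by move=> k /= km; rewrite mem_set.
by rewrite big_mkord subrr normr0 ltW.
Qed.

(** If m vectors spanned, m + 1 terms of the family would be linearly dependent;
    unconditionality separates the terms of a vanishing combination. *)
Lemma infinite_family_not_finite_dimensional V M (S : set nat) (x : nat -> V) :
  unconditional M S x -> (forall k, S k -> x k != 0) -> infinite_set S ->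
  ~ finite_dimensional (cspan S x).
Proof.
move=> ux x0 iS [m [e Ee]].
have [f if_ fS] := infinite_enumeration iS.
have Sf j : S (f j) by rewrite -fS; exists j.
have /choice[A hA'] : forall j : 'I_m.+1, exists a : 'I_m -> K,
    x (f j) = \sum_i a i *: e i.
  by move=> j; have := cspan_mem x (Sf j); rewrite Ee => -[a _ <-]; exists a.
pose B := \matrix_(j < m.+1, i < m) A j i.
have kB : kermx B != 0.
  rewrite -mxrank_eq0 mxrank_ker subn_eq0 -ltnNge.
  by rewrite ltnS rank_leq_col.
pose u := nz_row (kermx B).
have u0 : u != 0 by rewrite nz_row_eq0.
have uB : u *m B = 0 by apply/sub_kermxP; exact: nz_row_sub.
pose l := [seq (u 0 j, f j) | j : 'I_m.+1].
have Sl : supported S l.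
  by rewrite /supported all_map; apply/allP => j _; apply/asboolP; exact: Sf.
have lcE : lc x l = 0.
  rewrite /lc big_map big_enum /=.
  transitivity (\sum_(j < m.+1) \sum_(i < m) (u 0 j * A j i) *: e i).
    by apply: eq_bigr => j _; rewrite hA' scaler_sumr; apply: eq_bigr => i _; rewrite scalerA.
  rewrite exchange_big big1// => i _; rewrite -scaler_suml.
  have := congr1 (fun M : 'rV_m => M 0 i) uB; rewrite !mxE => uBi.
  rewrite (_ : \sum_(j < m.+1) _ = 0) ?scale0r// -[RHS]uBi.
  by apply: eq_bigr => j _; rewrite mxE.
case/rV0Pn: u0 => j /negP; apply.
have := ux (pred1 (f j)) l Sl; rewrite lcE normr0 mulr0 normr_le0.
rewrite lc_single scaler_eq0 (negbTE (x0 _ (Sf j))) orbF.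
rewrite /l big_map big_enum_cond /= (bigD1 j)//= big1 ?addr0// => i /andP[/eqP/if_/val_inj ->].
by rewrite eqxx.
Qed.

Lemma complemented_subfamily V (I : Type) M (A B : set I) (x : I -> V) :
  seq_complete V -> unconditional M A x -> B `<=` A ->
  complemented (cspan A x) (cspan B x).
Proof.
move=> cV ux BA; pose P i := `[< B i >].
have [T [bT Tx _]] := extend_linear hA cV (unconditional_dominates P ux).
have sub : cspan B x `<=` cspan A x by exact: cspan_sub.
have bT' : bounded_map (cspan A x) (cspan B x) T.
  apply: bounded_map_sub bT => //; apply: cspan_min.
  - exact: cspan_subspace.
  - exact: cspan_closed.
  - move=> i Ai; case: ifP => [/asboolP Bi|_]; first exact: cspan_mem.
    by case: (cspan_subspace hA B x).
apply: (complementedP _ sub bT'); first exact: cspan_subspace.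
apply: (bounded_maps_eq hA (bounded_map_sub sub (@subset_refl _ _) bT')
         (bounded_map_id (@subset_refl _ _))) => i Bi.
by rewrite Tx; [rewrite /P asboolT|exact: BA].
Qed.

Lemma cspan_split V (I : Type) M (A : set I) (P : pred I) (x : I -> V) :
  seq_complete V -> unconditional M A x ->
  iso (cspan A x) (cspan (A `&` [set i | P i]) x `*` cspan (A `&` [set i | ~~ P i]) x).
Proof.
move=> cV ux.
have sA : is_subspace (cspan A x) by exact: cspan_subspace.
have proj (Q : pred I) : exists T, bounded_map (cspan A x) (cspan (A `&` [set i | Q i]) x) T /\
    forall i, A i -> T (x i) = if Q i then x i else 0.
  have [T [bT Tx _]] := extend_linear hA cV (unconditional_dominates Q ux).
  exists T; split=> //; apply: bounded_map_sub bT => //; apply: cspan_min.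
  - exact: cspan_subspace.
  - exact: cspan_closed.
  - move=> i Ai; case: ifP => [Qi|_]; first exact: (@cspan_mem _ _ _ (_ `&` _)).
    by case: (cspan_subspace hA (A `&` [set i | Q i]) x).
have [T [bT Tx]] := proj P; have [S [bS Sx]] := proj (fun i => ~~ P i).
have subI (Q : pred I) : cspan (A `&` [set i | Q i]) x `<=` cspan A x.
  by apply: cspan_sub => // i [].
have bU : bounded_map (cspan (A `&` [set i | P i]) x `*` cspan (A `&` [set i | ~~ P i]) x)
    (cspan A x) (fun p => p.1 + p.2).
  apply: bounded_map_add => //.
    exact: bounded_map_sub (@subset_refl _ _) (subI P) (@bounded_map_fst _ _ _ _ _).
  exact: bounded_map_sub (@subset_refl _ _) (subI (fun i => ~~ P i)) (@bounded_map_snd _ _ _ _ _).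
have kill (Q : pred I) U (B : set V) (G : V -> V) : bounded_map (cspan A x) B G ->
   (forall i, A i -> Q i -> G (x i) = U (x i)) ->
   bounded_map (cspan (A `&` [set i | Q i]) x) (cspan A x) U ->
   forall v, cspan (A `&` [set i | Q i]) x v -> G v = U v.
  move=> bG GU bUU; apply: (bounded_maps_eq hA _ bUU).
    exact: bounded_map_sub (subI Q) (@subset_refl _ _) bG.
  by move=> i [Ai Qi]; exact: GU.
exists (fun v => (T v, S v)), (fun p => p.1 + p.2); split=> //.
- exact: bounded_map_pair.
- apply: (bounded_maps_eq hA (bounded_mapT (bounded_map_pair bT bS) bU)
    (bounded_map_id (@subset_refl _ _))) => i Ai /=.
  by rewrite Tx// Sx//; case: (P i); rewrite ?addr0 ?add0r.
- move=> [u w] [/= uP wP]; have [lT _ _] := bT; have [lS _ _] := bS.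
  have uA := subI _ _ uP; have wA := subI (fun i => ~~ P i) _ wP.
  rewrite (linear_onD lT)// (linear_onD lS)//.
  have id0 (Q : pred I) : bounded_map (cspan (A `&` [set i | Q i]) x) (cspan A x) id.
    exact: bounded_map_id (subI Q).
  have z0 (Q : pred I) : bounded_map (cspan (A `&` [set i | Q i]) x) (cspan A x) (fun=> 0).
    exact: bounded_map0.
  rewrite (kill P id _ T bT _ (id0 _) u uP); last by move=> i Ai Pi; rewrite Tx// Pi.
  rewrite (kill (fun i => ~~ P i) (fun=> 0) _ T bT _ (z0 _) w wP); last first.
    by move=> i Ai /negbTE Pi; rewrite Tx// Pi.
  rewrite (kill P (fun=> 0) _ S bS _ (z0 _) u uP); last by move=> i Ai Pi; rewrite Sx// Pi.
  rewrite (kill (fun i => ~~ P i) id _ S bS _ (id0 _) w wP); last first.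
    by move=> i Ai Pi; rewrite Sx// Pi.
  by rewrite addr0 add0r.
Qed.

Lemma iso_same_norms V W (I : Type) (A : set I) (x : I -> V) (E : set V) (F : set W) T S :
  is_subspace E -> bounded_map E F T -> bounded_map F E S ->
  (forall u, E u -> S (T u) = u) -> (forall i, A i -> E (x i)) ->
  exists C, same_norms C A x (T \o x).
Proof.
move=> sE [lT ET [C hC]] [_ _ [D hD]] TS Ex; exists (C + D)%N; split=> l Al.
  have [El e] := lc_linear sE lT Ex Al.
  rewrite -e (le_trans (hC _ El))// ler_wpM2r// ler_nat leq_addr//.
have [El e] := lc_linear sE lT Ex Al.
rewrite -{1}(TS _ El) e (le_trans (hD _ _))//; first by rewrite -e; exact: ET.
by rewrite ler_wpM2r// ler_nat leq_addl.
Qed.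

Lemma closed_spanE V N (x : nat -> V) : closed_span N x = cspan (index_set N) x.
Proof.
apply/seteqP; split=> v.
  move=> /closure_eps h e /h[_ [m [a ->]] vw].
  exists [seq (a k, k) | k <- index_iota 0 m & k \in index_set N].
    rewrite /supported all_map; apply/allP => k; rewrite mem_filter => /andP[+ _].
    by move=> Jk; apply/asboolP => /=; move: Jk; rewrite inE.
  by rewrite /lc big_map big_filter.
move=> h; apply/closure_eps => e /h[l Al vl]; exists (lc x l) => //.
exists (\max_(p <- l) p.2).+1, (fun k => \sum_(p <- l | p.2 == k) p.1).
rewrite -[LHS](congr1 (lc x) (filter_predT l)).
rewrite -(lc_coefficients x xpredT Al (supported_max l)).
by apply: eq_bigl => k; rewrite andbT.
Qed.

(** The basis of a product is indexed by the disjoint union of the index sets. *)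
Lemma has_unconditional_basis_prod V W (E : set V) (F : set W) :
  seq_complete V -> seq_complete W -> is_subspace E -> is_subspace F ->
  seq_closed E -> seq_closed F ->
  has_unconditional_basis E -> has_unconditional_basis F ->
  has_unconditional_basis (E `*` F).
Proof.
move=> cV cW sE sF cE cF [N [x ubx]] [N' [y uby]].
have [M ux] := basis_unconditional hA hK cV sE cE ubx.
have [M' uy] := basis_unconditional hA hK cW sF cF uby.
have x0 := basis_neq0 sE ubx; have y0 := basis_neq0 sF uby.
have spx := basis_cspan sE cE ubx; have spy := basis_cspan sF cF uby.
pose A := [set i : nat + nat | match i with
  | inl k => index_set N k | inr k => index_set N' k end].
pose z (i : nat + nat) : V * W := match i with inl k => (x k, 0) | inr k => (0, y k) end.
pose left_ (l : seq (K * (nat + nat))) :=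
  pmap (fun p => if p.2 is inl k then Some (p.1, k) else None) l.
pose right_ (l : seq (K * (nat + nat))) :=
  pmap (fun p => if p.2 is inr k then Some (p.1, k) else None) l.
have lcz l : lc z l = (lc x (left_ l), lc y (right_ l)).
  elim: l => [|[c [k|k]] l IH]; first by rewrite /= !lc_nil.
    by rewrite lc_cons IH /= lc_cons /z; congr pair => /=; rewrite scaler0 add0r.
  by rewrite lc_cons IH /= lc_cons /z; congr pair => /=; rewrite scaler0 add0r.
have sup l : supported A l ->
    supported (index_set N) (left_ l) /\ supported (index_set N') (right_ l).
  elim: l => [|[c [k|k]] l IH] //= /andP[/asboolP Ak /IH[h1 h2]]; split=> //=.
    by rewrite h1 andbT; exact/asboolP.
  by rewrite h2 andbT; exact/asboolP.
have uz : unconditional (M + M') A z.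
  move=> P l Al; have [h1 h2] := sup l Al.
  have -> : lc z [seq p <- l | P p.2] =
      (lc x [seq p <- left_ l | P (inl p.2)], lc y [seq p <- right_ l | P (inr p.2)]).
    rewrite lcz; congr pair.
      by congr lc; elim: l {Al h1 h2} => [|[c [k|k]] l IH] //=; case: ifP => //= _; rewrite IH.
    by congr lc; elim: l {Al h1 h2} => [|[c [k|k]] l IH] //=; case: ifP => //= _; rewrite IH.
  apply: norm_pair_le => /=.
    rewrite (le_trans (ux (fun k => P (inl k)) _ h1))// ler_pM// ?ler_nat ?leq_addr//.
    by rewrite lcz; exact: (norm_fst_le (_, _)).
  rewrite (le_trans (uy (fun k => P (inr k)) _ h2))// ler_pM// ?ler_nat ?leq_addl//.
  by rewrite lcz; exact: (norm_snd_le (_, _)).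
have z0 i : A i -> z i != 0.
  by case: i => k /= Ak; apply/eqP => -[/eqP]; apply/negP; [exact: x0|exact: y0].
have spz : cspan A z = E `*` F.
  apply/seteqP; split.
    apply: cspan_min.
    - exact: subspace_setX.
    - move=> w hw; split; [apply: cE|apply: cF] => e /hw[p [p1 p2] wp].
        by exists p.1 => //; apply: le_trans wp; exact: (norm_fst_le (w - p)).
      by exists p.2 => //; apply: le_trans wp; exact: (norm_snd_le (w - p)).
    - move=> [k|k] /= Ak; split=> /=.
      + by case: ubx => -[h _] _; exact: h.
      + by case: sF.
      + by case: sE.
      + by case: uby => -[h _] _; exact: h.
  move=> [u w] [/= Eu Fw] e e0.
  move: Eu; rewrite -spx => /(_ _ e0)[l Al ul].
  move: Fw; rewrite -spy => /(_ _ e0)[l' Al' wl].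
  exists ([seq (p.1, inl p.2) | p <- l] ++ [seq (p.1, inr p.2) | p <- l']).
    rewrite supported_cat (supported_map (A := index_set N))//=.
    exact: (supported_map (A := index_set N')).
  have leftK (s t : seq (K * nat)) :
      left_ ([seq (p.1, inl p.2) | p <- s] ++ [seq (p.1, inr p.2) | p <- t]) = s.
    by elim: s => [|[c k] s IH] /=; [elim: t|rewrite IH].
  have rightK (s t : seq (K * nat)) :
      right_ ([seq (p.1, inl p.2) | p <- s] ++ [seq (p.1, inr p.2) | p <- t]) = t.
    by elim: s => [|[c k] s IH] //=; elim: t => [|[c k] t IH] //=; rewrite IH.
  rewrite lcz leftK rightK.
  exact: norm_pair_le.
have [N'' [e be]] := countable_enumeration A (inl 0%N).
exists N'', (z \o e); rewrite -spz.
apply: (enumerated_family_basis hA hK _ uz z0 be).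
exact: seq_complete_prod.
Qed.

End BasesAndSubspaces.

(** * Spaces of finite genus *)

Section GenusSpaces.
Variables (K : numFieldType) (X : completeNormedModType K).
Hypotheses (hA : archimedean_norm K) (hK : seq_complete K).

Let cX : seq_complete X := @complete_seq K X.
Let T0 := [set: X].

Let complemented_sub (F : set X) : complemented T0 F -> is_subspace F.
Proof. exact: complemented_subspace (subspaceT X). Qed.

Let complemented_cl (F : set X) : complemented T0 F -> seq_closed F.
Proof. by apply: complemented_closed => //; exact: subspaceT. Qed.

(** Transporting the basis of one span to the other and normalizing it gives a
    second normalized basis, which uniqueness compares with the given one. *)
Lemma isomorphic_spans_embeds (x : nat -> X) (S S' : set nat) :
  normalized_unconditional x -> infinite_set S -> infinite_set S' ->
  unique_normalized_unconditional_basis (cspan S' x) ->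
  iso (cspan S x) (cspan S' x) -> embeds x S S'.
Proof.
move=> [nx [M ux]] iS iS' [_ uniq] [T [U [bT bU TU UT]]].
have [e ie eS] := infinite_enumeration iS.
have [e' ie' eS'] := infinite_enumeration iS'.
have nz k : x k != 0 by rewrite -normr_eq0 nx oner_eq0.
have basis (f : nat -> nat) B : injective f -> range f = B ->
    unconditional_basis (cspan B x) None (x \o f).
  move=> if_ fB; apply: (enumerated_family_basis hA hK cX (M := M)).
  - exact: unconditional_sub ux.
  - by move=> *; exact: nz.
  - split; first by move=> i _; rewrite -fB; exists i.
      by move=> i j _ _; exact: if_.
    by rewrite -fB.
have sS : is_subspace (cspan S x) by exact: cspan_subspace.
have sS' : is_subspace (cspan S' x) by exact: cspan_subspace.
have cS' : seq_closed (cspan S' x) by exact: cspan_closed.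
pose y := T \o (x \o e).
have by_ : unconditional_basis (cspan S' x) None y.
  exact: (unconditional_basis_iso sS bT bU TU UT (basis _ _ ie eS)).
have [M' uy] := basis_unconditional hA hK cX sS' cS' by_.
have y0 := basis_neq0 sS' by_.
have spy := basis_cspan sS' cS' by_.
have Se i : S (e i) by rewrite -eS; exists i.
have [C xy] : exists C, same_norms C [set: nat] (x \o e) y.
  by apply: (iso_same_norms (x := x \o e) sS bT bU TU) => i _; exact: cspan_mem.
pose y' k := `|y k|^-1 *: y k.
have yy' : same_norms (C * M') [set: nat] y y'.
  apply: same_norms_normalize uy _ => i _.
  have sup : supported [set: nat] [:: (1 : K, i)] by exact: supportedT.
  have := proj1 xy _ sup; have := proj2 xy _ sup.
  by rewrite !lc_cons !lc_nil !scale1r !addr0 /= nx mulr1; split.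
have by' : normalized_unconditional_basis (cspan S' x) None y'.
  split; last first.
    move=> k _; rewrite normrZ ger0_norm ?invr_ge0// mulVf//.
    by rewrite normr_eq0 y0.
  have -> : cspan S' x = cspan (index_set None) y'.
    rewrite -spy; apply/seteqP; split; apply: cspan_min;
      try exact: cspan_subspace; try exact: cspan_closed; move=> k _.
      have -> : y k = `|y k| *: y' k.
        by rewrite scalerA mulfV ?scale1r// normr_eq0 y0.
      by apply: (subspaceZ _ (@cspan_subspace _ hA _ _ _ _)); exact: cspan_mem.
    by apply: (subspaceZ _ (@cspan_subspace _ hA _ _ _ _)); exact: cspan_mem.
  apply: (family_basis hA hK cX (M := M')); first exact: unconditional_scale.
  move=> k _; rewrite scaler_eq0 negb_or y0// andbT invr_eq0.
  by rewrite normr_eq0 y0.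
have bz : normalized_unconditional_basis (cspan S' x) None (x \o e').
  by split; [exact: basis|move=> k _; exact: nx].
have [_ [pi [[_ ipi _] [P [isoP Py]]]]] := uniq _ _ _ _ by' bz.
rewrite !closed_spanE in isoP.
have sy' : is_subspace (cspan (index_set None) y') by exact: cspan_subspace.
have [Q [bP bQ PQ _]] := is_isomorphism_bounded hA sy' isoP.
have [D y'z] : exists D, same_norms D [set: nat] y' (P \o y').
  by apply: (iso_same_norms (x := y') sy' bP bQ PQ) => i _; exact: cspan_mem.
have {}y'z : same_norms D [set: nat] y' (x \o e' \o pi).
  by apply: (eq_same_norms _ _ y'z) => // i _; exact: Py.
have xz := same_norms_trans (same_norms_trans xy yy') y'z.
have [g ge] := @left_inverse_on _ _ [set: nat] e 0%N (in2W ie).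
have eg k : S k -> e (g k) = k by rewrite -eS => -[i _ <-]; rewrite ge.
exists (e' \o pi \o g); eexists; split.
- move=> i j; rewrite !inE => Si Sj /= /ie' h.
  have : g i = g j by apply: ipi h; rewrite inE.
  by move=> /(congr1 e); rewrite !eg.
- by move=> i _; rewrite -eS'; exists (pi (g i)).
- apply: (eq_same_norms (x := x \o e \o g) (y := x \o e' \o pi \o g)).
  + by move=> i Si /=; rewrite eg.
  + by [].
  + exact: (same_norms_reindex (e := g) _ xz).
Qed.

Lemma genus_subspace_complemented (E F : set X) : is_subspace E ->
  complemented T0 E -> genus_subspace E F -> genus_subspace T0 F.
Proof.
move=> sE cE [EF uF nF]; split=> //.
exact: complemented_trans (subspaceT X) cE EF.
Qed.

Lemma genus_subspace_basis n (F : set X) : genus n T0 -> genus_subspace T0 F ->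
  exists x : nat -> X, normalized_unconditional x /\ cspan [set: nat] x = F.
Proof.
move=> [_ uX _] [cF uF nF]; have sF := complemented_sub cF.
have clF := complemented_cl cF.
have [[N [x [bx nx]]] _] := uX F cF uF.
case: N bx nx => [m|] bx nx.
  by case: nF; exact: finite_basis_finite_dimensional bx.
exists x; split; last exact: (basis_cspan sF clF bx).
split; first by move=> k; exact: nx.
exact: (basis_unconditional hA hK cX sF clF bx).
Qed.

(** The type of S is the isomorphism class of its span, which is one of the n
    classes because the span is complemented. *)
Lemma genus_subspace_finitely_many_types n (x : nat -> X) :
  genus n T0 -> complemented T0 (cspan [set: nat] x) ->
  normalized_unconditional x -> finitely_many_types n x.
Proof.
move=> [_ uX [Y [gY _ covY]]] cF nux; have [nx [M ux]] := nux.
have nz k : x k != 0 by rewrite -normr_eq0 nx oner_eq0.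
have sub S : complemented T0 (cspan S x).
  apply: complemented_trans (subspaceT X) cF _ => //.
  exact: complemented_subfamily ux _.
have gS S : infinite_set S -> genus_subspace T0 (cspan S x).
  move=> iS; split=> //.
    have [N [e be]] := countable_enumeration S 0%N.
    exists N, (x \o e); apply: (enumerated_family_basis hA hK cX (M := M)) be.
      exact: unconditional_sub ux.
    by move=> *; exact: nz.
  apply: (infinite_family_not_finite_dimensional (M := M)) iS => //.
  exact: unconditional_sub ux.
have /choice[c hc] : forall S, exists i : nat, infinite_set S ->
    exists2 j : 'I_n, i = j & isomorphic (cspan S x) (Y j).
  move=> S; have [iS|nS] := pselect (infinite_set S); last by exists 0%N.
  by have [j Sj] := covY _ (gS S iS); exists j => _; exists j.
exists c; split; first by move=> S /hc[j ->].
move=> S S' iS iS' cSS'; apply: isomorphic_spans_embeds => //.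
  by apply: uX => //; case: (gS _ iS').
have [j cj Sj] := hc _ iS; have [j' cj' Sj'] := hc _ iS'.
have ejj' : j = j' by apply: val_inj; rewrite /= -cj -cj'.
rewrite -ejj' in Sj'.
have sS A : is_subspace (cspan A x) by exact: cspan_subspace.
move: Sj Sj' => /(isomorphicP hA _ (sS S)) h /(isomorphicP hA _ (sS S')) h'.
exact: iso_trans h (iso_sym h').
Qed.

(** F is the sum of the spans of the two halves of a partition of its basis into
    copies of that basis. *)
Lemma genus_subspace_square n (F : set X) :
  genus n T0 -> genus_subspace T0 F -> iso F (F `*` F).
Proof.
move=> gX gF; have [x [nux spx]] := genus_subspace_basis gX gF.
have cF : complemented T0 (cspan [set: nat] x) by rewrite spx; case: gF.
have types := genus_subspace_finitely_many_types gX cF nux.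
have dbl := finitely_many_types_doubling nux types.
have [s [t [C [is_ it st ns nt]]]] := doubling_partition nux dbl.
have [_ [M ux]] := nux; rewrite -spx.
have copy (f : nat -> nat) : injective f -> same_norms C [set: nat] x (x \o f) ->
    iso (cspan (range f) x) (cspan [set: nat] x).
  move=> if_ nf; rewrite -(@cspan_reindex _ hA _ _ _ [set: nat] _ f x).
    exact: iso_sym (cspan_iso hA cX cX nf).
  by split=> // i j _ _; exact: if_.
pose P k := `[< range s k >].
apply: iso_trans (cspan_split hA P cX ux) _.
have -> : [set: nat] `&` [set k | P k] = range s.
  by rewrite setTI; apply/seteqP; split=> k /asboolP.
have -> : [set: nat] `&` [set k | ~~ P k] = range t.
  by rewrite st setTI; apply/seteqP; split=> k /asboolPn.
by apply: iso_prod; exact: copy.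
Qed.

(** The classes other than that of X have an upper bound that is not X itself:
    the sum of two spaces that embed complementably in X does so too, because
    X is its own square, and is not X when X is unconditionally primary. *)
Lemma primary_upper_bound n (J : eqType) (s : seq J) (Y : J -> set X) :
  genus n T0 -> iso T0 (T0 `*` T0) -> unconditionally_primary X ->
  ~ finite_dimensional T0 ->
  (forall i, i \in s -> [/\ complemented T0 (Y i), has_unconditional_basis (Y i) &
     ~ iso T0 (Y i)]) ->
  exists W, [/\ complemented T0 W, has_unconditional_basis W, ~ iso T0 W &
    forall i, i \in s -> retract (Y i) W].
Proof.
move=> gX sqX prim nX; elim: s => [_|j s IH hY].
  have s0 : is_subspace [set 0 : X].
    by split=> // a u v -> ->; rewrite scaler0 addr0.
  have f0 : finite_dimensional [set 0 : X].
    exists 0%N, (fun=> 0); apply/seteqP; split=> [_ ->|_ [a _ <-]]; last by rewrite big_ord0.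
    by exists (fun=> 0) => //; rewrite big_ord0.
  exists [set 0]; split=> //.
  - apply: (complementedP (P := fun=> 0)) => //; exact: bounded_map0.
  - exists (Some 0%N), (fun=> 0); split; first split=> //.
      move=> _ ->; exists (fun=> 0); split=> //.
      apply/cvg_seq_lim => e e0; exists 0%N => m _.
      by rewrite big1 ?subrr ?normr0 ?ltW// => k _; rewrite scale0r.
    move=> _ a -> _ pi _; apply/cvg_seq_lim => e e0; exists 0%N => m _.
    by rewrite big1 ?subrr ?normr0 ?ltW// => k _; rewrite scaler0.
  - move=> /iso_retract X0; apply: nX.
    exact: retract_finite_dimensional s0 X0 f0.
have [i si|W [cW uW nW Ws]] := IH _; first by apply: hY; rewrite in_cons si orbT.
have [cY uY nY] := hY j (mem_head _ _).
have sW := complemented_sub cW; have sY := complemented_sub cY.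
have clW := complemented_cl cW; have clY := complemented_cl cY.
have sWY : is_subspace (W `*` Y j) by exact: subspace_setX.
have rWY : retract (W `*` Y j) T0.
  apply: retract_trans _ (iso_retract (iso_sym sqX)).
  by apply: retract_prod; apply: complemented_retract => //; exact: subspaceT.
have [H [cH isoH]] := retract_complemented sWY (subspaceT X) rWY.
exists H; split=> //.
- apply: has_unconditional_basis_iso sWY isoH _ => //.
  exact: has_unconditional_basis_prod.
- move=> XH.
  have [Z isoZ] := subspace_type_iso (ClosedSubspace sW clW).
  have [Z' isoZ'] := subspace_type_iso (ClosedSubspace sY clY).
  have XZ : iso T0 [set: (Z * Z')%type].
    rewrite -setXTT; apply: iso_trans XH _; apply: iso_trans (iso_sym isoH) _.
    exact: iso_prod.
  have [] := prim Z Z'.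
  + exact: has_unconditional_basis_iso sW isoZ uW.
  + exact: has_unconditional_basis_iso sY isoZ' uY.
  + by apply/isomorphicP => //; exact: subspaceT.
  + move=> /(isomorphicP hA _ (subspaceT X)) XZ1; apply: nW.
    exact: iso_trans XZ1 (iso_sym isoZ).
  + move=> /(isomorphicP hA _ (subspaceT X)) XZ1; apply: nY.
    exact: iso_trans XZ1 (iso_sym isoZ').
- move=> i; rewrite in_cons => /orP[/eqP ->|/Ws YW].
    apply: retract_trans _ (iso_retract isoH).
    exists (fun v => (0, v)), snd; split=> //; last exact: bounded_map_snd.
    by apply: bounded_map_pair; [exact: bounded_map0|exact: bounded_map_id].
  apply: retract_trans YW _; apply: retract_trans _ (iso_retract isoH).
  exists (fun v => (v, 0)), fst; split=> //; last exact: bounded_map_fst.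
  by apply: bounded_map_pair; [exact: bounded_map_id|exact: bounded_map0].
Qed.

(** The witness is an upper bound W of the classes other than X.  No subspace of
    W is in the class of X, as W would then be isomorphic to X by the
    decomposition method. *)
Lemma primary_genus_pred n : genus n.+1 T0 -> unconditionally_primary X ->
  exists Y, complemented T0 Y /\ genus n Y.
Proof.
move=> gX prim; have [uniqX uX [Y [gY injY covY]]] := gX.
have sub F : genus_subspace T0 F -> is_subspace F by case=> /complemented_sub.
have isoP (F G : set X) : genus_subspace T0 F -> isomorphic F G <-> iso F G.
  by move=> /sub sF; exact: isomorphicP.
have gT : genus_subspace T0 T0.
  split; first exact: complemented_refl.
    by case: uniqX => -[N [x [bx _]]] _; exists N, x.
  have [cY _ nY] := gY ord0 => fX; apply: nY.
  apply: retract_finite_dimensional fX => //.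
  by apply: complemented_retract => //; exact: subspaceT.
have sq F : genus_subspace T0 F -> iso F (F `*` F) by exact: genus_subspace_square gX.
have [_ _ nX] := gT.
have [i0 /(isoP _ _ gT) XY0] := covY _ gT.
have notX i : i != i0 -> ~ iso T0 (Y i).
  move=> ii XYi; have : i = i0.
    by apply: injY; apply/isoP => //; exact: iso_trans (iso_sym XYi) XY0.
  by move/eqP; rewrite (negbTE ii).
have [|W [cW uW nW Ws]] := @primary_upper_bound _ _ [seq i <- enum 'I_n.+1 | i != i0] Y
    gX (sq _ gT) prim nX.
  move=> i; rewrite mem_filter => /andP[/notX ? _]; split=> //; by case: (gY i).
have YW i : i != i0 -> retract (Y i) W.
  by move=> ii; apply: Ws; rewrite mem_filter ii mem_enum.
have sW := complemented_sub cW.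
exists W; split=> //; split.
- exact: uX.
- by move=> F WF; apply: uX; exact: complemented_trans (subspaceT X) cW WF.
have /choice[Z hZ] : forall j : 'I_n, exists Z, complemented W Z /\ iso (Y (lift i0 j)) Z.
  move=> j; apply: retract_complemented => //; first exact: sub.
  by apply: YW; rewrite eq_sym neq_lift.
have gZ j : genus_subspace W (Z j).
  have [cZ YZ] := hZ j; split=> //.
    by apply: has_unconditional_basis_iso YZ _; [exact: sub|case: (gY (lift i0 j))].
  have [_ _ nY] := gY (lift i0 j) => fZ; apply: nY.
  apply: retract_finite_dimensional fZ; first exact: complemented_subspace cZ.
  exact: iso_retract.
have up F : genus_subspace W F -> genus_subspace T0 F.
  exact: genus_subspace_complemented.
exists Z; split=> //.
  move=> i j /(isoP _ _ (up _ (gZ i))) ZZ; apply: (@lift_inj _ i0).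
  apply: injY; apply/isoP => //.
  exact: iso_trans (iso_trans (proj2 (hZ i)) ZZ) (iso_sym (proj2 (hZ j))).
move=> F gF; have gTF := up _ gF.
have [i /(isoP _ _ gTF) FY] := covY _ gTF.
have [j ij|ii] := unliftP i0 i.
  exists j; apply/isoP => //; rewrite ij in FY.
  exact: iso_trans FY (proj2 (hZ j)).
case: nW; rewrite ii in FY; have [cF uF nF] := gF.
have rF : retract F W by exact: complemented_retract cF.
have gW : genus_subspace T0 W.
  by split=> // fW; apply: nF; exact: retract_finite_dimensional rF fW.
apply: pelczynski => //; [exact: sq|exact: sq| |].
  apply: retract_trans rF; apply: iso_retract.
  exact: iso_trans XY0 (iso_sym FY).
by apply: complemented_retract => //; exact: subspaceT.
Qed.

(** F is sent to the span of the first m terms of a basis of G. *)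
Lemma finite_dimensional_retract n (F G : set X) :
  genus n T0 -> complemented T0 F -> has_unconditional_basis F ->
  finite_dimensional F -> genus_subspace T0 G -> retract F G.
Proof.
move=> gX cF uF fF gG; have [_ uX _] := gX.
have sF := complemented_sub cF; have clF := complemented_cl cF.
have [[N [f [bf nf]]] _] := uX F cF uF.
have [M uf] := basis_unconditional hA hK cX sF clF bf.
have f0 := basis_neq0 sF bf; have spf := basis_cspan sF clF bf.
case: N bf nf uf f0 spf => [m|] bf nf uf f0 spf; last first.
  by case: (infinite_family_not_finite_dimensional uf f0 infinite_nat); rewrite spf.
have [y [[ny [M' uy]] spy]] := genus_subspace_basis gX gG.
have fy : same_norms (m * (M + M')) `I_m f y.
  apply: same_norms_finite uf _ => //; first by move=> i im; rewrite nf// ny.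
  exact: unconditional_sub uy.
rewrite -spf; apply: retract_trans (iso_retract (cspan_iso hA cX cX fy)) _.
rewrite -spy; apply: complemented_retract => //; first exact: cspan_subspace.
exact: complemented_subfamily uy _.
Qed.

(** Y contains every class other than X, hence each of two summands not in the
    class of X, hence their sum, because Y is its own square. *)
Lemma genus_pred_primary n Y : genus n.+1 T0 -> complemented T0 Y -> genus n Y ->
  unconditionally_primary X.
Proof.
move=> gX cY gY U V uU uV; have sX := subspaceT X.
move=> /(isomorphicP hA _ sX) XUV.
apply: contrapT => /not_orP[nU nV].
have [uniqX uX [C [gC injC covC]]] := gX.
have [uniqY uY [D [gD injD covD]]] := gY.
have sub F : genus_subspace T0 F -> is_subspace F by case=> /complemented_sub.
have isoP (F G : set X) : genus_subspace T0 F -> isomorphic F G <-> iso F G.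
  by move=> /sub sF; exact: isomorphicP.
have sY := complemented_sub cY.
have toX F : complemented T0 F -> retract F T0.
  by move=> cF; exact: complemented_retract.
have up F : genus_subspace Y F -> genus_subspace T0 F by exact: genus_subspace_complemented.
have down F : genus_subspace T0 F -> retract F Y -> exists i, iso F (D i).
  move=> gF rF; have [F' [cF' FF']] := retract_complemented (sub _ gF) sY rF.
  have [_ uF nF] := gF.
  have gF' : genus_subspace Y F'.
    split=> //; first exact: has_unconditional_basis_iso (sub _ gF) FF' uF.
    move=> fF'; apply: nF; apply: retract_finite_dimensional (iso_retract FF') fF'.
    exact: complemented_subspace cF'.
  have [i /(isoP _ _ (up _ gF')) FD] := covD _ gF'.
  by exists i; exact: iso_trans FF' FD.
(* Otherwise the n.+1 classes of X would embed in Y, which has n of them. *)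
have XnY : ~ retract T0 Y.
  move=> XY; have /choice[f hf] : forall i, exists j, iso (C i) (D j).
    move=> i; apply: down => //; apply: retract_trans XY; apply: toX.
    by case: (gC i).
  have inj : injective f.
    move=> i j fij; apply: injC; apply/isoP => //.
    by apply: iso_trans (hf i) _; rewrite fij; exact: iso_sym.
  by have := leq_card f inj; rewrite !card_ord ltnn.
have gT : genus_subspace T0 T0.
  split; first exact: complemented_refl.
    by case: uniqX => -[N [x [bx _]]] _; exists N, x.
  have [cC _ nC] := gC ord0 => fX; apply: nC.
  by apply: retract_finite_dimensional fX => //; exact: toX.
have [i0 /(isoP _ _ gT) XC0] := covC _ gT.
have [_ _ nX] := gT.
(* The n classes of Y are then all the classes of X other than X. *)
have CY i : i != i0 -> retract (C i) Y.
  have /choice[g hg] : forall j, exists i, iso (D j) (C i).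
    move=> j; have [k /(isoP _ _ (up _ (gD j))) h] := covC _ (up _ (gD j)).
    by exists k.
  have DY j : retract (D j) Y.
    by apply: complemented_retract => //; case: (gD j).
  have g0 j : g j != i0.
    apply/eqP => gj; apply: XnY; apply: retract_trans (DY j); apply: iso_retract.
    by apply: iso_trans XC0 _; rewrite -gj; exact: iso_sym.
  have injg : injective g.
    move=> j k gjk; apply: injD; apply/(isoP _ _ (up _ (gD j))).
    by apply: iso_trans (hg j) _; rewrite gjk; exact: iso_sym.
  have im : (g @: [set: 'I_n]%SET = [set~ i0])%SET.
    apply/eqP; rewrite eqEcard; apply/andP; split.
      by apply/fintype.subsetP => _ /imsetP[j _ ->]; rewrite !inE g0.
    by rewrite card_imset// cardsT cardsC1 !card_ord.
  move=> ii; have : i \in (g @: [set: 'I_n]%SET)%SET by rewrite im !inE.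
  case/imsetP => j _ ->; apply: retract_trans (DY j); apply: iso_retract.
  exact: iso_sym.
have infY F : genus_subspace T0 F -> ~ iso T0 F -> retract F Y.
  move=> gF nF; have [i /(isoP _ _ gF) FC] := covC _ gF.
  apply: retract_trans (iso_retract FC) _; apply: CY; apply/eqP => ii.
  by apply: nF; apply: iso_trans XC0 _; rewrite -ii; exact: iso_sym.
have copy (Z : completeNormedModType K) : has_unconditional_basis [set: Z] ->
    retract [set: Z] T0 -> exists F, [/\ complemented T0 F, has_unconditional_basis F &
      iso [set: Z] F].
  move=> uZ rZ; have sZ := subspaceT Z.
  have [F [cF ZF]] := retract_complemented sZ sX rZ.
  by exists F; split=> //; exact: has_unconditional_basis_iso sZ ZF uZ.
have sUV := subspaceT (U * V)%type.
have rU : retract [set: U] T0.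
  apply: retract_trans _ (iso_retract (iso_sym XUV)).
  exists (fun v => (v, 0)), fst; split=> //; rewrite -setXTT.
    by apply: bounded_map_pair; [exact: bounded_map_id|exact: bounded_map0].
  exact: bounded_map_fst.
have rV : retract [set: V] T0.
  apply: retract_trans _ (iso_retract (iso_sym XUV)).
  exists (fun v => (0, v)), snd; split=> //; rewrite -setXTT.
    by apply: bounded_map_pair; [exact: bounded_map0|exact: bounded_map_id].
  exact: bounded_map_snd.
have [F [cF uF UF]] := copy U uU rU; have [G [cG uG VG]] := copy V uV rV.
have XFG : iso T0 (F `*` G).
  by apply: iso_trans XUV _; rewrite -setXTT; exact: iso_prod.
have nF : ~ iso T0 F.
  by move=> XF; apply: nU; apply/isomorphicP => //; exact: iso_trans XF (iso_sym UF).
have nG : ~ iso T0 G.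
  by move=> XG; apply: nV; apply/isomorphicP => //; exact: iso_trans XG (iso_sym VG).
(* Otherwise F, G and hence X would be finite-dimensional. *)
have gYX : genus_subspace T0 Y.
  have uY' : has_unconditional_basis Y.
    by case: uniqY => -[N [x [bx _]]] _; exists N, x.
  split=> // fY.
  have fin H : complemented T0 H -> has_unconditional_basis H -> ~ iso T0 H ->
      finite_dimensional H.
    move=> cH uH nH; apply: contrapT => nfH; apply: nfH.
    have [fH|nfH] := pselect (finite_dimensional H) => //.
    by apply: retract_finite_dimensional fY => //; apply: infY.
  apply: nX; apply: retract_finite_dimensional (iso_retract XFG) _.
    by apply: subspace_setX; exact: complemented_sub.
  by apply: finite_dimensional_prod; exact: fin.
have retY H : complemented T0 H -> has_unconditional_basis H -> ~ iso T0 H -> retract H Y.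
  move=> cH uH nH; have [fH|nfH] := pselect (finite_dimensional H).
    exact: finite_dimensional_retract gX cH uH fH gYX.
  exact: infY.
apply: XnY; apply: retract_trans (iso_retract XFG) _.
apply: retract_trans (iso_retract (iso_sym (genus_subspace_square gX gYX))).
by apply: retract_prod; exact: retY.
Qed.

End GenusSpaces.

Theorem proposition2p4 (R : realType) (K : numFieldType)
    (hK : scalar_field R K) (n : nat) (hn : (0 < n)%N)
    (X : completeNormedModType K) (hX : genus n [set: X]) :
  unconditionally_primary X <->
  exists Y : set X, complemented [set: X] Y /\ genus n.-1 Y.
Proof.
have hA := scalar_archimedean hK; have cK := scalar_complete hK.
case: n hn hX => // n _ hX; split; first exact: primary_genus_pred.
by move=> [Y [cY gY]]; exact: genus_pred_primary cY gY.
Qed.
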